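(* Let $P$ be a Markov kernel on a general measurable state space $\mathcal X$ with stationary probability measure $\mu$ and with $\lambda:=\lambda(P)<1$. Let $s_1,\dots,s_n$ be a Markov chain with transition kernel $P$ and initial distribution $s_1\sim\mu$. Let $F_1,\dots,F_n:\mathcal X\to\mathbb R^{d\times d}$ be measurable functions with values in the real symmetric $d\times d$ matrices such that for every $j$, $\mathbb E_\mu[F_j(x)]=0$ and $\|\mathbb E_\mu[F_j(x)^2]\|\le\mathcal V_j$ for a constant $\mathcal V_j$, and such that $\|F_j(x)\|\le\mathcal M$ for all $j$ and all $x\in\mathcal X$, where $\mathcal M>0$. Let $\sigma^2=\sum_{j=1}^n\mathcal V_j$. Then for every $0<\theta<\log(1/\lambda)/\mathcal M$ (with $\log(1/\lambda)=\infty$ if $\lambda=0$), $$\mathbb E_\mu\left[\left\|\prod_{j=1}^n\exp\left(\tfrac{\theta}{2}F_j(s_j)\right)\right\|_F^2\right]\le d\,\exp\left(\frac{\sigma^2}{\mathcal M^2}\left(e^{\mathcal M\theta}-\mathcal M\theta-1\right)+\frac{\sigma^2}{\mathcal M^2}\cdot\frac{\lambda(e^{\mathcal M\theta}-1)^2}{1-\lambda e^{\mathcal M\theta}}\right).$$ Furthermore, for every $t>0$, $$\Pr_\mu\left(\lambda_{\max}\Big(\sum_{j=1}^nF_j(s_j)\Big)\ge t\right)\le d^{2-\pi/4}\exp\left(\frac{-t^2/(32/\pi^2)}{\alpha(\lambda)\cdot\sigma^2+\beta(\lambda)\cdot\mathcal M t}\right),$$ where $\alpha(\lambda)=\frac{1+\lambda}{1-\lambda}$,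 and $\beta(\lambda)=\frac{4}{3\pi}$ if $\lambda=0$, $\beta(\lambda)=\frac{8/\pi}{1-\lambda}$ if $0<\lambda<1$.
   Context: For a Markov kernel $P$ on $\mathcal X$ with stationary probability measure $\mu$, $P$ acts on $L^2(\mu)$ by $(Ph)(x)=\int h(y)\,P(x,dy)$, and $\Pi$ is the projection $\Pi h=\mathbb E_\mu[h]\,\mathbf 1$ onto constants. Define $\lambda(P):=\sup\{\|Ph\|_{L^2(\mu)}/\|h\|_{L^2(\mu)}: h\ne0,\ \Pi h=0\}=\|P-\Pi\|_{L^2(\mu)\to L^2(\mu)}$; $P$ admits absolute spectral gap $1-\lambda(P)$ if $\lambda(P)<1$. No reversibility is assumed. The subscript $\mu$ on $\mathbb E$, $\Pr$ for chain quantities means the chain starts from $\mu$. $\prod_{j=1}^nA_j=A_1A_2\cdots A_n$ (ordered product), $\|\cdot\|_F$ is the Frobenius norm, $\|\cdot\|$ of a matrix is the spectral norm, $\lambda_{\max}$ the largest eigenvalue. *)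

(* Defs.v *)
From mathcomp Require Export all_boot all_order all_algebra.
From mathcomp Require Export all_classical all_reals all_analysis.

Set Implicit Arguments.
Unset Strict Implicit.
Unset Printing Implicit Defensive.

Export Order.TTheory GRing.Theory Num.Theory.
Export numFieldNormedType.Exports.

Local Open Scope classical_set_scope.
Local Open Scope ring_scope.

Section Matrices.
Context {R : realType}.

Definition frobenius_norm (m n : nat) (A : 'M[R]_(m, n)) : R :=
  Num.sqrt (\sum_(i < m) \sum_(j < n) A i j ^+ 2).

(* On column vectors [frobenius_norm] is the Euclidean norm, so this is the
   operator norm of A from l^2 to l^2. *)
Definition spectral_norm (m n : nat) (A : 'M[R]_(m, n)) : R :=
  sup [set frobenius_norm (A *m v) | v in
       [set v : 'cV[R]_n | frobenius_norm v <= 1]].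

(* The set of real eigenvalues is finite; it is nonempty when A is symmetric
   and n > 0, and its supremum is then the largest eigenvalue. *)
Definition lambda_max (n : nat) (A : 'M[R]_n) : R :=
  sup [set a : R | eigenvalue A a].

Definition expmx (n : nat) (A : 'M[R]_n) : 'M[R]_n :=
  limn (series (fun k : nat => (k`!%:R^-1 : R) *: A ^+ k)).

Definition mx_expectation {disp : measure_display} {T : measurableType disp}
    (mu : probability T R) (m n : nat) (G : T -> 'M[R]_(m, n)) :
    'M[R]_(m, n) :=
  \matrix_(i < m, j < n) \int[mu]_x (G x i j).

End Matrices.

Section Kernels.
Context {disp : measure_display} {T : measurableType disp} {R : realType}.
Implicit Types (P : R.-pker T ~> T) (mu : probability T R).

Definition stationary P mu : Prop :=
  forall A : set T, measurable A -> (\int[mu]_x P x A = mu A)%E.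

(* For h in L^2(mu), mu stationary, the integral is finite for mu-almost
   every x; the values at the remaining points do not affect any norm. *)
Definition kernel_op P (h : T -> R) : T -> \bar R :=
  fun x => (\int[P x]_y (h y)%:E)%E.

(* The condition E_mu[h] = 0 is Pi h = 0, and h != 0 in L^2(mu) is expressed by
   the norm. The maximum with 0 matters only when L^2(mu) consists of the
   constants: there is then no such h, so the supremum is -oo, while
   || P - Pi || = 0. *)
Definition kernel_lambda P mu : \bar R :=
  (maxe 0 (ereal_sup
    [set 'N[mu]_2%:E [kernel_op P h] / 'N[mu]_2%:E [EFin \o h] | h in
     [set h : T -> R | [/\ h \in Lfun mu 2%:E,
                           'N[mu]_2%:E [EFin \o h] != 0 &
                           'E_mu[h] = 0]]]))%E.

Context {disp' : measure_display} {Omega : measurableType disp'}.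
Implicit Types (Pr : probability Omega R).

Definition chain_past (n : nat) (s : 'I_n -> {mfun Omega >-> T}) (j : 'I_n) :
    set (set Omega) :=
  <<s \bigcup_(i in [set i : 'I_n | (i <= j)%N])
        preimage_set_system setT (s i) measurable >>.

(* Indices start at 0. The second condition says that
   Pr(s_(j+1) \in B | s_0, ..., s_j) = P (s_j, B) almost surely. *)
Definition markov_chain Pr P mu (n : nat) (s : 'I_n -> {mfun Omega >-> T}) :
    Prop :=
  (forall i : 'I_n, i = 0%N :> nat ->
     forall A, measurable A -> Pr (s i @^-1` A) = mu A) /\
  (forall j k : 'I_n, k = j.+1 :> nat ->
     forall (G : set Omega) (B : set T), chain_past s j G -> measurable B ->
       Pr (G `&` s k @^-1` B) = (\int[Pr]_(w in G) P (s j w) B)%E).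

End Kernels.

Section Constants.
Context {R : realType}.

Definition alpha_gap (lam : R) : R := (1 + lam) / (1 - lam).

Definition beta_gap (lam : R) : R :=
  if lam == 0 then 4 / (3 * pi) else (8 / pi) / (1 - lam).

End Constants.

(* Main.v *)
(** First inequality. Expanding |L|_F^2 = tr (L L^T) and integrating the chain
    out from its end alternates the maps X |-> E_mu[exp(B) X exp(B)^T] with the
    Markov operator, for B = (theta/2) F_j. The matrix-valued function obtained is
    split into its mean, of norm a, and a mean-zero part, of L^2 norm at most
    sqrt(lam) c; on (a, c) one step acts as a symmetric 2 x 2 matrix whose norm is
    at most 1 + (V_j/M^2) (e^(M theta) - 1 - M theta + lam (e^(M theta) - 1)^2
    / (1 - lam e^(M theta))).

    Tail. No multi-matrix Golden-Thompson inequality is used. If the sum of the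
    F_j(s_j) has the unit eigenvector v for an eigenvalue at least t, then
    f(z) = v (prod_j exp(z theta F_j/2)) v^T satisfies f(0) = 1,
    f'(0) >= theta t/2 and |f| <= 1 on the imaginary axis. A Carleman-type
    inequality in the right half disc bounds (2/pi) (p(0) + (pi/4) p'(0)) by the
    mean of Re p(e^(ix)) cos x over [0, pi/2], whenever Re p <= p(0) on the
    imaginary axis. It is applied to p = (f E)^2, where E is a multiplier with
    E(0) = 1, |E| = 1 on the imaginary axis, |E|^2 close to exp(-theta t pi/4) on
    the arc and p'(0) >= 0; the mean of |f(e^(ix))|^2 is controlled by the first
    inequality, because multiplying F_j by e^(ix) preserves all the norms. This
    gives Pr(..) <= d exp(..) exp(-theta t pi/4), and theta is then optimised.
    Exponentials are replaced by Taylor polynomials, and limits are taken last. *)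

Require Import Defs.
From HB Require Import structures.
From mathcomp Require Import ring lra measurable_realfun complex polyrcf uniform_distribution.

Set Implicit Arguments.
Unset Strict Implicit.
Unset Printing Implicit Defensive.

Local Open Scope classical_set_scope.
Local Open Scope ring_scope.

(** * Means of bounded measurable functions *)

(** The half disc suits the problem because its two boundary pieces ask for different things. On the
    imaginary axis the factors exp(iy theta F_j/2) are unitary, whatever the outcome of the chain;
    on the arc only a mean over the angle is needed, and such a mean commutes with the expectation.
    Squaring f E produces |f|^2, the quantity that the first inequality controls. The number pi/4
    comes from the multiplier E = exp(-(s/2) q). The ideal q has real part 1 on the arc and 0 on the
    axis, which forces q'(0) = 4/pi; then s = theta t pi/4 is the largest value for which (s/2)
    q'(0) does not exceed the guaranteed slope theta t/2 of f. With polynomials, the Carleman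
    inequality is a finite identity between coefficients. The price is that truncated exponentials
    are not exactly unitary on the axis; their defect has to be O(y^2), since the axis carries a
    weight y^(-2). Rotation by e^(ix) destroys the symmetry of F_j, so the one-step estimate is
    proved for general matrices, under bounds on a matrix and its transpose. *)

Section BoundedMeasurable.
Context {disp : measure_display} {T : measurableType disp} {R : realType}.
Implicit Types (f g : T -> R) (mu : probability T R).

Definition bounded_measurable f : Prop :=
  measurable_fun [set: T] f /\ exists K, forall x, `|f x| <= K.

Lemma bm_cst r : bounded_measurable (fun=> r).
Proof. by split; [exact: measurable_cst | exists `|r|]. Qed.

Lemma bmD f g : bounded_measurable f -> bounded_measurable g ->
  bounded_measurable (fun x => f x + g x).
Proof.
move=> [mf [K fK]] [mg [L gL]]; split; first exact: measurable_funD.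
by exists (K + L) => x; rewrite (le_trans (ler_normD _ _))// lerD.
Qed.

Lemma bmM f g : bounded_measurable f -> bounded_measurable g ->
  bounded_measurable (fun x => f x * g x).
Proof.
move=> [mf [K fK]] [mg [L gL]]; split; first exact: measurable_funM.
by exists (K * L) => x; rewrite normrM ler_pM.
Qed.

Lemma bmZ r f : bounded_measurable f -> bounded_measurable (fun x => r * f x).
Proof. by move=> bf; apply: bmM => //; exact: bm_cst. Qed.

Lemma bmB f g : bounded_measurable f -> bounded_measurable g ->
  bounded_measurable (fun x => f x - g x).
Proof.
move=> bf bg; have := bmD bf (bmZ (-1) bg).
by under eq_fun do rewrite mulN1r.
Qed.

Lemma bm_sum (I : Type) (r : seq I) (p : pred I) (f : I -> T -> R) :
  (forall i, bounded_measurable (f i)) ->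
  bounded_measurable (fun x => \sum_(i <- r | p i) f i x).
Proof.
move=> bf; elim: r => [|i r IH].
  by under eq_fun do rewrite big_nil; exact: bm_cst.
under eq_fun do rewrite big_cons.
by case: (p i) => //; exact: bmD.
Qed.

Lemma bm_integrable mu f : bounded_measurable f -> mu.-integrable setT (EFin \o f).
Proof.
move=> [mf [K fK]]; apply: measurable_bounded_integrable => //.
  by rewrite -ge0_fin_numE// fin_num_measure.
by exists K; split; [exact: num_real | move=> y Ky x _ /=; rewrite (le_trans (fK x))// ltW].
Qed.

Lemma bm_indic (A : set T) : measurable A -> bounded_measurable (\1_A : T -> R).
Proof.
move=> mA; split; first exact: measurable_indic.
by exists 1 => x; rewrite indicE; case: (_ \in _); rewrite ?normr1 ?normr0.
Qed.

Lemma meanD mu f g : bounded_measurable f -> bounded_measurable g ->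
  \int[mu]_x (f x + g x) = \int[mu]_x f x + \int[mu]_x g x.
Proof. by move=> bf bg; rewrite RintegralD//; exact: bm_integrable. Qed.

Lemma meanB mu f g : bounded_measurable f -> bounded_measurable g ->
  \int[mu]_x (f x - g x) = \int[mu]_x f x - \int[mu]_x g x.
Proof. by move=> bf bg; rewrite RintegralB//; exact: bm_integrable. Qed.

Lemma meanZ mu r f : bounded_measurable f ->
  \int[mu]_x (r * f x) = r * \int[mu]_x f x.
Proof. by move=> bf; rewrite RintegralZl//; exact: bm_integrable. Qed.

Lemma mean_cst mu r : \int[mu]_x r = r :> R.
Proof.
rewrite Rintegral_cst// [X in fine X](_ : _ = 1%E) ?mulr1//; exact: probability_setT.
Qed.

Lemma mean_sum mu (I : Type) (r : seq I) (p : pred I) (f : I -> T -> R) :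
  (forall i, bounded_measurable (f i)) ->
  \int[mu]_x (\sum_(i <- r | p i) f i x) = \sum_(i <- r | p i) \int[mu]_x f i x.
Proof.
move=> bf; elim: r => [|i r IH].
  by under eq_Rintegral do rewrite big_nil; rewrite big_nil mean_cst.
under eq_Rintegral do rewrite big_cons.
rewrite big_cons; case: (p i) => //; rewrite meanD ?IH//.
exact: bm_sum.
Qed.

Lemma mean_le mu f g : bounded_measurable f -> bounded_measurable g ->
  (forall x, f x <= g x) -> \int[mu]_x f x <= \int[mu]_x g x.
Proof. by move=> bf bg fg; apply: le_Rintegral => //; exact: bm_integrable. Qed.

Lemma mean_ge0 mu f : (forall x, 0 <= f x) -> 0 <= \int[mu]_x f x.
Proof. by move=> f0; exact: Rintegral_ge0. Qed.

Lemma mean_norm_le mu f K : bounded_measurable f ->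
  (forall x, `|f x| <= K) -> `|\int[mu]_x f x| <= K.
Proof.
move=> bf fK; have fK' x : - K <= f x <= K by rewrite -ler_norml.
rewrite ler_norml -{2}(mean_cst mu K) -(mean_cst mu (- K)).
apply/andP; split; apply: mean_le => //; try exact: bm_cst.
  by move=> x; have /andP[] := fK' x.
by move=> x; have /andP[] := fK' x.
Qed.

Lemma mean_EFin mu f : bounded_measurable f ->
  (\int[mu]_x (f x)%:E)%E = (\int[mu]_x f x)%:E.
Proof.
move=> bf; rewrite /Rintegral fineK//.
apply: (integrable_fin_num measurableT); exact: (bm_integrable mu bf).
Qed.

Lemma mean_indic mu (A : set T) : measurable A ->
  \int[mu]_x (\1_A x : R) = fine (mu A).
Proof. by move=> mA; rewrite /Rintegral integral_indic// setIT. Qed.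

(* A linear functional continuous for the uniform norm is determined by its
   values on indicators: f is uniformly approximated by
   N^-1 sum_(1 <= i <= C) 1_(f >= i/N - K). *)
Lemma bm_functional_eq0 (Lam : (T -> R) -> R) (C : R) :
  (forall f g, bounded_measurable f -> bounded_measurable g ->
     Lam (fun x => f x + g x) = Lam f + Lam g) ->
  (forall r f, bounded_measurable f -> Lam (fun x => r * f x) = r * Lam f) ->
  (forall f K, bounded_measurable f -> (forall x, `|f x| <= K) ->
     `|Lam f| <= C * K) ->
  (forall A, measurable A -> Lam \1_A = 0) ->
  forall f, bounded_measurable f -> Lam f = 0.
Proof.
move=> LD LZ LC L1 f bf; have [mf [K fK]] := bf.
have C0 : 0 <= C.
  have := LC (fun=> 0) 1 (bm_cst 0).
  rewrite mulr1 normr0 => /(_ (fun=> ler01)).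
  exact: le_trans.
have Lsum (n : nat) (h : nat -> T -> R) : (forall i, bounded_measurable (h i)) ->
    (forall i, Lam (h i) = 0) -> Lam (fun x => \sum_(i < n) h i x) = 0.
  move=> bh h0; elim: n => [|n IH].
    under eq_fun do rewrite big_ord0.
    by have := LZ 0 (fun=> 0) (bm_cst 0); rewrite !mul0r.
  under eq_fun do rewrite big_ord_recr /=.
  rewrite LD// ?IH ?h0 ?addr0//; exact: bm_sum.
have K0 : 0 <= K by rewrite (le_trans _ (fK point)).
apply/eqP; rewrite -normr_le0; apply/ler_addgt0Pl => e e0; rewrite addr0.
have [N N0 Ne] : exists2 N : nat, (0 < N)%N & C * N%:R^-1 <= e.
  exists (Num.truncn (C / e)).+1 => //.
  rewrite ler_pdivrMr ?ltr0n// mulrC -ler_pdivrMr//.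
  by rewrite ltW// truncnS_gt.
pose S := (Num.truncn (N%:R * (2 * K))).+1.
pose A (i : nat) := [set x | i.+1%:R <= N%:R * (f x + K)].
have NR0 : 0 < N%:R :> R by rewrite ltr0n.
have mA i : measurable (A i).
  have mg : measurable_fun setT (fun x => N%:R * (f x + K)).
    by apply: measurable_funM => //; apply: measurable_funD.
  rewrite /A; have := mg measurableT `[i.+1%:R, +oo[%classic (measurable_itv _).
  rewrite setTI; congr measurable; apply/seteqP; split=> x /=;
    by rewrite in_itv /= andbT.
pose g x := N%:R^-1 * \sum_(i < S) (\1_(A i) x : R).
have bg : bounded_measurable g.
  by apply: bmZ; apply: bm_sum => i; exact: bm_indic.
have Lg : Lam g = 0.
  rewrite LZ; last by apply: bm_sum => i; exact: bm_indic.
  by rewrite (Lsum _ (fun i => \1_(A i)))// ?mulr0// => i;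
    [exact: bm_indic | exact: L1].
have close x : `|f x + K - g x| <= N%:R^-1.
  have y0 : 0 <= N%:R * (f x + K).
    by rewrite mulr_ge0//; have := fK x; rewrite ler_norml => /andP[]; lra.
  have yS : N%:R * (f x + K) < S%:R.
    rewrite (@le_lt_trans _ _ (N%:R * (2 * K)))// ?truncnS_gt//.
    by rewrite ler_pM2l//; have := fK x; rewrite ler_norml => /andP[]; lra.
  have gE : g x = N%:R^-1 * (Num.truncn (N%:R * (f x + K)))%:R.
    rewrite /g; congr (_ * _).
    have tS : (Num.truncn (N%:R * (f x + K)) <= S)%N.
      by rewrite ltnW// -(@ltr_nat R) (le_lt_trans _ yS)// truncn_le.
    rewrite (eq_bigr (fun i : 'I_S => ((i < Num.truncn (N%:R * (f x + K)))%N)%:R)).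
      rewrite -natr_sum; congr _%:R.
      rewrite -[RHS]card_ord -sum1_card.
      rewrite -[LHS]/(\sum_(i < S) nat_of_bool _)%N -big_mkcond /=.
      by rewrite (big_ord_narrow tS).
    move=> i _; rewrite indicE; congr (nat_of_bool _)%:R.
    apply/idP/idP; rewrite inE /A /=.
      by rewrite truncn_ge_nat.
    by rewrite truncn_ge_nat.
  have -> : f x + K - g x = N%:R^-1 * (N%:R * (f x + K) - (Num.truncn (N%:R * (f x + K)))%:R).
    by rewrite gE mulrBr mulrA mulVf ?mul1r// gt_eqF.
  rewrite normrM ger0_norm ?invr_ge0// ler_piMr ?invr_ge0//.
  have /andP[h1 h2] := truncn_itv y0.
  rewrite ger0_norm ?subr_ge0// lerBlDl.
  by rewrite -natr1 in h2; exact: ltW.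
have LK : Lam (fun=> K) = 0.
  have := LZ K \1_setT (bm_indic measurableT); rewrite L1// mulr0 => <-.
  by congr Lam; apply/funext => x; rewrite indicT mulr1.
have bK := bm_cst K.
have -> : Lam f = Lam (fun x => f x + K - g x).
  rewrite (LD (fun x => f x + K) (fun x => - g x)); last 2 first.
  - exact: bmD.
  - by under eq_fun do rewrite -mulN1r; exact: bmZ.
  rewrite LD// LK addr0.
  have -> : (fun x => - g x) = (fun x => -1 * g x) by apply/funext => x; rewrite mulN1r.
  by rewrite LZ// Lg mulr0 addr0.
rewrite (le_trans _ Ne)// LC//.
by apply: bmB => //; exact: bmD.
Qed.

End BoundedMeasurable.

(** * The Markov operator on bounded functions and its spectral gap *)

Section KernelMean.
Context {disp : measure_display} {T : measurableType disp} {R : realType}.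
Variable P : R.-pker T ~> T.
Implicit Types (f g : T -> R) (mu : probability T R).

(* [P x] is inferred only as a measure; the alias carries the probability
   structure. *)
Definition kernel_prob (x : T) : set T -> \bar R := P x.
HB.instance Definition _ x := Measure.on (kernel_prob x).
HB.instance Definition _ x :=
  Measure_isProbability.Build _ _ _ (kernel_prob x) (prob_kernel x).

Definition kernel_mean f (x : T) : R := \int[kernel_prob x]_y f y.

Lemma kernel_mean_norm_le f K : bounded_measurable f ->
  (forall x, `|f x| <= K) -> forall x, `|kernel_mean f x| <= K.
Proof. by move=> bf fK x; exact: mean_norm_le. Qed.

Lemma bm_kernel_mean f : bounded_measurable f -> bounded_measurable (kernel_mean f).
Proof.
move=> bf; have [mf [K fK]] := bf; split; last first.
  by exists K => x; exact: kernel_mean_norm_le.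
(* [measurable_fun_integral_kernel] takes nonnegative integrands, hence the shift by [K]; it comes
   off again because [P x] has mass 1. *)
have bfK : bounded_measurable (fun x => f x + K) by apply: bmD => //; exact: bm_cst.
have -> : kernel_mean f = (fun x => fine (\int[P x]_y (f y + K)%:E)%E - K).
  apply/funext => x; rewrite -[X in fine X]/(\int[kernel_prob x]_y (f y + K)%:E)%E.
  by rewrite mean_EFin//= meanD ?mean_cst ?addrK//; exact: bm_cst.
apply: measurable_funB => //; apply: measurableT_comp => //.
apply: (@measurable_fun_integral_kernel _ _ _ _ _ P).
- by move=> U mU; exact: measurable_kernel.
- by move=> x; rewrite lee_fin; have := fK x; rewrite ler_norml => /andP[]; lra.
- by apply/measurable_EFinP; have [] := bfK.
Qed.

Lemma kernel_meanD f g x : bounded_measurable f -> bounded_measurable g ->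
  kernel_mean (fun y => f y + g y) x = kernel_mean f x + kernel_mean g x.
Proof. by move=> bf bg; exact: meanD. Qed.

Lemma kernel_meanZ r f x : bounded_measurable f ->
  kernel_mean (fun y => r * f y) x = r * kernel_mean f x.
Proof. by move=> bf; exact: meanZ. Qed.

(** [stationary] speaks of sets only. The difference of the two means is a linear functional of norm
    at most 2 that vanishes on indicators, so [bm_functional_eq0] applies. *)
Lemma mean_kernel_mean mu f : stationary P mu -> bounded_measurable f ->
  \int[mu]_x kernel_mean f x = \int[mu]_x f x.
Proof.
move=> st bf; apply/eqP; rewrite -subr_eq0; apply/eqP.
apply: (bm_functional_eq0 (Lam := fun f => \int[mu]_x kernel_mean f x - \int[mu]_x f x)
  (C := 2)) => //.
- move=> g h bg bh; rewrite (@eq_Rintegral _ _ _ mu setT (fun x => kernel_mean g x + kernel_mean h x)).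
    by rewrite !meanD//; [ring | exact: bm_kernel_mean | exact: bm_kernel_mean].
  by move=> x _; rewrite kernel_meanD.
- move=> r g bg; rewrite (@eq_Rintegral _ _ _ mu setT (fun x => r * kernel_mean g x)).
    by rewrite !meanZ//; [ring | exact: bm_kernel_mean].
  by move=> x _; rewrite kernel_meanZ.
- move=> g K bg gK; rewrite (le_trans (ler_normB _ _))// mulr_natl mulr2n lerD//.
    by apply: mean_norm_le; [exact: bm_kernel_mean | exact: kernel_mean_norm_le].
  exact: mean_norm_le.
- move=> A mA; rewrite mean_indic//.
  rewrite -(st _ mA) [X in X - _](_ : _ = fine (\int[mu]_x P x A)%E) ?subrr//.
  congr fine; apply: eq_integral => x _; rewrite /kernel_mean mean_indic//.
  rewrite fineK//; apply: fin_num_measure => //.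
Qed.

(** Nonnegativity of the variance of [f] under [P x]. *)
Lemma kernel_mean_sqr_le f x : bounded_measurable f ->
  kernel_mean f x ^+ 2 <= kernel_mean (fun y => f y ^+ 2) x.
Proof.
move=> bf; set c := kernel_mean f x.
have bf2 : bounded_measurable (fun y => f y ^+ 2).
  by under eq_fun do rewrite expr2; exact: bmM.
have : 0 <= \int[kernel_prob x]_y (f y ^+ 2 - (2 * c) * f y + c ^+ 2).
  by apply: mean_ge0 => y; have := sqr_ge0 (f y - c); rewrite sqrrB; lra.
rewrite meanD ?meanB ?meanZ ?mean_cst//.
all: try exact: bm_cst; try exact: bmZ; try by apply: bmB => //; exact: bmZ.
rewrite -/(kernel_mean f x) -/c -/(kernel_mean (fun y => f y ^+ 2) x); nra.
Qed.

Lemma Lnorm2E mu f : bounded_measurable f ->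
  ('N[mu]_2%:E [EFin \o f] = (Num.sqrt (\int[mu]_x (f x ^+ 2)))%:E)%E.
Proof.
move=> bf.
have bf2 : bounded_measurable (fun y => f y ^+ 2).
  by under eq_fun do rewrite expr2; exact: bmM.
rewrite unlock /= (eq_integral (fun x => (f x ^+ 2)%:E)); last first.
  move=> x _ /=; rewrite -[2]/(2%:R) powR_mulrn//.
  by rewrite real_normK// num_real.
rewrite mean_EFin//= powR12_sqrt//.
by apply: mean_ge0 => x; exact: sqr_ge0.
Qed.

Lemma kernel_gap mu lam f : stationary P mu -> kernel_lambda P mu = lam%:E ->
  bounded_measurable f -> \int[mu]_x f x = 0 ->
  \int[mu]_x (kernel_mean f x ^+ 2) <= lam ^+ 2 * \int[mu]_x (f x ^+ 2).
Proof.
move=> st lamE bf f0.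
have bf2 : bounded_measurable (fun y => f y ^+ 2).
  by under eq_fun do rewrite expr2; exact: bmM.
have bP := bm_kernel_mean bf.
have bP2 : bounded_measurable (fun x => kernel_mean f x ^+ 2).
  by under eq_fun do rewrite expr2; exact: bmM.
have i0 : 0 <= \int[mu]_x (f x ^+ 2) by apply: mean_ge0 => x; exact: sqr_ge0.
have Pi0 : 0 <= \int[mu]_x (kernel_mean f x ^+ 2).
  by apply: mean_ge0 => x; exact: sqr_ge0.
(* The ratio in [kernel_lambda] excludes functions of norm 0. For these it is enough that P
   contracts L^2(mu), by Jensen and stationarity. *)
have [z|nz] := eqVneq (\int[mu]_x (f x ^+ 2)) 0.
  rewrite z mulr0 -z -(mean_kernel_mean st bf2).
  by apply: mean_le => // [|x]; [exact: bm_kernel_mean | exact: kernel_mean_sqr_le].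
have N0 : Num.sqrt (\int[mu]_x (f x ^+ 2)) > 0 by rewrite sqrtr_gt0 lt_def nz.
have PE : kernel_op P f = EFin \o kernel_mean f.
  by apply/funext => x; rewrite /kernel_op /= -mean_EFin.
have : (('N[mu]_2%:E [kernel_op P f] / 'N[mu]_2%:E [EFin \o f])%E <= lam%:E)%E.
  rewrite -lamE /kernel_lambda le_max; apply/orP; right.
  apply: ereal_sup_ubound; exists f => //; split.
  - rewrite inE; apply/andP; split; rewrite inE /=; first by have [] := bf.
    by rewrite /finite_norm Lnorm2E// ltry.
  - by rewrite Lnorm2E// eqe gt_eqF.
  - by rewrite unlock mean_EFin// f0.
rewrite PE !Lnorm2E// inver gt_eqF// -EFinM lee_fin ler_pdivrMr// => h.
rewrite -(sqr_sqrtr Pi0) -(sqr_sqrtr i0) -exprMn ler_sqr//.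
  by rewrite nnegrE sqrtr_ge0.
by rewrite nnegrE (le_trans _ h)// sqrtr_ge0.
Qed.

End KernelMean.

Lemma bm_comp d d' (T : measurableType d) (Omega : measurableType d') (R : realType)
  (f : T -> R) (phi : Omega -> T) :
  measurable_fun setT phi -> bounded_measurable f ->
  bounded_measurable (fun w => f (phi w)).
Proof.
move=> mphi [mf [K fK]]; split; last by exists K => w.
exact: (measurableT_comp mf mphi).
Qed.

(** * Expectations along the chain *)

Section ChainMean.
Context {disp disp' : measure_display} {T : measurableType disp}
  {Omega : measurableType disp'} {R : realType}.
Variables (P : R.-pker T ~> T) (mu : probability T R) (Pr : probability Omega R).
Variables (n : nat) (s : 'I_n -> {mfun Omega >-> T}).
Hypothesis s_chain : markov_chain Pr P mu s.

Lemma mean_initial (i : 'I_n) (z : T -> R) : i = 0%N :> nat ->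
  bounded_measurable z -> \int[Pr]_w z (s i w) = \int[mu]_x z x.
Proof.
move=> i0 bz; apply/eqP; rewrite -subr_eq0; apply/eqP.
have ms : measurable_fun setT (s i) by [].
apply: (bm_functional_eq0
  (Lam := fun z => \int[Pr]_w z (s i w) - \int[mu]_x z x) (C := 2)) => //.
- move=> g h bg bh; rewrite !meanD//; try exact: bm_comp; ring.
- move=> r g bg; rewrite !meanZ//; try exact: bm_comp; ring.
- move=> g K bg gK; rewrite (le_trans (ler_normB _ _))// mulr_natl mulr2n lerD//.
    by apply: mean_norm_le => //; exact: bm_comp.
  exact: mean_norm_le.
- move=> A mA; have mAi : measurable (s i @^-1` A).
    by have := ms measurableT _ mA; rewrite setTI.
  rewrite (mean_indic mu mA) -[X in _ - fine X](s_chain.1 _ i0 _ mA).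
  by rewrite -(mean_indic Pr mAi) subrr.
Qed.

Definition chain_past_system (j : 'I_n) : set (set Omega) :=
  \bigcup_(i in [set i : 'I_n | (i <= j)%N])
        preimage_set_system setT (s i) measurable.

(* A function on [chain_past_type j] is measurable when it depends measurably on
   the first [j.+1] states. *)
Definition chain_past_type (j : 'I_n) := g_sigma_algebraType (chain_past_system j).

Lemma chain_past_measurable (j : 'I_n) (G : set Omega) :
  chain_past s j G -> measurable G.
Proof.
apply: smallest_sub; first exact: sigma_algebra_measurable.
by move=> A [i _ [B mB <-]]; exact: (measurable_funP (s i) measurableT).
Qed.

Lemma bm_past (j : 'I_n) (Y : Omega -> R) :
  bounded_measurable (Y : chain_past_type j -> R) -> bounded_measurable Y.
Proof.
move=> [mY bY]; split => // _ B mB; apply: (chain_past_measurable (j := j)).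
exact: mY.
Qed.

Lemma measurable_past (i j : 'I_n) : (i <= j)%N ->
  measurable_fun setT (s i : chain_past_type j -> T).
Proof.
move=> ij _ B mB; apply: sub_sigma_algebra.
by exists i => //; exists B.
Qed.

(** The Markov property is extended from events by two uses of [bm_functional_eq0]: first in [z],
    with [Y] the indicator of a past event, then in [Y]. *)
Lemma mean_markov_step (j k : 'I_n) (Y : Omega -> R) (z : T -> R) :
  k = j.+1 :> nat -> bounded_measurable (Y : chain_past_type j -> R) ->
  bounded_measurable z ->
  \int[Pr]_w (Y w * z (s k w)) = \int[Pr]_w (Y w * kernel_mean P z (s j w)).
Proof.
move=> kj bY bz.
have ms i : measurable_fun setT (s i) by [].
have step_bound (Y' : Omega -> R) (z' : T -> R) (K L : R) (i : 'I_n) :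
    bounded_measurable Y' -> bounded_measurable z' -> (forall w, `|Y' w| <= K) ->
    (forall x, `|z' x| <= L) -> `|\int[Pr]_w (Y' w * z' (s i w))| <= K * L.
  move=> bY' bz' YK zL; apply: mean_norm_le.
    by apply: bmM => //; exact: bm_comp.
  by move=> w; rewrite normrM ler_pM.
have bm1 (G : set Omega) : chain_past s j G -> bounded_measurable (\1_G : Omega -> R).
  by move=> /chain_past_measurable; exact: bm_indic.
have onG (G : set Omega) : chain_past s j G ->
    \int[Pr]_w (\1_G w * z (s k w)) - \int[Pr]_w (\1_G w * kernel_mean P z (s j w)) = 0.
  move=> pG; have mG := chain_past_measurable pG.
  apply: (bm_functional_eq0 (Lam := fun z => \int[Pr]_w (\1_G w * z (s k w)) -
    \int[Pr]_w (\1_G w * kernel_mean P z (s j w))) (C := 2) _ _ _ _ bz) => //.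
  - move=> g h bg bh.
    under eq_Rintegral do rewrite mulrDr.
    under [X in _ - X]eq_Rintegral do rewrite kernel_meanD// mulrDr.
    have := bm_kernel_mean P bg; have := bm_kernel_mean P bh => bPh bPg.
    rewrite !meanD//; try (apply: bmM; [exact: bm1|exact: bm_comp]); ring.
  - move=> r g bg; have bPg := bm_kernel_mean P bg.
    under eq_Rintegral do rewrite mulrCA.
    under [X in _ - X]eq_Rintegral do rewrite kernel_meanZ// mulrCA.
    rewrite !meanZ//; try (apply: bmM; [exact: bm1|exact: bm_comp]); ring.
  - move=> g K bg gK; rewrite (le_trans (ler_normB _ _))// mulr_natl mulr2n.
    have i1 w : `|\1_G w : R| <= 1.
      by rewrite indicE; case: (_ \in _); rewrite ?normr1 ?normr0.
    rewrite lerD// -[leRHS]mul1r; apply: step_bound => //; try exact: bm1.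
      exact: bm_kernel_mean.
    exact: kernel_mean_norm_le.
  - move=> A mA.
    have := s_chain.2 _ _ kj _ _ pG mA.
    have -> : \int[Pr]_w (\1_G w * \1_A (s k w)) = fine (Pr (G `&` s k @^-1` A)) :> R.
      rewrite -mean_indic; last first.
        by apply: measurableI => //; exact: measurable_funPTI.
      by apply: eq_Rintegral => w _; rewrite indicI.
    move=> ->; apply/eqP; rewrite subr_eq0; apply/eqP.
    rewrite -[RHS]/(fine (\int[Pr]_w (\1_G w * kernel_mean P \1_A (s j w))%:E)%E).
    rewrite integral_mkcond; congr fine; apply: eq_integral => w _.
    rewrite patchE indicE; case: (w \in G); rewrite ?mul0r// mul1r.
    rewrite /kernel_mean mean_indic// fineK//.
    exact: fin_num_measure.
have bPz := bm_kernel_mean P bz.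
have [K zK] := bz.2.
apply/eqP; rewrite -subr_eq0; apply/eqP.
(* Over the past sigma-algebra the indicators to be tested are exactly those of past events, settled
   by [onG]. *)
apply: (bm_functional_eq0 (T := chain_past_type j) (Lam := fun Y =>
  \int[Pr]_w (Y w * z (s k w)) - \int[Pr]_w (Y w * kernel_mean P z (s j w)))
  (C := 2 * K) _ _ _ _ bY) => //.
- move=> f g bf bg; have bf' := bm_past bf; have bg' := bm_past bg.
  under eq_Rintegral do rewrite mulrDl.
  under [X in _ - X]eq_Rintegral do rewrite mulrDl.
  rewrite !meanD//; try (apply: bmM => //; exact: bm_comp); ring.
- move=> r f bf; have bf' := bm_past bf.
  under eq_Rintegral do rewrite -mulrA.
  under [X in _ - X]eq_Rintegral do rewrite -mulrA.
  rewrite !meanZ//; try (apply: bmM => //; exact: bm_comp); ring.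
- move=> f L bf fL; have bf' := bm_past bf.
  rewrite (le_trans (ler_normB _ _))// -mulrA mulr_natl mulr2n (mulrC K).
  rewrite lerD//; apply: step_bound => //; exact: kernel_mean_norm_le.
Qed.

End ChainMean.

(** * Frobenius product and operator bounds *)

Section FrobeniusProduct.
Context {R : realType}.

Definition mxdot (m n : nat) (A B : 'M[R]_(m, n)) : R :=
  \sum_i \sum_j A i j * B i j.

Lemma mxdotC m n (A B : 'M[R]_(m, n)) : mxdot A B = mxdot B A.
Proof. by apply: eq_bigr => i _; apply: eq_bigr => j _; rewrite mulrC. Qed.

Lemma mxdotDr m n (A B C : 'M[R]_(m, n)) : mxdot A (B + C) = mxdot A B + mxdot A C.
Proof.
rewrite /mxdot -big_split; apply: eq_bigr => i _ /=; rewrite -big_split.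
by apply: eq_bigr => j _; rewrite mxE mulrDr.
Qed.

Lemma mxdotZr m n r (A B : 'M[R]_(m, n)) : mxdot A (r *: B) = r * mxdot A B.
Proof.
rewrite /mxdot mulr_sumr; apply: eq_bigr => i _; rewrite mulr_sumr.
by apply: eq_bigr => j _; rewrite mxE mulrCA.
Qed.

Lemma mxdotZl m n r (A B : 'M[R]_(m, n)) : mxdot (r *: B) A = r * mxdot B A.
Proof. by rewrite !(mxdotC _ A) mxdotZr. Qed.

Lemma mxdotNr m n (A B : 'M[R]_(m, n)) : mxdot A (- B) = - mxdot A B.
Proof. by rewrite -scaleN1r mxdotZr mulN1r. Qed.

Lemma mxdotBr m n (A B C : 'M[R]_(m, n)) : mxdot A (B - C) = mxdot A B - mxdot A C.
Proof. by rewrite mxdotDr mxdotNr. Qed.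

Lemma mxdotBl m n (A B C : 'M[R]_(m, n)) : mxdot (B - C) A = mxdot B A - mxdot C A.
Proof. by rewrite !(mxdotC _ A) mxdotBr. Qed.

Lemma mxdot0r m n (A : 'M[R]_(m, n)) : mxdot A 0 = 0.
Proof. by rewrite -(scale0r 0) mxdotZr mul0r. Qed.

Lemma mxdot_sumr m n (I : Type) (r : seq I) (p : pred I) (A : 'M[R]_(m, n)) F :
  mxdot A (\sum_(i <- r | p i) F i) = \sum_(i <- r | p i) mxdot A (F i).
Proof. by apply: big_morph; [exact: mxdotDr | exact: mxdot0r]. Qed.

Lemma mxdot_ge0 m n (A : 'M[R]_(m, n)) : 0 <= mxdot A A.
Proof. by apply: sumr_ge0 => i _; apply: sumr_ge0 => j _; rewrite -expr2 sqr_ge0. Qed.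

Lemma mxdot_eq0 m n (A : 'M[R]_(m, n)) : mxdot A A = 0 -> A = 0.
Proof.
move=> /eqP; rewrite psumr_eq0; last first.
  by move=> i _; apply: sumr_ge0 => j _; rewrite -expr2 sqr_ge0.
move=> /allP A0; apply/matrixP => i j; rewrite mxE.
have := A0 i (mem_index_enum _); rewrite psumr_eq0; last first.
  by move=> k _; rewrite -expr2 sqr_ge0.
by move=> /allP /(_ j (mem_index_enum _)); rewrite -expr2 sqrf_eq0 => /eqP.
Qed.

Lemma mxdot_trE m n (A B : 'M[R]_(m, n)) : mxdot A B = \tr (A^T *m B).
Proof.
rewrite /mxdot exchange_big; apply: eq_bigr => j _ /=; rewrite mxE.
by apply: eq_bigr => i _; rewrite mxE.
Qed.

Lemma mxdot_tr m n (A B : 'M[R]_(m, n)) : mxdot A^T B^T = mxdot A B.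
Proof. by rewrite !mxdot_trE trmxK mxtrace_mulC -mxtrace_tr trmx_mul trmxK. Qed.

Lemma mxdot_mull m n p (A : 'M[R]_(m, n)) (B : 'M[R]_(n, p)) C :
  mxdot (A *m B) C = mxdot B (A^T *m C).
Proof. by rewrite !mxdot_trE trmx_mul mulmxA. Qed.

Lemma mxdot_mulr m n p (A : 'M[R]_(m, n)) (B : 'M[R]_(n, p)) C :
  mxdot (A *m B) C = mxdot A (C *m B^T).
Proof. by rewrite !mxdot_trE trmx_mul -mulmxA mxtrace_mulC mulmxA. Qed.

Lemma mxdot_CS m n (A B : 'M[R]_(m, n)) : mxdot A B ^+ 2 <= mxdot A A * mxdot B B.
Proof.
have [B0|B0] := eqVneq (mxdot B B) 0.
  by rewrite (mxdot_eq0 B0) !mxdot0r expr0n mulr0.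
have Bp : 0 < mxdot B B by rewrite lt_def B0 mxdot_ge0.
have := mxdot_ge0 (mxdot B B *: A - mxdot A B *: B).
rewrite !(mxdotBr, mxdotBl, mxdotZr, mxdotZl) (mxdotC B A) => h.
have : 0 <= mxdot B B * (mxdot A A * mxdot B B - mxdot A B ^+ 2) by lra.
by rewrite pmulr_rge0// subr_ge0.
Qed.

Lemma frobenius_normE m n (A : 'M[R]_(m, n)) :
  frobenius_norm A = Num.sqrt (mxdot A A).
Proof. by []. Qed.

Lemma frobenius_norm_sqr m n (A : 'M[R]_(m, n)) : frobenius_norm A ^+ 2 = mxdot A A.
Proof. by rewrite frobenius_normE sqr_sqrtr// mxdot_ge0. Qed.

Lemma frobenius_norm_ge0 m n (A : 'M[R]_(m, n)) : 0 <= frobenius_norm A.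
Proof. exact: sqrtr_ge0. Qed.

Lemma mxdot_norm_le m n (A B : 'M[R]_(m, n)) :
  `|mxdot A B| <= frobenius_norm A * frobenius_norm B.
Proof.
rewrite -[leLHS]sqrtr_sqr -sqrtrM ?mxdot_ge0//.
by rewrite ler_sqrt ?mxdot_CS// mulr_ge0// mxdot_ge0.
Qed.

(** A bound kept in squared form, without supremum or root: it multiplies along products and,
    applied to each column, bounds Frobenius norms with no factor of the dimension. *)
Definition opnorm_le (m n : nat) (A : 'M[R]_(m, n)) (k : R) : Prop :=
  forall v : 'cV[R]_n, mxdot (A *m v) (A *m v) <= k ^+ 2 * mxdot v v.

Lemma mxdot_cols m n (A B : 'M[R]_(m, n)) :
  mxdot A B = \sum_j mxdot (col j A) (col j B).
Proof.
rewrite /mxdot exchange_big; apply: eq_bigr => j _ /=.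
by apply: eq_bigr => i _; rewrite big_ord1 !mxE.
Qed.

Lemma opnorm_le_mull m n p (A : 'M[R]_(m, n)) k (X : 'M[R]_(n, p)) :
  opnorm_le A k -> mxdot (A *m X) (A *m X) <= k ^+ 2 * mxdot X X.
Proof.
move=> Ak; rewrite (mxdot_cols (A *m X)) (mxdot_cols X) mulr_sumr.
by apply: ler_sum => j _; rewrite !colE -mulmxA.
Qed.

Lemma opnorm_le_mulr m n p (A : 'M[R]_(m, n)) k (X : 'M[R]_(p, n)) :
  opnorm_le A k -> mxdot (X *m A^T) (X *m A^T) <= k ^+ 2 * mxdot X X.
Proof.
by move=> Ak; rewrite -mxdot_tr trmx_mul trmxK -(mxdot_tr X); exact: opnorm_le_mull.
Qed.

Lemma opnorm_leM m n p (A : 'M[R]_(m, n)) (B : 'M[R]_(n, p)) k l :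
  opnorm_le A k -> opnorm_le B l -> opnorm_le (A *m B) (k * l).
Proof.
move=> Ak Bl v; rewrite -mulmxA (le_trans (Ak _))// exprMn -(mulrA (k ^+ 2)).
by rewrite ler_wpM2l// ?sqr_ge0.
Qed.

Lemma opnorm_leX n (A : 'M[R]_n) k i : opnorm_le A k -> opnorm_le (A ^+ i) (k ^+ i).
Proof.
move=> Ak; elim: i => [|i IH].
  by move=> v; rewrite !expr0 expr1n mul1r mul1mx.
by rewrite !exprS; apply: opnorm_leM.
Qed.

Lemma trmxX n (A : 'M[R]_n) i : (A ^+ i)^T = A^T ^+ i.
Proof.
elim: i => [|i IH]; first by rewrite !expr0 trmx1.
by rewrite exprS exprSr -IH; exact: trmx_mul.
Qed.

Lemma frobenius_norm_opnorm m n (A : 'M[R]_(m, n)) : opnorm_le A (frobenius_norm A).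
Proof.
move=> v; rewrite frobenius_norm_sqr /mxdot mulr_suml; apply: ler_sum => i _.
rewrite big_ord1 -expr2 mxE -/(mxdot _ _).
have -> : \sum_j A i j * v j 0 = mxdot (row i A) v^T.
  by rewrite /mxdot big_ord1; apply: eq_bigr => j _; rewrite !mxE.
rewrite (le_trans (mxdot_CS _ _))// mxdot_tr {1}/mxdot big_ord1.
rewrite le_eqVlt; apply/orP; left; apply/eqP; congr (_ * _).
by apply: eq_bigr => j _; rewrite !mxE.
Qed.

Lemma spectral_norm_opnorm m n (A : 'M[R]_(m, n)) k :
  spectral_norm A <= k -> opnorm_le A k.
Proof.
move=> Ak v; have [v0|v0] := eqVneq (mxdot v v) 0.
  by rewrite (mxdot_eq0 v0) mulmx0 !mxdot0r mulr0.
have vp : 0 < frobenius_norm v by rewrite sqrtr_gt0 lt_def v0 mxdot_ge0.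
set u := (frobenius_norm v)^-1 *: v.
have u1 : frobenius_norm u <= 1.
  rewrite frobenius_normE /u mxdotZr mxdotZl -frobenius_norm_sqr.
  by rewrite expr2 mulKf ?gt_eqF// mulVf ?gt_eqF// sqrtr1.
have bd : frobenius_norm (A *m u) <= k.
  apply: le_trans Ak; apply: ub_le_sup; last by exists u.
  (* [sup] dominates a set only if that set has an upper bound; the Frobenius norm provides one. *)
  exists (frobenius_norm A) => _ [w /= w1 <-].
  rewrite frobenius_normE -[leRHS]ger0_norm ?frobenius_norm_ge0//.
  rewrite -sqrtr_sqr ler_sqrt ?sqr_ge0// (le_trans (frobenius_norm_opnorm _ _))//.
  rewrite ler_piMr ?sqr_ge0// -frobenius_norm_sqr expr_le1//.
  exact: frobenius_norm_ge0.
have k0 : 0 <= k by rewrite (le_trans _ bd)// frobenius_norm_ge0.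
have un : mxdot u u = 1.
  rewrite /u mxdotZr mxdotZl -frobenius_norm_sqr.
  by rewrite expr2 mulKf ?gt_eqF// mulVf ?gt_eqF.
have vE : v = frobenius_norm v *: u by rewrite scalerA divff ?scale1r// gt_eqF.
have := frobenius_norm_sqr (A *m u); move: (frobenius_norm v) vE => c ->.
rewrite -(ler_sqr (frobenius_norm_ge0 _) k0) in bd.
clearbody u; rewrite -scalemxAr !mxdotZr !mxdotZl un => e; rewrite e in bd.
by rewrite mulr1 mulrA -!expr2 mulrC ler_wpM2r// sqr_ge0.
Qed.

Lemma spectral_norm_ge0 m n (A : 'M[R]_(m, n)) : 0 <= spectral_norm A.
Proof.
have a0 : frobenius_norm (A *m (0 : 'cV_n)) = 0.
  by rewrite frobenius_normE mulmx0 mxdot0r sqrtr0.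
rewrite -[leLHS]a0; apply: ub_le_sup; last first.
  by exists 0 => //=; rewrite frobenius_normE mxdot0r sqrtr0.
exists (frobenius_norm A) => _ [w /= w1 <-].
rewrite frobenius_normE -[leRHS]ger0_norm ?frobenius_norm_ge0//.
rewrite -sqrtr_sqr ler_sqrt ?sqr_ge0// (le_trans (frobenius_norm_opnorm _ _))//.
rewrite ler_piMr ?sqr_ge0// -frobenius_norm_sqr expr_le1//.
exact: frobenius_norm_ge0.
Qed.

End FrobeniusProduct.

(** * Matrix-valued functions and their L^2 geometry *)

Section MatrixFunctions.
Context {disp : measure_display} {T : measurableType disp} {R : realType}.

Definition bounded_measurable_mx (m n : nat) (X : T -> 'M[R]_(m, n)) : Prop :=
  forall i j, bounded_measurable (fun x => X x i j).

Lemma bmx_cst m n (u : 'M[R]_(m, n)) : bounded_measurable_mx (fun=> u).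
Proof. by move=> i j; exact: bm_cst. Qed.

Lemma bmxD m n (X Y : T -> 'M[R]_(m, n)) : bounded_measurable_mx X ->
  bounded_measurable_mx Y -> bounded_measurable_mx (fun x => X x + Y x).
Proof. by move=> bX bY i j; under eq_fun do rewrite mxE; exact: bmD. Qed.

Lemma bmxZ m n r (X : T -> 'M[R]_(m, n)) : bounded_measurable_mx X ->
  bounded_measurable_mx (fun x => r *: X x).
Proof. by move=> bX i j; under eq_fun do rewrite mxE; exact: bmZ. Qed.

Lemma bmxB m n (X Y : T -> 'M[R]_(m, n)) : bounded_measurable_mx X ->
  bounded_measurable_mx Y -> bounded_measurable_mx (fun x => X x - Y x).
Proof. by move=> bX bY i j; under eq_fun do rewrite !mxE; exact: bmB. Qed.

Lemma bmx_sum m n (I : Type) (r : seq I) (p : pred I) (X : I -> T -> 'M[R]_(m, n)) :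
  (forall i, bounded_measurable_mx (X i)) ->
  bounded_measurable_mx (fun x => \sum_(i <- r | p i) X i x).
Proof. by move=> bX i j; under eq_fun do rewrite summxE; apply: bm_sum => k; exact: bX. Qed.

Lemma bmx_mul m n q (X : T -> 'M[R]_(m, n)) (Y : T -> 'M[R]_(n, q)) :
  bounded_measurable_mx X -> bounded_measurable_mx Y ->
  bounded_measurable_mx (fun x => X x *m Y x).
Proof.
move=> bX bY i j; under eq_fun do rewrite mxE.
by apply: bm_sum => k; exact: bmM.
Qed.

Lemma bmx_tr m n (X : T -> 'M[R]_(m, n)) : bounded_measurable_mx X ->
  bounded_measurable_mx (fun x => (X x)^T).
Proof. by move=> bX i j; under eq_fun do rewrite mxE; exact: bX. Qed.

Lemma bmxX n (X : T -> 'M[R]_n) k : bounded_measurable_mx X ->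
  bounded_measurable_mx (fun x => X x ^+ k).
Proof.
move=> bX; elim: k => [|k IH].
  by under eq_fun do rewrite expr0; exact: bmx_cst.
by under eq_fun do rewrite exprS; exact: bmx_mul.
Qed.

Lemma bm_mxdot m n (X Y : T -> 'M[R]_(m, n)) : bounded_measurable_mx X ->
  bounded_measurable_mx Y -> bounded_measurable (fun x => mxdot (X x) (Y x)).
Proof.
move=> bX bY; apply: bm_sum => i; apply: bm_sum => j; exact: bmM.
Qed.

Variable mu : probability T R.

Section InnerProduct.
Variables m n : nat.
Implicit Types X Y Z : T -> 'M[R]_(m, n).

Definition l2dot X Y : R := \int[mu]_x mxdot (X x) (Y x).

Definition l2norm X : R := Num.sqrt (l2dot X X).

Lemma l2dotC X Y : l2dot X Y = l2dot Y X.
Proof. by apply: eq_Rintegral => x _; rewrite mxdotC. Qed.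

Lemma l2dotDr X Y Z : bounded_measurable_mx X -> bounded_measurable_mx Y ->
  bounded_measurable_mx Z ->
  l2dot X (fun x => Y x + Z x) = l2dot X Y + l2dot X Z.
Proof.
move=> bX bY bZ; rewrite -meanD; try exact: bm_mxdot.
by apply: eq_Rintegral => x _; rewrite mxdotDr.
Qed.

Lemma l2dotZr r X Y : bounded_measurable_mx X -> bounded_measurable_mx Y ->
  l2dot X (fun x => r *: Y x) = r * l2dot X Y.
Proof.
move=> bX bY; rewrite -meanZ; try exact: bm_mxdot.
by apply: eq_Rintegral => x _; rewrite mxdotZr.
Qed.

Lemma l2dotBr X Y Z : bounded_measurable_mx X -> bounded_measurable_mx Y ->
  bounded_measurable_mx Z ->
  l2dot X (fun x => Y x - Z x) = l2dot X Y - l2dot X Z.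
Proof.
move=> bX bY bZ; rewrite -meanB; try exact: bm_mxdot.
by apply: eq_Rintegral => x _; rewrite mxdotBr.
Qed.

Lemma l2dot_sumr X (I : Type) (r : seq I) (p : pred I) (Y : I -> T -> 'M[R]_(m, n)) :
  bounded_measurable_mx X -> (forall i, bounded_measurable_mx (Y i)) ->
  l2dot X (fun x => \sum_(i <- r | p i) Y i x) =
  \sum_(i <- r | p i) l2dot X (Y i).
Proof.
move=> bX bY; rewrite -mean_sum; last by move=> i; exact: bm_mxdot.
by apply: eq_Rintegral => x _; rewrite mxdot_sumr.
Qed.

Lemma l2dot_ge0 X : 0 <= l2dot X X.
Proof. by apply: mean_ge0 => x; exact: mxdot_ge0. Qed.

Lemma l2norm_ge0 X : 0 <= l2norm X.
Proof. exact: sqrtr_ge0. Qed.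

Lemma l2norm_sqr X : l2norm X ^+ 2 = l2dot X X.
Proof. by rewrite sqr_sqrtr// l2dot_ge0. Qed.

Lemma l2dot_CS X Y : bounded_measurable_mx X -> bounded_measurable_mx Y ->
  l2dot X Y ^+ 2 <= l2dot X X * l2dot Y Y.
Proof.
move=> bX bY.
have quad s t : 0 <= s ^+ 2 * l2dot X X - s * t * l2dot X Y *+ 2 + t ^+ 2 * l2dot Y Y.
  have bs : bounded_measurable_mx (fun x => s *: X x) by exact: bmxZ.
  have bt : bounded_measurable_mx (fun x => t *: Y x) by exact: bmxZ.
  have := l2dot_ge0 (fun x => s *: X x - t *: Y x).
  rewrite l2dotBr//; last by exact: bmxB.
  rewrite (l2dotC _ (fun x => s *: X x)) (l2dotC _ (fun x => t *: Y x)) !l2dotBr//.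
  rewrite !l2dotZr// !(l2dotC (fun x => _ *: _)) !l2dotZr// (l2dotC Y X).
  by move=> h; rewrite mulr2n; lra.
have a0 := l2dot_ge0 X; have b0 := l2dot_ge0 Y.
move: (l2dot X X) (l2dot X Y) (l2dot Y Y) quad a0 b0 => a c b quad a0 b0.
have [bz|bz] := eqVneq b 0.
  subst b; rewrite mulr0.
  have [-> //|cz] := eqVneq c 0; first by rewrite expr0n.
  (* With b = 0 and c nonzero the form would take the negative value a - 2 (a + 1) here. *)
  have := quad 1 ((a + 1) / c); rewrite mul1r mulr2n.
  by rewrite -!mulrA !mulVf// mulr0; nra.
have := quad b c.
have -> : b ^+ 2 * a - b * c * c *+ 2 + c ^+ 2 * b = b * (a * b - c ^+ 2) by ring.
by rewrite pmulr_rge0 ?subr_ge0// lt_def bz.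
Qed.

Lemma l2dot_norm_le X Y : bounded_measurable_mx X -> bounded_measurable_mx Y ->
  `|l2dot X Y| <= l2norm X * l2norm Y.
Proof.
move=> bX bY; rewrite -[leLHS]sqrtr_sqr -sqrtrM ?l2dot_ge0//.
by rewrite ler_sqrt ?l2dot_CS// mulr_ge0// l2dot_ge0.
Qed.

Lemma l2norm_le X k : 0 <= k -> l2dot X X <= k ^+ 2 -> l2norm X <= k.
Proof.
by move=> k0 h; rewrite -[leRHS](ger0_norm k0) -sqrtr_sqr ler_sqrt ?sqr_ge0.
Qed.

Lemma l2normD X Y : bounded_measurable_mx X -> bounded_measurable_mx Y ->
  l2norm (fun x => X x + Y x) <= l2norm X + l2norm Y.
Proof.
move=> bX bY; apply: l2norm_le; first by rewrite addr_ge0// l2norm_ge0.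
have bXY := bmxD bX bY.
rewrite l2dotDr// !(l2dotC (fun x => _ + _)) !l2dotDr// (l2dotC Y X).
rewrite -!l2norm_sqr sqrrD.
have := l2dot_norm_le bX bY; have := ler_norm (l2dot X Y).
by rewrite mulr2n; lra.
Qed.

Lemma l2norm0 : l2norm (fun=> 0) = 0.
Proof.
rewrite /l2norm (_ : l2dot _ _ = 0) ?sqrtr0//.
by rewrite /l2dot mxdot0r mean_cst.
Qed.

Lemma l2norm_sum (I : Type) (r : seq I) (p : pred I) (Y : I -> T -> 'M[R]_(m, n)) :
  (forall i, bounded_measurable_mx (Y i)) ->
  l2norm (fun x => \sum_(i <- r | p i) Y i x) <= \sum_(i <- r | p i) l2norm (Y i).
Proof.
move=> bY; elim: r => [|i r IH].
  by under eq_fun do rewrite big_nil; rewrite big_nil l2norm0.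
under eq_fun do rewrite big_cons; rewrite big_cons; case: (p i) => //.
apply: le_trans (l2normD _ _) _ => //; first exact: bmx_sum.
by rewrite lerD2l.
Qed.

Lemma l2normZ r X : bounded_measurable_mx X ->
  l2norm (fun x => r *: X x) = `|r| * l2norm X.
Proof.
move=> bX; rewrite /l2norm l2dotZr//; last exact: bmxZ.
by rewrite l2dotC l2dotZr// mulrA -expr2 sqrtrM ?sqr_ge0// sqrtr_sqr.
Qed.

Lemma l2dot_cstl (u : 'M[R]_(m, n)) X : bounded_measurable_mx X ->
  l2dot (fun=> u) X = mxdot u (mx_expectation mu X).
Proof.
move=> bX; rewrite /l2dot /mxdot mean_sum; last first.
  by move=> i; apply: bm_sum => j; exact: bmZ.
apply: eq_bigr => i _; rewrite mean_sum; last by move=> j; exact: bmZ.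
by apply: eq_bigr => j _; rewrite mxE meanZ.
Qed.

Lemma l2norm_cst (u : 'M[R]_(m, n)) : l2norm (fun=> u) = frobenius_norm u.
Proof. by rewrite /l2norm /l2dot mean_cst. Qed.

Lemma mx_expectationB X Y : bounded_measurable_mx X -> bounded_measurable_mx Y ->
  mx_expectation mu (fun x => X x - Y x) = mx_expectation mu X - mx_expectation mu Y.
Proof.
move=> bX bY; apply/matrixP => i j; rewrite !mxE -meanB//.
by apply: eq_Rintegral => x _; rewrite !mxE.
Qed.

Lemma mx_expectation_cst (u : 'M[R]_(m, n)) : mx_expectation mu (fun=> u) = u.
Proof. by apply/matrixP => i j; rewrite mxE mean_cst. Qed.

(** Taking the mean is the orthogonal projection onto constants, so removing it shortens. *)
Lemma l2norm_center_le X : bounded_measurable_mx X ->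
  l2norm (fun x => X x - mx_expectation mu X) <= l2norm X.
Proof.
move=> bX; apply: l2norm_le; first exact: l2norm_ge0.
have bE : bounded_measurable_mx (fun=> mx_expectation mu X) by exact: bmx_cst.
have bB := bmxB bX bE.
rewrite l2dotBr// [X in _ - X]l2dotC l2dot_cstl// mx_expectationB//.
rewrite mx_expectation_cst subrr mxdot0r subr0 l2dotC l2dotBr// l2norm_sqr lerBlDl lerDr.
by rewrite l2dotC l2dot_cstl// mxdot_ge0.
Qed.

End InnerProduct.

End MatrixFunctions.

(** Over a general ring because it is used for reals, complex numbers and polynomials in z, with
    evaluation at z commuting with it. [N] is the number of terms. *)
Definition exp_trunc (K : comUnitRingType) (N : nat) (x : K) : K :=
  \sum_(k < N) (k`!%:R)^-1 * x ^+ k.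

Definition expmx_trunc (K : comUnitRingType) (n N : nat) (A : 'M[K]_n) : 'M[K]_n :=
  \sum_(k < N) (k`!%:R)^-1 *: A ^+ k.

Lemma exp_trunc_ge0 (R : realType) N (x : R) : 0 <= x -> 0 <= exp_trunc N x.
Proof.
by move=> x0; apply: sumr_ge0 => k _; rewrite mulr_ge0 ?invr_ge0 ?exprn_ge0.
Qed.

Lemma exp_truncE (R : realType) N (x : R) : exp_trunc N x = series (exp_coeff x) N.
Proof.
by rewrite /series /= big_mkord; apply: eq_bigr => k _; rewrite /exp_coeff /= mulrC.
Qed.

Lemma exp_trunc_cvg (R : realType) (x : R) : exp_trunc N x @[N --> \oo] --> expR x.
Proof.
have -> : (fun N => exp_trunc N x) = series (exp_coeff x).
  by apply/funext => N; exact: exp_truncE.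
exact: is_cvg_series_exp_coeff.
Qed.

Lemma exp_trunc_le_expR (R : realType) N (x : R) : 0 <= x -> exp_trunc N x <= expR x.
Proof.
move=> x0; rewrite exp_truncE; apply: nondecreasing_cvgn_le.
  by apply: nondecreasing_series => k _ _; exact: exp_coeff_ge0.
exact: is_cvg_series_exp_coeff.
Qed.

(** * Conjugation by the exponential of a random matrix *)

Section ConjugationBounds.
Context {disp : measure_display} {T : measurableType disp} {R : realType}.
Variable mu : probability T R.
Variable D : nat.
Implicit Types (B : T -> 'M[R]_D) (X : T -> 'M[R]_D) (u : 'M[R]_D).

Definition conj_term B (k l : nat) X (x : T) : 'M[R]_D :=
  B x ^+ k *m X x *m (B x)^T ^+ l.

(** [m] bounds [B] everywhere, and [r * m] bounds it in mean square on a fixed vector. Thus [r ^+ 2]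
    is a variance in units of [m ^+ 2]; it becomes V_j / M^2. *)
Definition row_bound B (m r : R) : Prop :=
  [/\ bounded_measurable_mx B, forall x, opnorm_le (B x) m &
      forall v : 'cV[R]_D,
        \int[mu]_x mxdot (B x *m v) (B x *m v) <= (r * m) ^+ 2 * mxdot v v].

Lemma bmx_conj_term B k l X : bounded_measurable_mx B -> bounded_measurable_mx X ->
  bounded_measurable_mx (conj_term B k l X).
Proof.
move=> bB bX; apply: bmx_mul; first by apply: bmx_mul => //; exact: bmxX.
by apply: bmxX; exact: bmx_tr.
Qed.

Lemma conj_term_pointwise B m k l X x : opnorm_le (B x) m ->
  mxdot (conj_term B k l X x) (conj_term B k l X x) <=
  (m ^+ (k + l)) ^+ 2 * mxdot (X x) (X x).
Proof.
move=> Bm; rewrite /conj_term -trmxX.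
rewrite (le_trans (opnorm_le_mulr _ (opnorm_leX l Bm)))//.
rewrite exprD exprMn [X in _ <= X * _]mulrC -[leRHS]mulrA ler_wpM2l ?sqr_ge0//.
exact: opnorm_le_mull (opnorm_leX k Bm).
Qed.

Lemma l2norm_conj_term B m k l X : 0 <= m -> bounded_measurable_mx B ->
  (forall x, opnorm_le (B x) m) -> bounded_measurable_mx X ->
  l2norm mu (conj_term B k l X) <= m ^+ (k + l) * l2norm mu X.
Proof.
move=> m0 bB Bm bX; apply: l2norm_le.
  by rewrite mulr_ge0 ?exprn_ge0// l2norm_ge0.
rewrite exprMn l2norm_sqr -meanZ; last exact: bm_mxdot.
apply: mean_le.
- by apply: bm_mxdot; exact: bmx_conj_term.
- by apply: bmZ; exact: bm_mxdot.
- by move=> x; exact: conj_term_pointwise.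
Qed.

Lemma row_bound_mull B m r u : row_bound B m r ->
  \int[mu]_x mxdot (B x *m u) (B x *m u) <= (r * m) ^+ 2 * mxdot u u.
Proof.
case=> bB _ Bv.
under eq_Rintegral do rewrite mxdot_cols.
rewrite mean_sum; last first.
  move=> j; apply: bm_mxdot;
    by under eq_fun do rewrite colE -mulmxA; apply: bmx_mul => //; exact: bmx_cst.
rewrite mxdot_cols mulr_sumr; apply: ler_sum => j _.
by under eq_Rintegral do rewrite colE -mulmxA -colE; exact: Bv.
Qed.

(** One factor of [B] adjacent to the constant [u] is paid for in mean square by [r * m], the others
    uniformly by [m]. It is taken on the left if k > 0, on the right otherwise. *)
Lemma l2norm_conj_term_cst B m r k l u : 0 <= m -> 0 <= r -> row_bound B m r ->
  (0 < k + l)%N ->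
  l2norm mu (conj_term B k l (fun=> u)) <= r * m ^+ (k + l) * frobenius_norm u.
Proof.
move=> m0 r0 rB kl; have [bB Bm _] := rB.
have Bu : l2norm mu (fun x => B x *m u) <= r * m * frobenius_norm u.
  apply: l2norm_le; first by rewrite !mulr_ge0// frobenius_norm_ge0.
  by rewrite exprMn frobenius_norm_sqr; exact: row_bound_mull.
have uB : l2norm mu (fun x => u *m (B x)^T) <= r * m * frobenius_norm u.
  apply: l2norm_le; first by rewrite !mulr_ge0// frobenius_norm_ge0.
  rewrite exprMn frobenius_norm_sqr -(mxdot_tr u).
  rewrite (le_trans _ (row_bound_mull _ rB))//.
  rewrite le_eqVlt; apply/orP; left; apply/eqP; apply: eq_Rintegral => x _.
  by rewrite -mxdot_tr trmx_mul trmxK.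
have bu : bounded_measurable_mx (fun _ : T => u : 'M[R]_D) by exact: bmx_cst.
case: k kl => [|k] kl.
  case: l kl => [//|l] _.
  have -> : conj_term B 0 l.+1 (fun=> u) = conj_term B 0 l (fun x => u *m (B x)^T).
    apply/funext => x; rewrite /conj_term !expr0 !mul1mx exprS.
    exact: mulmxA.
  rewrite (le_trans (l2norm_conj_term _ _ m0 bB Bm _))//.
    by apply: bmx_mul => //; exact: bmx_tr.
  rewrite !add0n exprSr -mulrA mulrCA -mulrA ler_wpM2l ?exprn_ge0//.
  by rewrite mulrA (mulrC m).
have -> : conj_term B k.+1 l (fun=> u) = conj_term B k l (fun x => B x *m u).
  apply/funext => x; rewrite /conj_term exprSr.
  by rewrite -[in LHS](mulmxA (B x ^+ k)).
rewrite (le_trans (l2norm_conj_term _ _ m0 bB Bm _))//; first exact: bmx_mul.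
rewrite addSn exprSr -mulrA mulrCA -mulrA ler_wpM2l ?exprn_ge0//.
by rewrite mulrA (mulrC m).
Qed.

Definition exp_conj B N X (x : T) : 'M[R]_D :=
  expmx_trunc N (B x) *m X x *m (expmx_trunc N (B x))^T.

Lemma bmx_exp_conj B N X : bounded_measurable_mx B -> bounded_measurable_mx X ->
  bounded_measurable_mx (exp_conj B N X).
Proof.
move=> bB; have be : bounded_measurable_mx (fun x => expmx_trunc N (B x)).
  by apply: bmx_sum => k; apply: bmxZ; exact: bmxX.
by move=> bX; apply: bmx_mul; [exact: bmx_mul | exact: bmx_tr].
Qed.

(** The transpose is included because adjunction moves factors of [B] across an inner product, and
    the rotated matrices of the tail bound are not symmetric. *)
Definition two_sided_bound B (m r : R) : Prop :=
  [/\ row_bound B m r, row_bound (fun x => (B x)^T) m r & mx_expectation mu B = 0].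

Variables (B : T -> 'M[R]_D) (m r : R).
Hypotheses (m0 : 0 <= m) (r0 : 0 <= r) (BB : two_sided_bound B m r).

Let bB : bounded_measurable_mx B. Proof. by have [[]] := BB. Qed.
Let Bm x : opnorm_le (B x) m. Proof. by have [[]] := BB. Qed.
Let rB : row_bound B m r. Proof. by have [] := BB. Qed.
Let rBt : row_bound (fun x => (B x)^T) m r. Proof. by have [] := BB. Qed.

(** Of at least two factors of [B], one moves by adjunction onto [u'] and another stays with [u].
    Cauchy-Schwarz then uses the variance on both sides, whence [r ^+ 2]. *)
Lemma l2dot_conj_term_ge2 k l u u' : (1 < k + l)%N ->
  `|l2dot mu (fun=> u') (conj_term B k l (fun=> u))| <=
  r ^+ 2 * m ^+ (k + l) * (frobenius_norm u' * frobenius_norm u).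
Proof.
have [bBt _ _] := rBt.
have bu v : bounded_measurable_mx (fun _ : T => v : 'M[R]_D) by exact: bmx_cst.
case: k => [|k] kl.
  case: l kl => [//|l] kl.
  have -> : l2dot mu (fun=> u') (conj_term B 0 l.+1 (fun=> u)) =
      l2dot mu (conj_term (fun x => (B x)^T) 0 1 (fun=> u')) (conj_term B 0 l (fun=> u)).
    apply: eq_Rintegral => x _; rewrite /conj_term !expr0 !mul1mx expr1 trmxK exprSr.
    by rewrite [in LHS]mulmxA mxdotC mxdot_mulr trmxK mxdotC.
  rewrite (le_trans (l2dot_norm_le _ _ _))//; try exact: bmx_conj_term.
  rewrite (le_trans (ler_pM _ _ (l2norm_conj_term_cst u' m0 r0 rBt _)
    (l2norm_conj_term_cst u m0 r0 rB _)))//; try exact: l2norm_ge0.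
  by rewrite !add0n expr1 (exprS m); rewrite le_eqVlt; apply/predU1P; left; ring.
have -> : l2dot mu (fun=> u') (conj_term B k.+1 l (fun=> u)) =
    l2dot mu (conj_term (fun x => (B x)^T) 1 0 (fun=> u')) (conj_term B k l (fun=> u)).
  apply: eq_Rintegral => x _; rewrite /conj_term !expr0 expr1 mulmx1 exprS.
  by rewrite -[in LHS](mulmxA (B x)) -[in LHS](mulmxA (B x)) mxdotC mxdot_mull mxdotC.
rewrite (le_trans (l2dot_norm_le _ _ _))//; try exact: bmx_conj_term.
rewrite (le_trans (ler_pM _ _ (l2norm_conj_term_cst u' m0 r0 rBt _)
  (l2norm_conj_term_cst u m0 r0 rB _)))//; try exact: l2norm_ge0.
by rewrite expr1 addSn (exprS m); rewrite le_eqVlt; apply/predU1P; left; ring.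
Qed.

Lemma l2dot_conj_term1 k l u u' : (k + l = 1)%N ->
  l2dot mu (fun=> u') (conj_term B k l (fun=> u)) = 0.
Proof.
have E0 : mx_expectation mu B = 0 by have [] := BB.
have [bBt _ _] := rBt.
case: k => [|[|//]] /=; last first.
  case: l => // _.
  rewrite -(mxdot0r (u' *m u^T)) -E0 -l2dot_cstl//.
  apply: eq_Rintegral => x _; rewrite /conj_term expr0 expr1 mulmx1.
  by rewrite mxdotC mxdot_mulr mxdotC.
case: l => [|[|//]] // _.
rewrite -(mxdot0r (u'^T *m u)) -E0 -l2dot_cstl//.
apply: eq_Rintegral => x _; rewrite /conj_term expr0 expr1 mul1mx.
by rewrite /= mxdotC mxdot_mull -mxdot_tr trmxK trmx_mul trmxK mxdotC.
Qed.

Variable N : nat.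
Hypothesis N2 : (1 < N)%N.

Let c (k : nat) : R := (k`!%:R)^-1.
Let c0 k : 0 <= c k. Proof. by rewrite invr_ge0. Qed.

Lemma exp_conjE X :
  exp_conj B N X = fun x => \sum_(k < N) \sum_(l < N) (c k * c l) *: conj_term B k l X x.
Proof.
apply/funext => x; rewrite /exp_conj /expmx_trunc !mulmx_suml; apply: eq_bigr => k _.
rewrite linear_sum /= mulmx_sumr; apply: eq_bigr => l _.
by rewrite linearZ /= -!scalemxAl -scalemxAr scalerA trmxX.
Qed.

Let sum_delta (i : nat) : (i < N)%N -> \sum_(k < N) c k * (k == i :> nat)%:R = c i.
Proof.
move=> iN; rewrite (bigD1 (Ordinal iN))//= eqxx mulr1 big1 ?addr0// => j ji.
by rewrite (_ : (j == i :> nat) = false) ?mulr0//; apply/negbTE; move: ji; rewrite -val_eqE.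
Qed.

Let sum_prod (f g : nat -> R) :
  \sum_(k < N) \sum_(l < N) (c k * c l) * (f k * g l) =
  (\sum_(k < N) c k * f k) * (\sum_(l < N) c l * g l).
Proof.
rewrite mulr_suml; apply: eq_bigr => k _; rewrite mulr_sumr; apply: eq_bigr => l _.
ring.
Qed.

Let q := expR (2 * m).
Let exp2 : (exp_trunc N m) ^+ 2 <= q.
Proof.
rewrite /q mulr_natl mulr2n expRD -expr2 ler_sqr ?nnegrE ?expR_ge0 ?exp_trunc_ge0//.
exact: exp_trunc_le_expR.
Qed.

Lemma l2norm_exp_conj X : bounded_measurable_mx X ->
  l2norm mu (exp_conj B N X) <= q * l2norm mu X.
Proof.
move=> bX; have bt k l : bounded_measurable_mx (conj_term B k l X).
  exact: bmx_conj_term.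
rewrite exp_conjE (le_trans (l2norm_sum _ _ _ _))//.
  by move=> k; apply: bmx_sum => l; exact: bmxZ.
apply: (@le_trans _ _ (\sum_(k < N) \sum_(l < N) (c k * c l) * (m ^+ k * m ^+ l)
   * l2norm mu X)).
  apply: ler_sum => k _; rewrite (le_trans (l2norm_sum _ _ _ _))//.
    by move=> l; exact: bmxZ.
  apply: ler_sum => l _; rewrite l2normZ// ger0_norm ?mulr_ge0// -mulrA.
  by rewrite ler_wpM2l ?mulr_ge0// -exprD; exact: l2norm_conj_term.
under eq_bigr do rewrite -mulr_suml.
rewrite -mulr_suml (sum_prod (fun k => m ^+ k) (fun k => m ^+ k)) -expr2.
by rewrite ler_wpM2r ?l2norm_ge0.
Qed.

Lemma l2norm_exp_conj_sub u :
  l2norm mu (fun x => exp_conj B N (fun=> u) x - u) <= r * (q - 1) * frobenius_norm u.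
Proof.
have bu : bounded_measurable_mx (fun _ : T => u : 'M[R]_D) by exact: bmx_cst.
have bt k l : bounded_measurable_mx (conj_term B k l (fun=> u)).
  exact: bmx_conj_term.
(* [dl] allows [u] to be subtracted term by term: it cancels the term k = l = 0 of the expansion and
   leaves the others alone. *)
pose dl (k l : nat) : R := (k == 0%N)%:R * (l == 0%N)%:R.
have uE : u = \sum_(k < N) \sum_(l < N) (c k * c l * dl k l) *: u.
  under eq_bigr do rewrite -scaler_suml.
  rewrite -scaler_suml (sum_prod (fun k => (k == 0%N)%:R) (fun k => (k == 0%N)%:R)).
  by rewrite !sum_delta ?(ltn_trans _ N2)// /c fact0 invr1 mulr1 scale1r.
have -> : (fun x => exp_conj B N (fun=> u) x - u) = fun x => \sum_(k < N) \sum_(l < N)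
    (c k * c l) *: (conj_term B k l (fun=> u) x - dl k l *: u).
  apply/funext => x; rewrite exp_conjE [X in _ - X]uE -sumrB; apply: eq_bigr => k _.
  by rewrite -sumrB; apply: eq_bigr => l _; rewrite scalerBr scalerA.
have bs k l : bounded_measurable_mx (fun x => conj_term B k l (fun=> u) x - dl k l *: u).
  by apply: bmxB => //; exact: bmx_cst.
rewrite (le_trans (l2norm_sum _ _ _ _))//.
  by move=> k; apply: bmx_sum => l; exact: bmxZ.
apply: (@le_trans _ _ (\sum_(k < N) \sum_(l < N)
   ((c k * c l) * (m ^+ k * m ^+ l) - (c k * c l) * dl k l) * (r * frobenius_norm u))).
  apply: ler_sum => k _; rewrite (le_trans (l2norm_sum _ _ _ _))//.
    by move=> l; exact: bmxZ.
  apply: ler_sum => l _; rewrite l2normZ// ger0_norm ?mulr_ge0// -mulrBr -[leRHS]mulrA.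
  rewrite ler_wpM2l ?mulr_ge0// -exprD.
  have [kl0|kl] := posnP (k + l)%N.
    have [k0 l0] : nat_of_ord k = 0%N /\ nat_of_ord l = 0%N.
      by move/eqP: kl0; rewrite addn_eq0 => /andP[/eqP -> /eqP ->].
    have e0 x : conj_term B k l (fun=> u) x - dl k l *: u = 0.
      by rewrite /conj_term /dl k0 l0 !expr0 mul1r scale1r mul1mx mulmx1 subrr.
    under eq_fun do rewrite e0.
    by rewrite l2norm0 /dl k0 l0 !expr0 mul1r subrr mul0r.
  have -> : dl k l = 0.
    rewrite /dl; move: kl; case: (nat_of_ord k) => [|?]; case: (nat_of_ord l) => [|?] //= _;
      by rewrite ?mul0r ?mulr0.
  rewrite subr0 mulrA (mulrC _ r); under eq_fun do rewrite scale0r subr0.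
  exact: l2norm_conj_term_cst.
under eq_bigr do rewrite -mulr_suml.
rewrite -mulr_suml; under eq_bigr do rewrite sumrB.
rewrite sumrB (sum_prod (fun k => m ^+ k) (fun k => m ^+ k)).
rewrite (sum_prod (fun k => (k == 0%N)%:R) (fun k => (k == 0%N)%:R)).
rewrite !sum_delta ?(ltn_trans _ N2)// /c fact0 invr1 mulr1 -expr2.
rewrite mulrCA mulrA ler_wpM2r ?frobenius_norm_ge0// ler_wpM2l//.
by rewrite lerD2r.
Qed.

Lemma l2dot_exp_conj_cst u u' : `|l2dot mu (fun=> u') (exp_conj B N (fun=> u))| <=
  (1 + r ^+ 2 * (q - 1 - 2 * m)) * (frobenius_norm u' * frobenius_norm u).
Proof.
have bu v : bounded_measurable_mx (fun _ : T => v : 'M[R]_D) by exact: bmx_cst.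
have bt k l : bounded_measurable_mx (conj_term B k l (fun=> u)).
  exact: bmx_conj_term.
pose d0 (k : nat) : R := (k == 0%N)%:R.
pose d1 (k : nat) : R := (k == 1%N)%:R.
set uu := frobenius_norm u' * frobenius_norm u.
have uu0 : 0 <= uu by rewrite mulr_ge0// frobenius_norm_ge0.
rewrite exp_conjE l2dot_sumr//; last first.
  by move=> k; apply: bmx_sum => l; exact: bmxZ.
(* The bracket equals 1 for k = l = 0, 0 for k + l = 1 (the mean of [B] vanishes) and r^2 m^(k+l)
   beyond. It is written as one formula so that every double sum factors. *)
apply: (@le_trans _ _ (\sum_(k < N) \sum_(l < N) (c k * c l *
   (r ^+ 2 * (m ^+ k * m ^+ l) + (1 - r ^+ 2) * (d0 k * d0 l)
    - r ^+ 2 * m * (d0 k * d1 l) - r ^+ 2 * m * (d1 k * d0 l))) * uu)).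
  rewrite (le_trans (ler_norm_sum _ _ _))//; apply: ler_sum => k _.
  rewrite l2dot_sumr//; last by move=> l; exact: bmxZ.
  rewrite (le_trans (ler_norm_sum _ _ _))//; apply: ler_sum => l _.
  rewrite l2dotZr// normrM ger0_norm ?mulr_ge0// -mulrA ler_wpM2l ?mulr_ge0//.
  have [kl|] := ltnP 1 (k + l).
    rewrite (le_trans (l2dot_conj_term_ge2 _ _ kl))// ler_wpM2r// -exprD.
    have -> : d0 k * d0 l = 0.
      by rewrite /d0; case: (nat_of_ord k) kl => [|?]; case: (nat_of_ord l) => [|?] //= _;
        rewrite ?mul0r ?mulr0.
    have -> : d0 k * d1 l = 0.
      by rewrite /d0 /d1; case: (nat_of_ord k) kl => [|?]; case: (nat_of_ord l) => [|[|?]] //= _;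
        rewrite ?mul0r ?mulr0.
    have -> : d1 k * d0 l = 0.
      by rewrite /d0 /d1; case: (nat_of_ord k) kl => [|[|?]]; case: (nat_of_ord l) => [|?] //= _;
        rewrite ?mul0r ?mulr0.
    by rewrite !mulr0 !subr0 addr0.
  rewrite leq_eqVlt ltnS leqn0 => /orP[/eqP kl|kl].
    rewrite l2dot_conj_term1// normr0.
    by rewrite /d0 /d1; move: kl; case: (nat_of_ord k) => [|[|?]];
      case: (nat_of_ord l) => [|[|?]] //= _;
      rewrite ?expr0 ?expr1 ?mulr1 ?mul1r ?mulr0 ?mul0r ?subr0 ?addr0 ?subrr ?mul0r.
  move: kl; rewrite addn_eq0 => /andP[/eqP k0 /eqP l0]; rewrite k0 l0.
  rewrite /d0 /d1 /= !expr0 !mulr1 !mulr0 !subr0 addrC subrK mul1r.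
  rewrite (_ : conj_term _ _ _ _ = fun=> u).
    by rewrite (le_trans (l2dot_norm_le _ _ _))// !l2norm_cst.
  by apply/funext => x; rewrite /conj_term !expr0 mul1mx mulmx1.
under eq_bigr do rewrite -mulr_suml.
rewrite -mulr_suml ler_wpM2r//.
have -> : \sum_(k < N) \sum_(l < N) (c k * c l *
   (r ^+ 2 * (m ^+ k * m ^+ l) + (1 - r ^+ 2) * (d0 k * d0 l)
    - r ^+ 2 * m * (d0 k * d1 l) - r ^+ 2 * m * (d1 k * d0 l))) =
   r ^+ 2 * (\sum_(k < N) \sum_(l < N) c k * c l * (m ^+ k * m ^+ l))
   + (1 - r ^+ 2) * (\sum_(k < N) \sum_(l < N) c k * c l * (d0 k * d0 l))
   - r ^+ 2 * m * (\sum_(k < N) \sum_(l < N) c k * c l * (d0 k * d1 l))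
   - r ^+ 2 * m * (\sum_(k < N) \sum_(l < N) c k * c l * (d1 k * d0 l)).
  rewrite !mulr_sumr -!sumrN -!big_split; apply: eq_bigr => k _ /=.
  rewrite !mulr_sumr -!sumrN -!big_split; apply: eq_bigr => l _ /=; ring.
rewrite (sum_prod (fun k => m ^+ k) (fun k => m ^+ k)) (sum_prod d0 d0) (sum_prod d0 d1) (sum_prod d1 d0) /d0 /d1.
have N1 := ltnW N2; rewrite !sum_delta//.
have -> : c 0 = 1 by rewrite /c fact0 invr1.
have -> : c 1 = 1 by rewrite /c invr1.
rewrite !mulr1 -expr2.
have h : r ^+ 2 * exp_trunc N m ^+ 2 <= r ^+ 2 * q by rewrite ler_wpM2l ?sqr_ge0.
rewrite -/(exp_trunc N m); lra.
Qed.

End ConjugationBounds.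

(** * One step of the chain *)

Section GapStep.
Context {disp : measure_display} {T : measurableType disp} {R : realType}.
Variables (P : R.-pker T ~> T) (mu : probability T R) (lam : R).
Hypotheses (st : stationary P mu) (lamE : kernel_lambda P mu = lam%:E).

Lemma kernel_lambda_ge0 : 0 <= lam.
Proof. by rewrite -lee_fin -lamE /kernel_lambda le_max lexx. Qed.

Definition kernel_mean_mx m n (Z : T -> 'M[R]_(m, n)) (x : T) : 'M[R]_(m, n) :=
  \matrix_(i, j) kernel_mean P (fun y => Z y i j) x.

Lemma bmx_kernel_mean m n (Z : T -> 'M[R]_(m, n)) :
  bounded_measurable_mx Z -> bounded_measurable_mx (kernel_mean_mx Z).
Proof. by move=> bZ i j; under eq_fun do rewrite mxE; exact: bm_kernel_mean. Qed.

Lemma mx_expectation_kernel_mean m n (Z : T -> 'M[R]_(m, n)) :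
  bounded_measurable_mx Z ->
  mx_expectation mu (kernel_mean_mx Z) = mx_expectation mu Z.
Proof.
move=> bZ; apply/matrixP => i j; rewrite !mxE -(mean_kernel_mean st (bZ i j)).
by apply: eq_Rintegral => x _; rewrite mxE.
Qed.

Lemma l2dot_entries m n (X : T -> 'M[R]_(m, n)) : bounded_measurable_mx X ->
  l2dot mu X X = \sum_i \sum_j \int[mu]_x (X x i j ^+ 2).
Proof.
move=> bX; rewrite /l2dot /mxdot mean_sum; last first.
  by move=> i; apply: bm_sum => j; exact: bmM.
by apply: eq_bigr => i _; rewrite mean_sum// => j; exact: bmM.
Qed.

(** The gap of scalar functions passes to matrices entry by entry: squared Frobenius norms add up,
    with no loss in the dimension. *)
Lemma l2norm_kernel_mean_center m n (Z : T -> 'M[R]_(m, n)) :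
  bounded_measurable_mx Z ->
  l2norm mu (fun x => kernel_mean_mx Z x - mx_expectation mu Z) <=
  lam * l2norm mu (fun x => Z x - mx_expectation mu Z).
Proof.
move=> bZ; have bE : bounded_measurable_mx (fun _ : T => mx_expectation mu Z).
  exact: bmx_cst.
have lam0 := kernel_lambda_ge0.
apply: l2norm_le; first by rewrite mulr_ge0// l2norm_ge0.
rewrite exprMn l2norm_sqr !l2dot_entries; try exact: bmxB.
  rewrite mulr_sumr; apply: ler_sum => i _; rewrite mulr_sumr; apply: ler_sum => j _.
  pose f x := Z x i j - mx_expectation mu Z i j.
  have bf : bounded_measurable f by apply: bmB => //; exact: bm_cst.
  have f0 : \int[mu]_x f x = 0.
    by rewrite meanB ?mean_cst ?mxE ?subrr//; exact: bm_cst.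
  have := kernel_gap st lamE bf f0.
  rewrite (_ : \int[mu]_x (kernel_mean P f x ^+ 2) =
    \int[mu]_x ((kernel_mean_mx Z x - mx_expectation mu Z) i j ^+ 2)).
    rewrite (_ : \int[mu]_x (f x ^+ 2) =
      \int[mu]_x ((Z x - mx_expectation mu Z) i j ^+ 2))//.
    by apply: eq_Rintegral => x _; rewrite 2!mxE.
  apply: eq_Rintegral => x _; congr (_ ^+ 2); rewrite 2!mxE [in RHS]mxE.
  by rewrite /kernel_mean /f meanB ?mean_cst//; exact: bm_cst.
by apply: bmxB => //; exact: bmx_kernel_mean.
Qed.

(* The constant part and the mean-zero part of U are measured together: x^2
   dominates |E U|^2 + |U - E U|^2 / lam, written without division. *)
Definition gap_cone D (x : R) (U : T -> 'M[R]_D) : Prop :=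
  exists c, [/\ 0 <= c, frobenius_norm (mx_expectation mu U) ^+ 2 + c ^+ 2 <= x ^+ 2 &
    l2norm mu (fun y => U y - mx_expectation mu U) <= Num.sqrt lam * c].

(* The symmetric matrix [[A, k], [k, d]] has norm at most y when
   k^2 <= (y - A)(1 - d), 1 <= y and d <= 1. *)
Lemma two_by_two_bound (A k d y a c : R) : 0 <= A -> A <= y -> 1 <= y -> 0 <= d ->
  d <= 1 -> k ^+ 2 <= (y - A) * (1 - d) ->
  (A * a + k * c) ^+ 2 + (k * a + d * c) ^+ 2 <= y ^+ 2 * (a ^+ 2 + c ^+ 2).
Proof.
move=> A0 Ay y1 d0 d1 kk.
(* Cauchy-Schwarz with weights p and s. Used once for each row, it leaves a comparison of the
   coefficients of a^2 and c^2, which y >= 1 and y >= A settle. *)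
have CS (p s t u e v : R) : 0 <= p -> 0 <= s -> t ^+ 2 <= s * u -> 0 <= u ->
    (p * e + t * v) ^+ 2 <= (p + s) * (p * e ^+ 2 + u * v ^+ 2).
  move=> p0 s0 tt u0.
  have h1 : t ^+ 2 * v ^+ 2 <= s * u * v ^+ 2 by rewrite ler_wpM2r ?sqr_ge0.
  have h2 : 2 * (e * t * v) <= u * v ^+ 2 + s * e ^+ 2.
    have [u00|u00] := eqVneq u 0.
      subst u; have t0 : t ^+ 2 = 0 by apply/eqP; rewrite eq_le sqr_ge0 andbT -(mulr0 s).
      move/eqP: t0; rewrite sqrf_eq0 => /eqP ->.
      by rewrite mulr0 !mul0r mulr0 add0r mulr_ge0// sqr_ge0.
    have up : 0 < u by rewrite lt_def u00.
    rewrite -subr_ge0 -(pmulr_rge0 _ up).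
    have := sqr_ge0 (u * v - e * t).
    have : 0 <= e ^+ 2 * (s * u - t ^+ 2) by rewrite mulr_ge0 ?sqr_ge0// subr_ge0.
    by lra.
  have h3 := ler_wpM2l p0 h2.
  by lra.
have yA0 : 0 <= y - A by rewrite subr_ge0.
have d10 : 0 <= 1 - d by rewrite subr_ge0.
have e1 : (A * a + k * c) ^+ 2 <= y * (A * a ^+ 2 + (1 - d) * c ^+ 2).
  have := CS _ _ _ _ a c A0 yA0 kk d10.
  by have -> : A + (y - A) = y by ring.
have e2 : (k * a + d * c) ^+ 2 <= (y - A) * a ^+ 2 + d * c ^+ 2.
  have kk' : k ^+ 2 <= (1 - d) * (y - A) by rewrite mulrC.
  have := CS _ _ _ _ c a d0 d10 kk' yA0.
  have -> : d + (1 - d) = 1 by ring.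
  by rewrite mul1r addrC [leRHS]addrC.
have y10 : 0 <= y - 1 by rewrite subr_ge0.
have h4 := mulr_ge0 (mulr_ge0 y10 yA0) (sqr_ge0 a).
have h5 := mulr_ge0 (mulr_ge0 y10 (le_trans ler01 y1)) (sqr_ge0 c).
have h6 := mulr_ge0 (mulr_ge0 y10 d0) (sqr_ge0 c).
lra.
Qed.

Variables (D N : nat).
Hypothesis N2 : (1 < N)%N.

(** At m = theta M / 2 this is the bracket multiplying sigma^2 / M^2 in the first inequality. *)
Definition gap_factor (m : R) : R :=
  expR (2 * m) - 1 - 2 * m
  + lam * (expR (2 * m) - 1) ^+ 2 / (1 - lam * expR (2 * m)).

(** If |E U| = a and the deviation of U has norm at most sqrt(lam) c, the new pair is at most (A a +
    k c, k a + lam q c) with k = sqrt(lam) r (q - 1). The weight sqrt(lam) is what makes the two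
    off-diagonal coefficients equal. The first conclusion, before the kernel acts, serves at the
    initial state of the chain. *)
Lemma gap_step (B : T -> 'M[R]_D) m r x U : 0 <= m -> 0 <= r ->
  two_sided_bound mu B m r -> lam * expR (2 * m) < 1 -> 0 <= x ->
  bounded_measurable_mx U -> gap_cone x U ->
  frobenius_norm (mx_expectation mu (exp_conj B N U)) <= (1 + r ^+ 2 * gap_factor m) * x /\
  gap_cone ((1 + r ^+ 2 * gap_factor m) * x) (kernel_mean_mx (exp_conj B N U)).
Proof.
move=> m0 r0 BB lq x0 bU [c [c0 acx bc]].
have bB : bounded_measurable_mx B by have [[]] := BB.
have lam0 := kernel_lambda_ge0.
have sl0 : 0 <= Num.sqrt lam by exact: sqrtr_ge0.
have slE : Num.sqrt lam ^+ 2 = lam by rewrite sqr_sqrtr.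
set sl := Num.sqrt lam in sl0 slE bc *.
set q := expR (2 * m) in lq *; rewrite /gap_factor -/q.
have q1 : 1 + 2 * m <= q by exact: expR_ge1Dx.
set u := mx_expectation mu U in acx bc *.
set a := frobenius_norm u in acx *; have a0 : 0 <= a by exact: frobenius_norm_ge0.
pose w y := U y - u.
have bu v : bounded_measurable_mx (fun _ : T => v : 'M[R]_D) by exact: bmx_cst.
have bw : bounded_measurable_mx w by exact: bmxB.
set b := l2norm mu w; have b0 : 0 <= b by exact: l2norm_ge0.
have Ew : mx_expectation mu w = 0 by rewrite mx_expectationB// mx_expectation_cst subrr.
set Z := exp_conj B N U; have bZ : bounded_measurable_mx Z by exact: bmx_exp_conj.
have bAu := bmx_exp_conj N bB (bu u).
have bAw := bmx_exp_conj N bB bw.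
have ZE : Z = fun y => exp_conj B N (fun=> u) y + exp_conj B N w y.
  apply/funext => y; rewrite /Z /exp_conj -mulmxDl -mulmxDr; congr (_ *m _ *m _).
  by rewrite /w addrC subrK.
set q' := q - 1.
have q'0 : 0 <= q' by rewrite /q'; lra.
have K0 : 0 <= lam * q' ^+ 2 / (1 - lam * q).
  by rewrite divr_ge0 ?mulr_ge0 ?sqr_ge0// subr_ge0 ltW.
set K := lam * q' ^+ 2 / (1 - lam * q) in K0 *.
set y := 1 + r ^+ 2 * (q' - 2 * m + K).
have r2 : 0 <= r ^+ 2 by exact: sqr_ge0.
have y1 : 1 <= y by rewrite /y lerDl mulr_ge0// addr_ge0//; rewrite /q'; lra.
set A := 1 + r ^+ 2 * (q' - 2 * m).
have A1 : 1 <= A by rewrite /A lerDl mulr_ge0//; rewrite /q'; lra.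
have Ay : A <= y by rewrite /A /y lerD2l ler_wpM2l// lerDl.
set k := sl * r * q'.
have k0 : 0 <= k by rewrite /k !mulr_ge0.
(* The summand [K] of the factor is chosen to make this an equality. *)
have kk : k ^+ 2 <= (y - A) * (1 - lam * q).
  have -> : (y - A) = r ^+ 2 * K by rewrite /y /A; ring.
  rewrite /K -!mulrA mulVf ?mulr1; last by rewrite gt_eqF// subr_gt0.
  rewrite /k !exprMn slE le_eqVlt; apply/predU1P; left; ring.
have lq0 : 0 <= lam * q by rewrite mulr_ge0// expR_ge0.
have key := two_by_two_bound a c (le_trans ler01 A1) Ay y1 lq0 (ltW lq) kk.
have key2 : (A * a + k * c) ^+ 2 + (k * a + lam * q * c) ^+ 2 <= (y * x) ^+ 2.
  by rewrite exprMn (le_trans key)// ler_wpM2l ?sqr_ge0.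
have EZ : frobenius_norm (mx_expectation mu Z) <= A * a + k * c.
  set z := mx_expectation mu Z.
  have [z0|z0] := eqVneq (frobenius_norm z) 0.
    by rewrite z0 addr_ge0// mulr_ge0// (le_trans ler01).
  have zp : 0 < frobenius_norm z by rewrite lt_def z0 frobenius_norm_ge0.
  rewrite -(ler_pM2l zp) -expr2 frobenius_norm_sqr -[leLHS]l2dot_cstl// ZE l2dotDr//.
  have h1 := l2dot_exp_conj_cst m0 r0 BB N2 u z.
  have zu : l2dot mu (fun=> z) w = 0 by rewrite l2dot_cstl// Ew mxdot0r.
  have BBt : two_sided_bound mu (fun x => (B x)^T) m r.
    have [h11 h12 E0] := BB; split => //.
      by under [X in row_bound _ X]eq_fun do rewrite trmxK.
    apply/matrixP => i j; rewrite !mxE.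
    have /matrixP/(_ j i) := E0; rewrite !mxE => <-.
    by apply: eq_Rintegral => t _; rewrite mxE.
  have h2 := l2norm_exp_conj_sub m0 r0 BBt N2 z.
  have bAt : bounded_measurable_mx (exp_conj (fun x => (B x)^T) N (fun=> z)).
    by apply: bmx_exp_conj => //; exact: bmx_tr.
  (* The adjoint of conjugation by exp(B) is conjugation by exp(B^T). Since [w] has mean zero, [z]
     itself may be subtracted, which gains the factor [r * (q - 1)]. *)
  have wE : l2dot mu (fun=> z) (exp_conj B N w) =
      l2dot mu (fun t => exp_conj (fun x => (B x)^T) N (fun=> z) t - z) w.
    rewrite [RHS]l2dotC l2dotBr// [X in _ = _ - X]l2dotC zu subr0.
    apply: eq_Rintegral => t _; rewrite /exp_conj.
    have -> : expmx_trunc N (B t)^T = (expmx_trunc N (B t))^T.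
      rewrite /expmx_trunc linear_sum; apply: eq_bigr => i _ /=.
      by rewrite linearZ /= trmxX.
    by rewrite trmxK mxdotC -mulmxA mxdot_mull mxdot_mulr trmxK.
  have h3 : l2dot mu (fun=> z) (exp_conj B N w) <= r * q' * frobenius_norm z * b.
    rewrite wE (le_trans (ler_norm _))// (le_trans (l2dot_norm_le _ _ _))//.
      exact: bmxB.
    by rewrite ler_wpM2r.
  have h4 := le_trans (ler_norm _) h1.
  have h5 : r * q' * frobenius_norm z * b <= r * q' * frobenius_norm z * (sl * c).
    by rewrite ler_wpM2l// !mulr_ge0// frobenius_norm_ge0.
  apply: le_trans (lerD h4 (le_trans h3 h5)) _.
  by rewrite -/q -/q' -/a -/A /k le_eqVlt; apply/predU1P; left; ring.
have bcen : l2norm mu (fun t => Z t - mx_expectation mu Z) <= r * q' * a + q * b.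
  (* The deviation is measured from [u] instead of from the new mean, which can only enlarge it. *)
  have bX : bounded_measurable_mx (fun t => Z t - u) by exact: bmxB.
  have -> : (fun t => Z t - mx_expectation mu Z) =
      fun t => (Z t - u) - mx_expectation mu (fun t => Z t - u).
    apply/funext => t; rewrite mx_expectationB// mx_expectation_cst opprB.
    by rewrite addrA subrK.
  rewrite (le_trans (l2norm_center_le _ bX))//.
  have -> : (fun t => Z t - u) =
      fun t => (exp_conj B N (fun=> u) t - u) + exp_conj B N w t.
    by apply/funext => t; rewrite ZE addrAC.
  rewrite (le_trans (l2normD _ _ _))//; first exact: bmxB.
  by rewrite lerD//; [exact: l2norm_exp_conj_sub | exact: (l2norm_exp_conj m0 BB)].
have yx0 : 0 <= y * x by rewrite mulr_ge0// (le_trans ler01).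
have c'0 : 0 <= k * a + lam * q * c by rewrite addr_ge0// mulr_ge0.
have EZ0 := frobenius_norm_ge0 (mx_expectation mu Z).
have EZ2 : frobenius_norm (mx_expectation mu Z) ^+ 2 <= (A * a + k * c) ^+ 2.
  by rewrite ler_sqr// nnegrE// (le_trans EZ0).
split.
  rewrite -ler_sqr ?nnegrE// (le_trans EZ2)// (le_trans _ key2)//.
  by rewrite lerDl sqr_ge0.
exists (k * a + lam * q * c); split => //.
  rewrite mx_expectation_kernel_mean// (le_trans _ key2)// lerD2r//.
rewrite mx_expectation_kernel_mean// (le_trans (l2norm_kernel_mean_center bZ))//.
have : lam * l2norm mu (fun t => Z t - mx_expectation mu Z) <=
    lam * (r * q' * a + q * (sl * c)).
  rewrite ler_wpM2l// (le_trans bcen)// lerD2l ler_wpM2l//.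
  exact: expR_ge0.
move=> /le_trans; apply; rewrite -/sl /k -slE le_eqVlt; apply/predU1P; left; ring.
Qed.

End GapStep.

Lemma mxdot_gram (R : realType) m n (L : 'M[R]_(m, n)) Z :
  mxdot (L^T *m L) Z = mxdot L (L *m Z).
Proof. by rewrite mxdot_mull trmxK. Qed.

Lemma mxdot_conj (R : realType) m n p (L : 'M[R]_(m, n)) (A : 'M[R]_(n, p)) Z :
  mxdot L (L *m (A *m Z *m A^T)) = mxdot (L *m A) (L *m A *m Z).
Proof. by rewrite !mulmxA mxdotC mxdot_mulr trmxK mxdotC. Qed.

(** * Backward recursion along the chain *)

Section ChainProduct.
Context {disp disp' : measure_display} {T : measurableType disp}
  {Omega : measurableType disp'} {R : realType}.
Variables (P : R.-pker T ~> T) (mu : probability T R) (lam : R).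
Hypotheses (st : stationary P mu) (lamE : kernel_lambda P mu = lam%:E).
Variables (n : nat) (Pr : probability Omega R) (s : 'I_n.+1 -> {mfun Omega >-> T}).
Hypothesis s_chain : markov_chain Pr P mu s.
Variables (D N : nat).
Hypothesis N2 : (1 < N)%N.
Variables (B : 'I_n.+1 -> T -> 'M[R]_D) (m : R) (r : 'I_n.+1 -> R).
Hypotheses (m0 : 0 <= m) (r0 : forall j, 0 <= r j)
  (BB : forall j, two_sided_bound mu (B j) m (r j))
  (lq : lam * expR (2 * m) < 1).

Let bB j : bounded_measurable_mx (B j). Proof. by have [[]] := BB j. Qed.

Let y (j : nat) : R := 1 + r (inord j) ^+ 2 * gap_factor lam m.

Let y0 j : 0 <= y j.
Proof.
rewrite addr_ge0// mulr_ge0// ?sqr_ge0// addr_ge0//.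
  by have := expR_ge1Dx (2 * m); lra.
apply: divr_ge0; last by rewrite subr_ge0 ltW.
apply: mulr_ge0; [exact: (kernel_lambda_ge0 lamE) | exact: sqr_ge0].
Qed.

(** With A_i the truncated exponential at time i and L = A_(j+1) ... A_(j+k), this is A_j(x)
    E[L L^T | s_j = x] A_j(x)^T. *)
Fixpoint backward_state (j k : nat) : T -> 'M[R]_D :=
  exp_conj (B (inord j)) N
    (if k is k'.+1 then kernel_mean_mx P (backward_state j.+1 k') else fun=> 1%:M).

Let size_bound (j k : nat) : R := (\prod_(i < k.+1) y (j + i)) * Num.sqrt D%:R.

Let bsqrt : Num.sqrt (D%:R : R) ^+ 2 = D%:R. Proof. by rewrite sqr_sqrtr. Qed.

Lemma backward_state_bound j k :
  [/\ bounded_measurable_mx (backward_state j k),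
   frobenius_norm (mx_expectation mu (backward_state j k)) <= size_bound j k &
   gap_cone mu lam (size_bound j k) (kernel_mean_mx P (backward_state j k))].
Proof.
elim: k j => [|k IH] j.
  have b1 : bounded_measurable_mx (fun _ : T => 1%:M : 'M[R]_D) by exact: bmx_cst.
  have c1 : gap_cone mu lam (Num.sqrt D%:R) (fun _ : T => 1%:M : 'M[R]_D).
    exists 0; split => //.
      rewrite expr0n addr0 mx_expectation_cst frobenius_norm_sqr bsqrt.
      rewrite /mxdot (eq_bigr (fun=> 1)).
        by rewrite sumr_const card_ord.
      move=> i _; rewrite (bigD1 i)//= mxE eqxx mulr1 big1 ?addr0// => l li.
      by rewrite mxE eq_sym (negbTE li) mulr0.
    by rewrite mx_expectation_cst mulr0; under eq_fun do rewrite subrr; rewrite l2norm0.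
  have sz : size_bound j 0 = y j * Num.sqrt D%:R.
    by rewrite /size_bound big_ord1 addn0.
  have [h1 h2] := gap_step st lamE N2 m0 (r0 (inord j)) (BB (inord j)) lq
    (sqrtr_ge0 _) b1 c1.
  by rewrite sz; split => //; exact: bmx_exp_conj.
have [b1 _ c1] := IH j.+1.
have sz : size_bound j k.+1 = y j * size_bound j.+1 k.
  rewrite /size_bound big_ord_recl addn0 -mulrA; congr (_ * (_ * _)).
  by apply: eq_bigr => i _; rewrite /= /bump add1n addSnnS.
have x0 : 0 <= size_bound j.+1 k.
  by rewrite mulr_ge0 ?sqrtr_ge0//; apply: prodr_ge0 => i _.
have [h1 h2] := gap_step st lamE N2 m0 (r0 (inord j)) (BB (inord j)) lq
    x0 (bmx_kernel_mean P b1) c1.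
by rewrite sz; split => //; apply: bmx_exp_conj => //; exact: bmx_kernel_mean.
Qed.

Let A (i : nat) (w : Omega) : 'M[R]_D := expmx_trunc N (B (inord i) (s (inord i) w)).
Let L (j : nat) (w : Omega) : 'M[R]_D := \prod_(i < j) A i w.

Let LS j w : L j.+1 w = L j w *m A j w.
Proof. by rewrite /L big_ord_recr. Qed.

Lemma bmx_past_product (j k : nat) : (j <= k.+1)%N -> (k <= n)%N ->
  bounded_measurable_mx (L j : chain_past_type s (inord k) -> 'M[R]_D).
Proof.
elim: j => [|j IH] jk kn.
  have -> : L 0 = fun=> 1%:M by apply/funext => w; rewrite /L big_ord0.
  exact: bmx_cst.
have -> : L j.+1 = fun w => L j w *m A j w by apply/funext => w; exact: LS.
apply: bmx_mul; first by apply: IH => //; exact: ltnW.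
have bA : bounded_measurable_mx (fun x => expmx_trunc N (B (inord j) x)).
  by apply: bmx_sum => i; apply: bmxZ; exact: bmxX.
move=> a b; apply: (bm_comp (f := fun x => expmx_trunc N (B (inord j) x) a b)) => //.
apply: measurable_past; rewrite !inordK ?ltnS//.
by rewrite (leq_trans _ kn).
Qed.

Let val_at (j k : nat) : R :=
  \int[Pr]_w mxdot (L j w) (L j w *m backward_state j k (s (inord j) w)).

(** The factor at time j moves from the backward state into the past product, and the Markov
    property replaces the kernel mean at time j by the state at time j + 1. The Gram matrix [Y] of
    the past product makes the integrand linear in the entries of that state. *)
Let val_atS j k : (j + k.+1 = n)%N -> val_at j k.+1 = val_at j.+1 k.
Proof.
move=> jk.
have jn : (j.+1 <= n)%N by rewrite -jk addnS ltnS leq_addr.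
have bZ : bounded_measurable_mx (backward_state j.+1 k).
  by have [] := backward_state_bound j.+1 k.
pose Y (w : Omega) := (L j.+1 w)^T *m L j.+1 w.
have bY : bounded_measurable_mx (Y : chain_past_type s (inord j) -> 'M[R]_D).
  have := bmx_past_product (leqnn j.+1) (ltnW jn) => bL.
  by apply: bmx_mul => //; exact: bmx_tr.
transitivity (\int[Pr]_w (\sum_a \sum_b Y w a b *
    kernel_mean P (fun x => backward_state j.+1 k x a b) (s (inord j) w))).
  apply: eq_Rintegral => w _.
  rewrite /= /exp_conj -/(A j w) [X in _ = X](_ : _ =
    mxdot (Y w) (kernel_mean_mx P (backward_state j.+1 k) (s (inord j) w))).
    by rewrite /Y mxdot_gram LS mxdot_conj.
  by apply: eq_bigr => a _; apply: eq_bigr => b _; congr (_ * _); rewrite mxE.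
transitivity (\int[Pr]_w (\sum_a \sum_b Y w a b *
    backward_state j.+1 k (s (inord j.+1) w) a b)).
  have bYw : bounded_measurable_mx Y
    by move=> a b; apply: (bm_past (s := s) (j := inord j)); exact: bY.
  have ms i : measurable_fun setT (s i) by [].
  have bP a b : bounded_measurable (fun w =>
      kernel_mean P (fun x => backward_state j.+1 k x a b) (s (inord j) w)).
    exact: (bm_comp (ms (inord j)) (bm_kernel_mean P (bZ a b))).
  have bZs a b : bounded_measurable (fun w =>
      backward_state j.+1 k (s (inord j.+1) w) a b).
    exact: (bm_comp (ms (inord j.+1)) (bZ a b)).
  rewrite mean_sum; last by move=> a; apply: bm_sum => b; exact: bmM.
  rewrite mean_sum; last by move=> a; apply: bm_sum => b; exact: bmM.
  apply: eq_bigr => a _.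
  rewrite mean_sum; last by move=> b; exact: bmM.
  rewrite mean_sum; last by move=> b; exact: bmM.
  apply: eq_bigr => b _; apply/esym.
  apply: (mean_markov_step s_chain _ (bY a b) (bZ a b)).
  by rewrite !inordK// ltnS// ltnW.
apply: eq_Rintegral => w _; rewrite -/(mxdot (Y w) _) /Y.
by rewrite mxdot_gram.
Qed.

Lemma mean_chain_product :
  \int[Pr]_w mxdot (\prod_(j < n.+1) expmx_trunc N (B j (s j w)))
                   (\prod_(j < n.+1) expmx_trunc N (B j (s j w))) <=
  D%:R * \prod_(j < n.+1) (1 + r j ^+ 2 * gap_factor lam m).
Proof.
have -> : \int[Pr]_w mxdot (\prod_(j < n.+1) expmx_trunc N (B j (s j w)))
                   (\prod_(j < n.+1) expmx_trunc N (B j (s j w))) = val_at n 0.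
  apply: eq_Rintegral => w _.
  have -> : \prod_(j < n.+1) expmx_trunc N (B j (s j w)) = L n.+1 w.
    by apply: eq_bigr => j _; rewrite /A inord_val.
  by rewrite LS /= /exp_conj -/(A n w) mxdot_conj mulmx1.
(* [val_at] is constant along j + k = n. At j = 0 the past product is empty and only the mean of the
   backward state remains. *)
have -> : val_at n 0 = val_at 0 n.
  suff : forall k, (k <= n)%N -> val_at n 0 = val_at (n - k) k.
    by move=> /(_ n (leqnn n)); rewrite subnn.
  elim=> [|k IH] kn; first by rewrite subn0.
  by rewrite IH ?(ltnW kn)// -(subnSK kn) -val_atS// subnK.
have [bZ h1 _] := backward_state_bound 0 n.
have -> : val_at 0 n = mxdot 1%:M (mx_expectation mu (backward_state 0 n)).
  rewrite -l2dot_cstl// /l2dot -(mean_initial s_chain (i := inord 0)); last 2 first.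
  - by rewrite inordK.
  - by apply: bm_mxdot => //; exact: bmx_cst.
  by apply: eq_Rintegral => w _; rewrite /L big_ord0 mul1mx.
rewrite (le_trans (ler_norm _))// (le_trans (mxdot_norm_le _ _))//.
have -> : frobenius_norm (1%:M : 'M[R]_D) = Num.sqrt D%:R.
  rewrite frobenius_normE /mxdot (eq_bigr (fun=> 1)).
    by rewrite sumr_const card_ord.
  move=> i _; rewrite (bigD1 i)//= mxE eqxx mulr1 big1 ?addr0// => l li.
  by rewrite mxE eq_sym (negbTE li) mulr0.
rewrite (le_trans (ler_wpM2l (sqrtr_ge0 _) h1))// /size_bound mulrCA -expr2 bsqrt mulrC.
rewrite le_eqVlt; apply/predU1P; left; congr (_ * _); apply: eq_bigr => j _.
by rewrite /y add0n inord_val.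
Qed.

End ChainProduct.

(** * The first inequality *)

Section ExpmxLimit.
Context {R : realType}.

Lemma mx_entry_le_frobenius m n (A : 'M[R]_(m, n)) i j : `|A i j| <= frobenius_norm A.
Proof.
rewrite -[leLHS]sqrtr_sqr frobenius_normE ler_sqrt ?mxdot_ge0//.
rewrite /mxdot (bigD1 i)//= (bigD1 j)//= -expr2 -addrA lerDl.
by rewrite addr_ge0// ?sumr_ge0// => [k _|k _]; rewrite -?expr2 ?sqr_ge0//;
  apply: sumr_ge0 => l _; rewrite -expr2 sqr_ge0.
Qed.

Lemma mxdot1 n : mxdot (1%:M : 'M[R]_n) 1%:M = n%:R.
Proof.
rewrite /mxdot (eq_bigr (fun=> 1)) ?sumr_const ?card_ord// => i _.
rewrite (bigD1 i)//= mxE eqxx mulr1 big1 ?addr0// => l li.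
by rewrite mxE eq_sym (negbTE li) mulr0.
Qed.

Lemma frobenius_normX_le n (A : 'M[R]_n) k :
  frobenius_norm (A ^+ k) <= Num.sqrt n%:R * frobenius_norm A ^+ k.
Proof.
have := opnorm_le_mull 1%:M (opnorm_leX k (frobenius_norm_opnorm A)).
rewrite mulmx1 mxdot1 -frobenius_norm_sqr => h.
rewrite -ler_sqr ?nnegrE ?mulr_ge0 ?sqrtr_ge0 ?exprn_ge0 ?frobenius_norm_ge0//.
by rewrite (le_trans h)// exprMn sqr_sqrtr// mulrC.
Qed.

(** [expmx] is a limit of matrices. Each entry converges absolutely, dominated by sqrt(n) times the
    exponential series at |A|_F, and finitely many entries converge uniformly. *)
Lemma expmx_trunc_cvg n (A : 'M[R]_n) i j :
  expmx_trunc N A i j @[N --> \oo] --> expmx A i j.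
Proof.
pose a i j := limn (series (fun k => (k`!%:R)^-1 * (A ^+ k) i j)).
have truncE i' j' : (fun N => expmx_trunc N A i' j') =
    series (fun k => (k`!%:R)^-1 * (A ^+ k) i' j').
  apply/funext => N; rewrite /expmx_trunc /series /= big_mkord summxE.
  by apply: eq_bigr => k _; rewrite mxE.
have ca i' j' : expmx_trunc N A i' j' @[N --> \oo] --> a i' j'.
  rewrite truncE; suff : cvgn (series (fun k => (k`!%:R)^-1 * (A ^+ k) i' j')) by [].
  apply: normed_cvg; apply: (@series_le_cvg _ _
     (Num.sqrt n%:R *: exp_coeff (frobenius_norm A))).
  - by move=> k; exact: normr_ge0.
  - move=> k; rewrite /= mulr_ge0 ?sqrtr_ge0//; apply: exp_coeff_ge0.
    exact: frobenius_norm_ge0.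
  - move=> k; rewrite /= normrM ger0_norm ?invr_ge0// /exp_coeff /=.
    rewrite [leRHS]mulrA [leRHS]mulrC ler_wpM2l ?invr_ge0//.
    by rewrite (le_trans (mx_entry_le_frobenius _ _ _))// frobenius_normX_le.
  - by apply: is_cvg_seriesZ; exact: is_cvg_series_exp_coeff.
have h : (fun N => expmx_trunc N A) @ \oo --> (\matrix_(i, j) a i j : 'M[R]_n).
  apply/cvgrPdist_le => e e0.
  have : \forall N \near \oo, forall i' j', `|a i' j' - expmx_trunc N A i' j'| <= e.
    apply: filter_forall => i'; apply: filter_forall => j'.
    by move/cvgrPdist_le : (ca i' j'); exact.
  apply: filterS => N hN; rewrite [leLHS]mx_normrE.
  apply: bigmax_le => [|[i' j'] _]; first exact: ltW.
  by have := hN i' j'; rewrite !mxE.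
suff -> : expmx A = \matrix_(i, j) a i j by rewrite mxE; exact: ca.
apply: cvg_lim => //; rewrite (_ : series _ = fun N => expmx_trunc N A)//.
by apply/funext => N; rewrite /expmx_trunc /series /= big_mkord.
Qed.

Lemma cvgn_sum (I : Type) (r : seq I) (f : nat -> I -> R) (l : I -> R) :
  (forall i, f N i @[N --> \oo] --> l i) ->
  \sum_(i <- r) f N i @[N --> \oo] --> \sum_(i <- r) l i.
Proof.
move=> fl; elim: r => [|i r IH].
  by under eq_fun do rewrite big_nil; rewrite big_nil; exact: cvg_cst.
under eq_fun do rewrite big_cons; rewrite big_cons.
by apply: cvgD => //; exact: fl.
Qed.

Lemma cvg_mulmx_entries n (u v : nat -> 'M[R]_n) (a b : 'M[R]_n) :
  (forall i j, u N i j @[N --> \oo] --> a i j) ->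
  (forall i j, v N i j @[N --> \oo] --> b i j) ->
  forall i j, (u N *m v N) i j @[N --> \oo] --> (a *m b) i j.
Proof.
move=> ua vb i j.
have -> : (fun N => (u N *m v N) i j) = fun N => \sum_k u N i k * v N k j.
  by apply/funext => N; rewrite mxE.
have -> : (a *m b) i j = \sum_k a i k * b k j by rewrite mxE.
by apply: cvgn_sum => k; apply: cvgM; [exact: ua | exact: vb].
Qed.

Lemma cvg_prod_expmx_trunc n p (A : 'I_p -> 'M[R]_n) i j :
  (\prod_(k < p) expmx_trunc N (A k)) i j @[N --> \oo] -->
  (\prod_(k < p) expmx (A k)) i j.
Proof.
elim: p A i j => [|p IH] A i j.
  by under eq_fun do rewrite big_ord0; rewrite big_ord0; exact: cvg_cst.
under eq_fun do rewrite big_ord_recl; rewrite big_ord_recl.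
apply: cvg_mulmx_entries => a b; first exact: expmx_trunc_cvg.
exact: IH.
Qed.

Lemma cvg_mxdot_entries m n (u : nat -> 'M[R]_(m, n)) (a : 'M[R]_(m, n)) :
  (forall i j, u N i j @[N --> \oo] --> a i j) ->
  mxdot (u N) (u N) @[N --> \oo] --> mxdot a a.
Proof.
move=> ua; apply: cvgn_sum => i; apply: cvgn_sum => j.
by apply: cvgM; exact: ua.
Qed.

End ExpmxLimit.

Section FirstPart.
Context {disp disp' : measure_display} {T : measurableType disp}
  {Omega : measurableType disp'} {R : realType}.
Variables (mu : probability T R) (d : nat) (F : T -> 'M[R]_d) (V M : R).
Hypotheses (F_measurable : forall a b : 'I_d,
     measurable_fun [set: T] (fun x : T => F x a b))
  (F_sym : forall x : T, (F x)^T = F x)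
  (F_mean : mx_expectation mu F = 0)
  (F_var : spectral_norm (mx_expectation mu (fun x : T => F x ^+ 2)) <= V)
  (M_gt0 : 0 < M)
  (F_bound : forall x : T, spectral_norm (F x) <= M).

Lemma bmx_spectral_bound : bounded_measurable_mx F.
Proof.
move=> a b; split; first exact: F_measurable.
exists M => x; have := spectral_norm_opnorm (F_bound x) (delta_mx b 0).
have -> : mxdot (delta_mx b 0 : 'cV[R]_d) (delta_mx b 0) = 1.
  rewrite /mxdot (bigD1 b)//= !big_ord1 !mxE !eqxx mulr1 big1 ?addr0// => i ib.
  by rewrite big_ord1 !mxE (negbTE ib) mul0r.
rewrite mulr1 -colE => h.
rewrite -ler_sqr ?nnegrE ?(ltW M_gt0)//; apply: le_trans h.
rewrite real_normK ?num_real// /mxdot (bigD1 a)//= big_ord1 !mxE -expr2 lerDl.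
by apply: sumr_ge0 => i _; rewrite big_ord1 -expr2 sqr_ge0.
Qed.

Lemma variance_opnorm (v : 'cV[R]_d) :
  \int[mu]_x mxdot (F x *m v) (F x *m v) <= V * mxdot v v.
Proof.
have bF := bmx_spectral_bound.
have V0 : 0 <= V by exact: le_trans (spectral_norm_ge0 _) F_var.
have bF2 : bounded_measurable_mx (fun x => F x ^+ 2) by exact: bmxX.
have -> : \int[mu]_x mxdot (F x *m v) (F x *m v) =
    mxdot v (mx_expectation mu (fun x => F x ^+ 2) *m v).
  rewrite mxdotC mxdot_mulr mxdotC -l2dot_cstl//.
  apply: eq_Rintegral => x _; rewrite mxdot_mull F_sym mxdotC mulmxA mxdot_mulr mxdotC.
  by rewrite expr2.
apply: le_trans (ler_norm _) _.
rewrite (le_trans (mxdot_norm_le _ _))//.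
have h : frobenius_norm (mx_expectation mu (fun x => F x ^+ 2) *m v) <=
    V * frobenius_norm v.
  rewrite -ler_sqr ?nnegrE ?mulr_ge0 ?frobenius_norm_ge0//.
  by rewrite exprMn !frobenius_norm_sqr; exact: (spectral_norm_opnorm F_var).
rewrite (le_trans (ler_wpM2l (frobenius_norm_ge0 _) h))//.
by rewrite mulrCA -expr2 frobenius_norm_sqr.
Qed.

End FirstPart.

Section FirstInequality.
Context {disp disp' : measure_display} {T : measurableType disp}
  {Omega : measurableType disp'} {R : realType}.
Variables (P : R.-pker T ~> T) (mu : probability T R) (lam : R).
Hypotheses (st : stationary P mu) (lamE : kernel_lambda P mu = lam%:E).
Variables (n : nat) (Pr : probability Omega R) (s : 'I_n.+1 -> {mfun Omega >-> T}).
Hypothesis s_chain : markov_chain Pr P mu s.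

Lemma mean_chain_product_exp D N (B : 'I_n.+1 -> T -> 'M[R]_D) (m : R)
    (r : 'I_n.+1 -> R) : (1 < N)%N -> 0 <= m -> (forall j, 0 <= r j) ->
  (forall j, two_sided_bound mu (B j) m (r j)) -> lam * expR (2 * m) < 1 ->
  \int[Pr]_w mxdot (\prod_(j < n.+1) expmx_trunc N (B j (s j w)))
                   (\prod_(j < n.+1) expmx_trunc N (B j (s j w))) <=
  D%:R * expR ((\sum_(j < n.+1) r j ^+ 2) * gap_factor lam m).
Proof.
move=> N2 m0 r0 BB lq.
rewrite (le_trans (mean_chain_product st lamE s_chain N2 m0 r0 BB lq))//.
rewrite ler_wpM2l// mulr_suml expR_sum; apply: ler_prod => j _.
rewrite expR_ge1Dx andbT addr_ge0// mulr_ge0 ?sqr_ge0// addr_ge0//.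
  by have := expR_ge1Dx (2 * m); lra.
apply: divr_ge0; last by rewrite subr_ge0 ltW.
apply: mulr_ge0; [exact: (kernel_lambda_ge0 lamE) | exact: sqr_ge0].
Qed.

Variables (d : nat) (F : 'I_n.+1 -> T -> 'M[R]_d) (V : 'I_n.+1 -> R) (M : R).
Hypotheses (F_measurable : forall (j : 'I_n.+1) (a b : 'I_d),
     measurable_fun [set: T] (fun x : T => F j x a b))
  (F_sym : forall (j : 'I_n.+1) (x : T), (F j x)^T = F j x)
  (F_mean : forall j : 'I_n.+1, mx_expectation mu (F j) = 0)
  (F_var : forall j : 'I_n.+1,
     spectral_norm (mx_expectation mu (fun x : T => F j x ^+ 2)) <= V j)
  (M_gt0 : 0 < M)
  (F_bound : forall (j : 'I_n.+1) (x : T), spectral_norm (F j x) <= M).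

Lemma bmx_F j : bounded_measurable_mx (F j).
Proof. exact: (bmx_spectral_bound (F_measurable j) M_gt0 (F_bound j)). Qed.

Lemma variance_ge0 j : 0 <= V j.
Proof. exact: le_trans (spectral_norm_ge0 _) (F_var j). Qed.

Definition std_ratio j : R := Num.sqrt (V j) / M.

Lemma std_ratio_ge0 j : 0 <= std_ratio j.
Proof. by rewrite divr_ge0 ?sqrtr_ge0// ltW. Qed.

Lemma sum_std_ratio : \sum_j std_ratio j ^+ 2 = (\sum_j V j) / M ^+ 2.
Proof.
rewrite mulr_suml; apply: eq_bigr => j _; rewrite /std_ratio expr_div_n sqr_sqrtr//.
exact: variance_ge0.
Qed.

Lemma two_sided_bound_symmetric (theta : R) j : 0 < theta ->
  two_sided_bound mu (fun x => (theta / 2) *: F j x) (theta * M / 2) (std_ratio j).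
Proof.
move=> theta0.
have bF := bmx_F j.
have rb : row_bound mu (fun x => (theta / 2) *: F j x) (theta * M / 2) (std_ratio j).
  split.
  - exact: bmxZ.
  - move=> x v; rewrite -scalemxAl mxdotZl mxdotZr mulrA -expr2.
    have -> : theta * M / 2 = theta / 2 * M by rewrite mulrAC.
    rewrite [X in _ <= X * _]exprMn -[leRHS]mulrA ler_wpM2l ?sqr_ge0//.
    exact: (spectral_norm_opnorm (F_bound j x)).
  - move=> v; have -> : (std_ratio j * (theta * M / 2)) ^+ 2 = (theta / 2) ^+ 2 * V j.
      rewrite -[in RHS](sqr_sqrtr (variance_ge0 j)) -exprMn; congr (_ ^+ 2).
      by rewrite /std_ratio; field; rewrite gt_eqF.
    have bFv : bounded_measurable_mx (fun x => F j x *m v).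
      by apply: bmx_mul => //; exact: bmx_cst.
    rewrite (_ : \int[mu]_x _ = (theta / 2) ^+ 2 *
        \int[mu]_x mxdot (F j x *m v) (F j x *m v)).
      rewrite -mulrA ler_wpM2l ?sqr_ge0//.
      exact: (variance_opnorm (F_measurable j) (F_sym j) (F_var j) M_gt0 (F_bound j)).
    rewrite -meanZ; last exact: bm_mxdot.
    by apply: eq_Rintegral => x _; rewrite -scalemxAl mxdotZl mxdotZr mulrA -expr2.
split => //.
  by under [X in row_bound _ X]eq_fun do rewrite linearZ /= F_sym.
apply/matrixP => a b; rewrite !mxE.
have /matrixP/(_ a b) := F_mean j; rewrite !mxE => Fab.
rewrite (@eq_Rintegral _ _ _ mu setT (fun x => theta / 2 * F j x a b)); last first.
  by move=> x _; rewrite mxE.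
by rewrite meanZ// Fab mulr0.
Qed.

Lemma gap_condition (theta : R) : 0 < theta ->
  (lam != 0 -> theta < ln (1 / lam) / M) -> lam * expR (2 * (theta * M / 2)) < 1.
Proof.
move=> theta0 h; have [->|l0] := eqVneq lam 0; first by rewrite mul0r ltr01.
have lp : 0 < lam by rewrite lt_def l0 (kernel_lambda_ge0 lamE).
have := h l0; rewrite ltr_pdivlMr// => hl.
have : expR (theta * M) < 1 / lam.
  by rewrite -[ltRHS]lnK ?ltr_expR// posrE divr_gt0.
rewrite ltr_pdivlMr// mulrC; congr (_ * expR _ < 1).
by field.
Qed.

(** The bound for truncations does not depend on the number of terms, so Fatou's lemma carries it to
    the exponentials. Truncations start at two terms, where the linear one is present. *)
Lemma first_inequality (theta : R) : 0 < theta ->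
  (lam != 0 -> theta < ln (1 / lam) / M) ->
  ('E_Pr[(fun w : Omega =>
     (frobenius_norm (\prod_(j < n.+1) expmx ((theta / 2) *: F j (s j w))) ^+ 2)%R)]
   <= (d%:R * expR ((\sum_j V j) / M ^+ 2 * gap_factor lam (theta * M / 2)))%:E)%E.
Proof.
move=> theta0 h; have lq := gap_condition theta0 h.
have m0 : 0 <= theta * M / 2 by rewrite divr_ge0 ?mulr_ge0// ltW.
pose C : R := d%:R * expR ((\sum_j V j) / M ^+ 2 * gap_factor lam (theta * M / 2)).
pose A (N : nat) w : 'M[R]_d :=
  \prod_(j < n.+1) expmx_trunc N.+2 ((theta / 2) *: F j (s j w)).
have bA N : bounded_measurable_mx (A N).
  have : forall r : seq 'I_n.+1, bounded_measurable_mx (fun w =>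
      (\prod_(j <- r) expmx_trunc N.+2 ((theta / 2) *: F j (s j w)) : 'M[R]_d)).
    elim=> [|j r IH].
      by under eq_fun do rewrite big_nil; exact: bmx_cst.
    under eq_fun do rewrite big_cons; apply: bmx_mul => //.
    have bT : bounded_measurable_mx (fun x => expmx_trunc N.+2 ((theta / 2) *: F j x)).
      by apply: bmx_sum => k; apply: bmxZ; apply: bmxX; apply: bmxZ; exact: bmx_F.
    by move=> a b; exact: (bm_comp (f := fun x => expmx_trunc N.+2 ((theta / 2) *: F j x) a b)).
  exact.
have intA N : (\int[Pr]_w (mxdot (A N w) (A N w))%:E <= C%:E)%E.
  rewrite mean_EFin; last exact: bm_mxdot.
  rewrite lee_fin /C -sum_std_ratio.
  exact: (mean_chain_product_exp (B := fun j x => (theta / 2) *: F j x)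
    _ m0 std_ratio_ge0 (fun j => two_sided_bound_symmetric j theta0) lq).
have limA w : mxdot (A N w) (A N w) @[N --> \oo] -->
    frobenius_norm (\prod_(j < n.+1) expmx ((theta / 2) *: F j (s j w))) ^+ 2.
  rewrite frobenius_norm_sqr; apply: cvg_mxdot_entries => a b.
  have := @cvg_prod_expmx_trunc _ _ _ (fun j => (theta / 2) *: F j (s j w)) a b.
  by rewrite -(cvg_shiftn 2); under eq_fun do rewrite addn2.
rewrite unlock.
have -> : (\int[Pr]_w (frobenius_norm (\prod_(j < n.+1) expmx ((theta / 2) *: F j (s j w))) ^+ 2)%:E
    = \int[Pr]_w limn_einf (fun N => (mxdot (A N w) (A N w))%:E))%E.
  apply: eq_integral => w _; have cA : (mxdot (A N w) (A N w))%:E @[N --> \oo] -->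
      (frobenius_norm (\prod_(j < n.+1) expmx ((theta / 2) *: F j (s j w))) ^+ 2)%:E.
    by apply: cvg_EFin; [exact: nearW | exact: limA].
  rewrite is_cvg_limn_einfE; last by apply/cvg_ex; eexists; exact: cA.
  by apply/esym/cvg_lim.
apply: le_trans (fatou Pr measurableT (f := fun N w => (mxdot (A N w) (A N w))%:E) _ _) _.
- by move=> N; apply/measurable_EFinP; have [] := bm_mxdot (bA N) (bA N).
- by move=> N w _; rewrite lee_fin mxdot_ge0.
rewrite limn_einf_lim; apply: lime_le; first exact: is_cvg_einfs.
apply: nearW => N; apply: le_trans (intA N).
by apply: ereal_inf_lbound; exists N => /=.
Qed.

End FirstInequality.

(** * Truncated exponentials *)

Section TruncatedExponentialOfNormal.
Context {R : realType}.

Lemma sum_antidiagonals (V : zmodType) (g : nat -> nat -> V) N :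
  \sum_(j < N) \sum_(i < j.+1) g (j - i)%N i =
  \sum_(k < N) \sum_(l < N | (k + l < N)%N) g k l.
Proof.
have -> : \sum_(j < N) \sum_(i < j.+1) g (j - i)%N i =
    \sum_(j < N) \sum_(i < N | (i <= j)%N) g (j - i)%N i.
  by apply: eq_bigr => j _; rewrite (big_ord_widen N (fun i => g (j - i)%N i)).
rewrite (exchange_big_dep xpredT)//= [RHS](exchange_big_dep xpredT)//=.
apply: eq_bigr => i _.
rewrite -(big_geq_mkord i N xpredT (fun j => g (j - i)%N i)) -{1}(add0n (nat_of_ord i)).
rewrite big_addn big_mkord (big_ord_widen N (fun k => g (k + i - i)%N i)) ?leq_subr//.
apply: eq_big => [k|k _]; first by rewrite ltn_subRL addnC.
by rewrite addnK.
Qed.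

Let c (k : nat) : R := (k`!%:R)^-1.

Let c_ge0 k : 0 <= c k. Proof. by rewrite invr_ge0. Qed.

Let c_bin j i : (i <= j)%N -> c j * 'C(j, i)%:R = c (j - i) * c i.
Proof.
move=> ij; have f0 k : (k`!%:R : R) != 0 by rewrite pnatr_eq0 -lt0n fact_gt0.
have /(congr1 (fun k => k%:R : R)) := bin_fact ij.
rewrite !natrM => e.
apply: (mulfI (f0 j)); rewrite mulrA divff// mul1r -e /c.
by field; rewrite !f0.
Qed.

Lemma expmx_truncD n N (A B : 'M[R]_n) : GRing.comm A B ->
  expmx_trunc N (A + B) =
  \sum_(k < N) \sum_(l < N | (k + l < N)%N) (c k * c l) *: (A ^+ k *m B ^+ l).
Proof.
move=> AB.
rewrite -(sum_antidiagonals (fun k l => (c k * c l) *: (A ^+ k *m B ^+ l))).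
apply: eq_bigr => j _; rewrite exprDn_comm// scaler_sumr; apply: eq_bigr => i _.
by have <- := c_bin (ltn_ord i : (i <= j)%N); rewrite -[(_ * _) *+ _]scaler_nat scalerA.
Qed.

Lemma exp_truncD N (a b : R) :
  exp_trunc N (a + b) =
  \sum_(k < N) \sum_(l < N | (k + l < N)%N) (c k * c l) * (a ^+ k * b ^+ l).
Proof.
rewrite -(sum_antidiagonals (fun k l => (c k * c l) * (a ^+ k * b ^+ l))).
apply: eq_bigr => j _; rewrite exprDn mulr_sumr; apply: eq_bigr => i _.
by have <- := c_bin (ltn_ord i : (i <= j)%N); rewrite -[(_ * _) *+ _]mulr_natl; exact: mulrA.
Qed.

(* The failure of [exp_trunc N] to be of modulus 1 on the imaginary axis: there
   its squared modulus is at most [1 + exp_tail N k] on the disc of radius [k]. *)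
Definition exp_tail N (k : R) : R := exp_trunc N k ^+ 2 - exp_trunc N (2 * k).

Lemma exp_tailE N k : exp_tail N k =
  \sum_(i < N) \sum_(l < N | ~~ (i + l < N)%N) (c i * c l) * (k ^+ i * k ^+ l).
Proof.
rewrite /exp_tail (_ : 2 * k = k + k) ?exp_truncD ?expr2; last by rewrite mulr_natl.
rewrite mulr_suml -sumrB; apply: eq_bigr => i _; rewrite mulr_sumr.
rewrite (bigID (fun l : 'I_N => (i + l < N)%N)) /= addrAC.
rewrite (eq_bigr (fun l : 'I_N => c i * c l * (k ^+ i * k ^+ l))); last first.
  by move=> l _; rewrite /c; ring.
rewrite subrr add0r; apply: eq_bigr => l _; rewrite /c; ring.
Qed.

Lemma exp_tail_ge0 N k : 0 <= k -> 0 <= exp_tail N k.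
Proof.
move=> k0; rewrite exp_tailE; apply: sumr_ge0 => i _; apply: sumr_ge0 => l _.
by rewrite !mulr_ge0 ?exprn_ge0.
Qed.

(** By [exp_tailE] only monomials of degree at least N >= 2 occur. The factor y^2 compensates the
    weight y^(-2) on the imaginary axis. *)
Lemma exp_tail_scale N y k : (1 < N)%N -> 0 <= y <= 1 -> 0 <= k ->
  exp_tail N (y * k) <= y ^+ 2 * exp_tail N k.
Proof.
move=> N2 /andP[y0 y1] k0; rewrite !exp_tailE mulr_sumr; apply: ler_sum => i _.
rewrite mulr_sumr; apply: ler_sum => l; rewrite -leqNgt => il.
have -> : c i * c l * ((y * k) ^+ i * (y * k) ^+ l) =
   y ^+ (i + l) * (c i * c l * (k ^+ i * k ^+ l)).
  by rewrite !exprMn exprD; ring.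
rewrite ler_wpM2r ?mulr_ge0 ?exprn_ge0//.
by rewrite ler_wiXn2l// (leq_trans N2).
Qed.

Lemma exp_tail_le N k : 0 <= k -> exp_tail N k <= expR (2 * k) - exp_trunc N (2 * k).
Proof.
move=> k0; rewrite lerD2r mulr_natl mulr2n expRD -expr2.
by rewrite ler_sqr ?nnegrE ?expR_ge0 ?exp_trunc_ge0//; exact: exp_trunc_le_expR.
Qed.

Lemma exp_tail_cvg0 k : 0 <= k -> exp_tail N k @[N --> \oo] --> 0.
Proof.
move=> k0.
have h : expR (2 * k) - exp_trunc N (2 * k) @[N --> \oo] --> 0.
  rewrite -(subrr (expR (2 * k))); apply: cvgB; first exact: cvg_cst.
  exact: exp_trunc_cvg.
apply: (squeeze_cvgr _ (cvg_cst 0) h); apply: nearW => N.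
by rewrite exp_tail_ge0//= exp_tail_le.
Qed.

(** With X = |A^T v|^2 = <v, A A^T v>, Cauchy-Schwarz gives X^2 <= |v|^2 k^2 X. *)
Lemma opnorm_le_tr m n (A : 'M[R]_(m, n)) k : 0 <= k -> opnorm_le A k -> opnorm_le A^T k.
Proof.
move=> k0 Ak v.
have h := mxdot_CS v (A *m (A^T *m v)).
have h2 : mxdot v (A *m (A^T *m v)) = mxdot (A^T *m v) (A^T *m v).
  by rewrite [RHS]mxdot_mull trmxK.
rewrite h2 in h; have h3 := Ak (A^T *m v).
set X := mxdot (A^T *m v) (A^T *m v) in h h3 *.
have [X0|X0] := eqVneq X 0; first by rewrite X0 mulr_ge0 ?sqr_ge0// mxdot_ge0.
have Xp : 0 < X by rewrite lt_def X0 mxdot_ge0.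
rewrite -(ler_pM2r Xp) -expr2 (le_trans h)//.
by rewrite (le_trans (ler_wpM2l (mxdot_ge0 v) h3))// mulrCA mulrA.
Qed.

(* For commuting K and K^T the two double sums differ by the terms with
   k + l >= N only. *)
Lemma expmx_trunc_normal n N (K : 'M[R]_n) (k : R) (v : 'cV[R]_n) :
  0 <= k -> GRing.comm K^T K -> opnorm_le K k ->
  mxdot (expmx_trunc N K *m v) (expmx_trunc N K *m v) <=
  mxdot v (expmx_trunc N (K^T + K) *m v) + exp_tail N k * mxdot v v.
Proof.
move=> k0 KK Kk; have Ktk := opnorm_le_tr k0 Kk.
have -> : mxdot (expmx_trunc N K *m v) (expmx_trunc N K *m v) =
    \sum_(i < N) \sum_(l < N) (c i * c l) * mxdot v (K^T ^+ i *m K ^+ l *m v).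
  rewrite mxdot_mull /expmx_trunc linear_sum mulmx_suml mxdot_sumr.
  apply: eq_bigr => i _; rewrite linearZ /= trmxX mulmx_suml mulmx_sumr mxdot_sumr.
  apply: eq_bigr => l _; rewrite -!scalemxAl -scalemxAr scalerA mxdotZr.
  by rewrite mulmxA.
rewrite expmx_truncD// exp_tailE.
rewrite mulmx_suml mxdot_sumr mulr_suml -big_split /=; apply: ler_sum => i _.
rewrite mulmx_suml mxdot_sumr mulr_suml (bigID (fun l : 'I_N => (i + l < N)%N)) /=.
apply: lerD; first by apply: ler_sum => l _; rewrite -scalemxAl mxdotZr.
apply: ler_sum => l _; rewrite -[leRHS]mulrA ler_wpM2l ?mulr_ge0//.
rewrite (le_trans (ler_norm _))// (le_trans (mxdot_norm_le _ _))//.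
rewrite -[X in _ <= _ * X]frobenius_norm_sqr expr2 mulrA mulrC.
rewrite ler_wpM2r ?frobenius_norm_ge0//.
have kil : 0 <= k ^+ i * k ^+ l by rewrite mulr_ge0 ?exprn_ge0.
rewrite -ler_sqr ?nnegrE ?mulr_ge0 ?exprn_ge0 ?frobenius_norm_ge0//.
rewrite exprMn !frobenius_norm_sqr.
exact: (opnorm_leM (opnorm_leX i Ktk) (opnorm_leX l Kk)).
Qed.

End TruncatedExponentialOfNormal.

(** * Complex matrices as real blocks *)

Section ComplexBlocks.
Context {R : realType}.
Local Notation C := R[i].
Local Notation toC := (real_complex R).

(* Complex matrices are represented by real ones of twice the size, so that the
   real estimates on products along the chain apply to them. *)
Definition cblock m n (A : 'M[C]_(m, n)) : 'M[R]_(m + m, n + n) :=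
  block_mx (map_mx (@complex.Re R) A) (- map_mx (@complex.Im R) A)
           (map_mx (@complex.Im R) A) (map_mx (@complex.Re R) A).

Lemma cblockD m n (A B : 'M[C]_(m, n)) : cblock (A + B) = cblock A + cblock B.
Proof.
rewrite /cblock add_block_mx; congr block_mx; apply/matrixP => i j; rewrite !mxE;
  by case: (A i j) => a b; case: (B i j) => a' b' /=; rewrite ?opprD.
Qed.

Lemma cblock0 m n : cblock (0 : 'M[C]_(m, n)) = 0.
Proof.
have := cblockD (0 : 'M[C]_(m, n)) 0; rewrite addr0 => h.
by apply: (addrI (cblock 0)); rewrite addr0 -h.
Qed.

Lemma cblock_sum m n (I : Type) (r : seq I) (F : I -> 'M[C]_(m, n)) :
  cblock (\sum_(i <- r) F i) = \sum_(i <- r) cblock (F i).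
Proof. by apply: big_morph; [exact: cblockD | exact: cblock0]. Qed.

Lemma cblockZ m n (a : R) (A : 'M[C]_(m, n)) : cblock (toC a *: A) = a *: cblock A.
Proof.
rewrite /cblock scale_block_mx; congr block_mx; apply/matrixP => i j; rewrite !mxE;
  case: (A i j) => x y /=; ring.
Qed.

Lemma Re_sum (I : Type) (r : seq I) (F : I -> C) :
  complex.Re (\sum_(i <- r) F i) = \sum_(i <- r) complex.Re (F i).
Proof. by apply: big_morph => // -[a b] [a' b']. Qed.

Let Im_sum (I : Type) (r : seq I) (F : I -> C) :
  complex.Im (\sum_(i <- r) F i) = \sum_(i <- r) complex.Im (F i).
Proof. by apply: big_morph => // -[a b] [a' b']. Qed.
Let ReM (x y : C) :
  complex.Re (x * y) = complex.Re x * complex.Re y - complex.Im x * complex.Im y.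
Proof. by case: x; case: y. Qed.
Let ImM (x y : C) :
  complex.Im (x * y) = complex.Re x * complex.Im y + complex.Im x * complex.Re y.
Proof. by case: x; case: y. Qed.

Lemma cblockM m n p (A : 'M[C]_(m, n)) (B : 'M[C]_(n, p)) :
  cblock (A *m B) = cblock A *m cblock B.
Proof.
have ReAB : map_mx (@complex.Re R) (A *m B) =
    map_mx (@complex.Re R) A *m map_mx (@complex.Re R) B
    - map_mx (@complex.Im R) A *m map_mx (@complex.Im R) B.
  apply/matrixP => i j; rewrite !mxE Re_sum -sumrB; apply: eq_bigr => k _.
  by rewrite ReM !mxE.
have ImAB : map_mx (@complex.Im R) (A *m B) =
    map_mx (@complex.Re R) A *m map_mx (@complex.Im R) B
    + map_mx (@complex.Im R) A *m map_mx (@complex.Re R) B.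
  apply/matrixP => i j; rewrite !mxE Im_sum -big_split; apply: eq_bigr => k _.
  by rewrite ImM !mxE.
rewrite /cblock mulmx_block ReAB ImAB; congr block_mx.
- by rewrite mulNmx.
- by rewrite mulmxN mulNmx opprD.
- by rewrite addrC.
- by rewrite mulmxN addrC.
Qed.

Lemma cblock1 n : cblock (1%:M : 'M[C]_n) = 1%:M.
Proof.
rewrite /cblock scalar_mx_block; congr block_mx; apply/matrixP => i j; rewrite !mxE;
  by case: (i == j); rewrite /= ?oppr0.
Qed.

Lemma cblockX n (A : 'M[C]_n) k : cblock (A ^+ k) = cblock A ^+ k.
Proof.
elim: k => [|k IH]; first by rewrite !expr0 cblock1.
by rewrite !exprS -IH; exact: cblockM.
Qed.

Lemma cblock_prod n (r : nat) (F : 'I_r -> 'M[C]_n) :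
  cblock (\prod_(i < r) F i) = \prod_(i < r) cblock (F i).
Proof. by apply: big_morph; [exact: cblockM | exact: cblock1]. Qed.

Lemma cblock_expmx_trunc n N (A : 'M[C]_n) :
  cblock (expmx_trunc N A) = expmx_trunc N (cblock A).
Proof.
rewrite /expmx_trunc cblock_sum; apply: eq_bigr => k _.
rewrite -cblockX -cblockZ; congr (cblock (_ *: _)).
by rewrite fmorphV rmorph_nat.
Qed.

Lemma mxdot_cblock m n (A : 'M[C]_(m, n)) : mxdot (cblock A) (cblock A) =
  2 * \sum_i \sum_j (complex.Re (A i j) ^+ 2 + complex.Im (A i j) ^+ 2).
Proof.
rewrite /mxdot big_split_ord /=.
have e1 : \sum_(i < m) \sum_(j < n + n)
    cblock A (lshift m i) j * cblock A (lshift m i) j =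
    \sum_i \sum_j (complex.Re (A i j) ^+ 2 + complex.Im (A i j) ^+ 2).
  apply: eq_bigr => i _; rewrite big_split_ord /= -big_split; apply: eq_bigr => j _.
  by rewrite /cblock !block_mxEul !block_mxEur !mxE /=; ring.
have e2 : \sum_(i < m) \sum_(j < n + n)
    cblock A (rshift m i) j * cblock A (rshift m i) j =
    \sum_i \sum_j (complex.Re (A i j) ^+ 2 + complex.Im (A i j) ^+ 2).
  apply: eq_bigr => i _; rewrite big_split_ord /= -big_split; apply: eq_bigr => j _.
  by rewrite /cblock !block_mxEdl !block_mxEdr !mxE /=; ring.
by rewrite e1 e2; ring.
Qed.

End ComplexBlocks.

(** * A half disc inequality *)

Section QuarterCircle.
Context {R : realType}.
Local Notation C := R[i].
Local Notation toC := (real_complex R).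

Lemma pihalf_gt0 : 0 < pi / 2 :> R.
Proof. by rewrite divr_gt0// pi_gt0. Qed.

Definition quarter_angle : probability (measurableTypeR R) R := uniform_prob pihalf_gt0.

Lemma mean_quarter_angle (f F : R -> R) (K : R) :
  (forall x : R, is_derive x 1 F (f x)) -> continuous f -> (forall x, `|f x| <= K) ->
  \int[quarter_angle]_x f x = (2 / pi) * (F (pi / 2) - F 0).
Proof.
move=> dF cf fK.
have bf : bounded_measurable (f : measurableTypeR R -> R).
  by split; [exact: continuous_measurable_fun | exists K].
(* [integral_uniform] takes nonnegative integrands, hence the shift by [K]. *)
have : \int[quarter_angle]_x (f x + K) = (2 / pi) * (F (pi / 2) - F 0) + K.
  have cg : continuous (fun x => f x + K).
    by move=> x; apply: cvgD; [exact: cf | exact: cvg_cst].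
  pose G := F + K *: id.
  have dG (x : R) : is_derive x 1 G (f x + K).
    by rewrite -[K in X in is_derive _ _ _ X]mulr1; apply: is_deriveD.
  rewrite /Rintegral (integral_uniform pihalf_gt0); last 2 first.
  - by apply/measurable_EFinP; exact: continuous_measurable_fun.
  - by move=> x; rewrite lee_fin; have := fK x; rewrite ler_norml => /andP[]; lra.
  rewrite (@continuous_FTC2 _ _ G) ?pihalf_gt0//.
  - have GE x : G x = F x + K * x by [].
    rewrite -EFinB -EFinM /fine !GE mulr0 addr0 subr0.
    move: (F (pi / 2)) (F 0) (@pi_gt0 R) => A B; move: (pi : R) => p p0.
    by field; rewrite gt_eqF.
  - exact: continuous_subspaceT.
  - have cG : continuous G by move=> x; apply/differentiable_continuous/derivable1_diffP.
    split => [x _| |] //; first by apply: cvg_at_right_filter; exact: cG.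
    by apply: cvg_at_left_filter; exact: cG.
  - by move=> x _; rewrite derive1E derive_val.
rewrite meanD// ?mean_cst; last exact: bm_cst.
by move/addIr.
Qed.

Definition sin_primitive (a : nat) (x : R) : R :=
  if a is 0%N then x else a%:R^-1 * sin (a%:R * x).

Lemma is_derive_sin_primitive a (x : R) :
  is_derive x 1 (sin_primitive a) (cos (a%:R * x)).
Proof.
case: a => [|a]; first by rewrite mul0r cos0; exact: is_derive_id.
have -> : sin_primitive a.+1 = a.+1%:R^-1 *: (sin \o (a.+1%:R *: id)) by [].
have d1 : is_derive ((a.+1%:R *: id : R -> R) x) 1 (@sin R) (cos (a.+1%:R * x)).
  exact: is_derive_sin.
have d2 : is_derive x 1 (a.+1%:R *: id : R -> R) (a.+1%:R *: 1) by exact: is_deriveZ.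
have -> : cos (a.+1%:R * x) = a.+1%:R^-1 *: (cos (a.+1%:R * x) * (a.+1%:R *: 1)).
  by rewrite /GRing.scale /= mulr1 mulrCA mulVf ?mulr1// pnatr_eq0.
by apply: is_deriveZ; exact: is_derive1_comp.
Qed.

Lemma sin_natmul_pi m : sin (m%:R * pi : R) = 0.
Proof.
elim: m => [|m IH]; first by rewrite mul0r sin0.
by rewrite -natr1 mulrDl mul1r sinDpi IH oppr0.
Qed.

Lemma sin_odd_pihalf m : sin (m.*2.+1%:R * (pi / 2) : R) = (-1) ^+ m.
Proof.
elim: m => [|m IH]; first by rewrite mul1r sin_pihalf.
have -> : m.+1.*2.+1%:R * (pi / 2) = m.*2.+1%:R * (pi / 2) + pi :> R.
  by rewrite doubleS -(addn2 m.*2.+1) natrD; move: (pi : R) => p; field.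
by rewrite sinDpi IH exprS mulN1r.
Qed.

Lemma sin_primitive_even m : sin_primitive m.+1.*2 (pi / 2) = 0.
Proof.
rewrite /sin_primitive doubleS -doubleS -muln2 natrM.
have -> : m.+1%:R * 2 * (pi / 2) = m.+1%:R * pi :> R.
  by move: (pi : R) => p; field.
by rewrite sin_natmul_pi mulr0.
Qed.

Lemma sin_primitive_odd m :
  sin_primitive m.*2.+1 (pi / 2) = m.*2.+1%:R^-1 * (-1) ^+ m.
Proof. by rewrite /sin_primitive sin_odd_pihalf. Qed.

Lemma sin_primitive0 a : sin_primitive a 0 = 0.
Proof. by case: a => [|a] //=; rewrite mulr0 sin0 mulr0. Qed.

Definition moment (k : nat) : R := \int[quarter_angle]_x (cos (k%:R * x) * cos x).

Lemma momentE k : moment k = pi^-1 *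
  (sin_primitive k.+1 (pi / 2) + sin_primitive (if k is k'.+1 then k' else 1) (pi / 2)).
Proof.
(* b = |k - 1|: the product of cosines involves cos((k - 1) x), and cosine is even. *)
pose b := if k is k'.+1 then k' else 1%N.
have E (x : R) : cos (k%:R * x) * cos x = 2^-1 * (cos (k.+1%:R * x) + cos (b%:R * x)).
  have -> : cos (b%:R * x) = cos (k%:R * x - x).
    rewrite /b; case: (k) => [|k']; first by rewrite mul0r sub0r cosN mul1r.
    by congr cos; rewrite -natr1; ring.
  by rewrite -[k.+1%:R]natr1 mulrDl mul1r cosD cosB; field.
pose F := 2^-1 *: (sin_primitive k.+1 + sin_primitive b).
have dF (x : R) : is_derive x 1 F (cos (k%:R * x) * cos x).
  by rewrite E; apply: is_deriveZ; apply: is_deriveD; exact: is_derive_sin_primitive.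
have cf : continuous (fun x : R => cos (k%:R * x) * cos x).
  move=> x; apply: cvgM; last exact: continuous_cos.
  apply: (@continuous_comp _ _ _ (fun x : R => k%:R * x) cos); last exact: continuous_cos.
  exact: mulrl_continuous.
have f1 (x : R) : `|cos (k%:R * x) * cos x| <= 1 by rewrite normrM mulr_ile1// cos_max.
rewrite /moment (mean_quarter_angle dF cf f1).
have GE x : F x = 2^-1 * (sin_primitive k.+1 x + sin_primitive b x) by [].
rewrite !GE !sin_primitive0 -/b.
move: (sin_primitive _ _) (sin_primitive _ _) (@pi_gt0 R) => u v.
by move: (pi : R) => p p0; field; rewrite gt_eqF.
Qed.

Lemma moment0 : moment 0 = 2 / pi.
Proof.
rewrite momentE (sin_primitive_odd 0) expr0 invr1; move: (@pi_gt0 R).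
by move: (pi : R) => p p0; field; rewrite gt_eqF.
Qed.

Lemma moment1 : moment 1 = 2^-1.
Proof.
rewrite momentE (sin_primitive_even 0) /sin_primitive; move: (@pi_gt0 R).
by move: (pi : R) => p p0; field; rewrite gt_eqF.
Qed.

(** Cosines of distinct odd frequencies are orthogonal on a quarter period. Hence the only odd
    coefficient of a polynomial seen by the mean over the arc is the first. *)
Lemma moment_odd m : moment m.+1.*2.+1 = 0.
Proof. by rewrite momentE -doubleS !sin_primitive_even addr0 mulr0. Qed.

(** The difference of reciprocals is the integral of y^(2m) (1 - y^2) over [0, 1]. In this way the
    even moments on the arc become a weighted integral along the imaginary axis. *)
Lemma moment_even m : moment m.+1.*2 =
  pi^-1 * ((-1) ^+ m * (m.*2.+1%:R^-1 - m.+1.*2.+1%:R^-1)).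
Proof.
rewrite momentE sin_primitive_odd doubleS sin_primitive_odd exprS; ring.
Qed.

Definition cis (x : R) : C := Complex (cos x) (sin x).

Lemma cisX x k : cis x ^+ k = cis (k%:R * x).
Proof.
elim: k => [|k IH]; first by rewrite expr0 mul0r /cis cos0 sin0.
rewrite exprS IH /cis -[k.+1]addn1 natrD mulrDl mul1r addrC cosD sinD.
by congr Complex; ring.
Qed.

Definition poly_at (z : C) (p : {poly R}) : C := (map_poly toC p).[z].

HB.instance Definition _ z := GRing.RMorphism.copy (poly_at z)
  (horner_eval z \o map_poly toC).

Lemma poly_atE N z (p : {poly R}) : (size p <= N)%N ->
  poly_at z p = \sum_(k < N) toC p`_k * z ^+ k.
Proof.
move=> sp; rewrite /poly_at (horner_coef_wide (n := N)).
  by apply: eq_bigr => k _; rewrite coef_map.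
by rewrite size_map_poly.
Qed.

Lemma Re_toCM (a : R) (z : C) : complex.Re (toC a * z) = a * complex.Re z.
Proof. by case: z => x y /=; rewrite mul0r subr0. Qed.

Lemma Re_poly_at_cis N x (p : {poly R}) : (size p <= N)%N ->
  complex.Re (poly_at (cis x) p) = \sum_(k < N) p`_k * cos (k%:R * x).
Proof.
move=> sp; rewrite (poly_atE _ sp) Re_sum; apply: eq_bigr => k _.
by rewrite Re_toCM cisX.
Qed.

Lemma sum_even_odd (V : nmodType) (f : nat -> V) K :
  \sum_(k < K.*2) f k = \sum_(m < K) (f m.*2 + f m.*2.+1).
Proof.
elim: K => [|K IH]; first by rewrite !big_ord0.
by rewrite doubleS !big_ord_recr /= IH addrA.
Qed.

Lemma imag_powers (y : R) m : (Complex 0 y : C) ^+ m.*2 = toC ((-1) ^+ m * y ^+ m.*2) /\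
  (Complex 0 y : C) ^+ m.*2.+1 = Complex 0 ((-1) ^+ m * y ^+ m.*2.+1).
Proof.
have e : (Complex 0 y : C) ^+ 2 = toC (- y ^+ 2).
  by rewrite !expr2 /real_complex_def; simpc.
have h : (Complex 0 y : C) ^+ m.*2 = toC ((-1) ^+ m * y ^+ m.*2).
  rewrite -muln2 mulnC exprM e -rmorphXn; congr (toC _).
  by rewrite exprM -exprMn mulN1r.
split => //; rewrite exprSr h exprSr /real_complex_def; simpc.
by congr Complex; ring.
Qed.

Lemma Re_poly_at_imag K y (p : {poly R}) : (size p <= K.*2)%N ->
  complex.Re (poly_at (Complex 0 y) p) = \sum_(m < K) p`_m.*2 * ((-1) ^+ m * y ^+ m.*2).
Proof.
move=> sp; rewrite (poly_atE _ sp) Re_sum.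
rewrite (sum_even_odd (fun k => complex.Re (toC p`_k * (Complex 0 y : C) ^+ k))).
apply: eq_bigr => m _; have [-> ->] := imag_powers y m.
by rewrite !Re_toCM /= mulr0 addr0.
Qed.

(* Integrating r(y) (1 - y^2) >= 0 over [0, 1], where
   r(y) = delta - (Re p(iy) - p(0)) / y^2. *)
Lemma imag_axis_sum K (p : {poly R}) delta : (size p <= K.+1.*2)%N ->
  (forall y, 0 <= y <= 1 ->
     complex.Re (poly_at (Complex 0 y) p) <= p`_0 + delta * y ^+ 2) ->
  - (2 * delta / 3) <=
  \sum_(m < K) p`_m.+1.*2 * ((-1) ^+ m * (m.*2.+1%:R^-1 - m.+1.*2.+1%:R^-1)).
Proof.
move=> sp hp.
pose a m := p`_m.+1.*2 * (-1) ^+ m.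
pose Q : {poly R} := delta *: ('X - 3^-1 *: 'X^3)
  + \sum_(m < K) a m *: (m.*2.+1%:R^-1 *: 'X^(m.*2.+1) - m.+1.*2.+1%:R^-1 *: 'X^(m.+1.*2.+1)).
have dX n (y : R) : ((n.+1%:R^-1 *: 'X^(n.+1) : {poly R})^`()).[y] = y ^+ n.
  rewrite derivZ derivXn hornerZ hornerMn hornerXn succnK.
  by rewrite -[y ^+ n *+ _]mulr_natl mulrA mulVf ?mul1r// pnatr_eq0.
have dQ y : Q^`().[y] = (1 - y ^+ 2) * (delta + \sum_(m < K) a m * y ^+ m.*2).
  rewrite /Q derivD derivZ derivB derivX derivZ derivXn raddf_sum hornerD hornerZ.
  rewrite hornerD hornerN hornerC hornerZ hornerMn hornerXn horner_sum [RHS]mulrDr.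
  congr (_ + _); first by rewrite /= -[_ *+ 3]mulr_natl; field.
  rewrite mulr_sumr; apply: eq_bigr => m _ /=.
  by rewrite derivZ derivB hornerZ hornerD hornerN !dX doubleS !exprS; ring.
have vX n (y : R) : ((n.+1%:R^-1 *: 'X^(n.+1) : {poly R})).[y] = n.+1%:R^-1 * y ^+ n.+1.
  by rewrite hornerZ hornerXn.
have QE y : Q.[y] = delta * (y - 3^-1 * y ^+ 3) +
    \sum_(m < K) a m * (m.*2.+1%:R^-1 * y ^+ m.*2.+1 - m.+1.*2.+1%:R^-1 * y ^+ m.+1.*2.+1).
  rewrite /Q hornerD hornerZ hornerD hornerX hornerN hornerZ hornerXn horner_sum.
  by congr (_ + _); apply: eq_bigr => m _; rewrite hornerZ hornerD hornerN !vX.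
have Q0 : Q.[0] = 0.
  rewrite QE expr0n mulr0 subr0 mulr0 add0r big1// => m _.
  by rewrite !expr0n !mulr0 subr0 mulr0.
have Q1 : Q.[1] = 2 * delta / 3 + \sum_(m < K) p`_m.+1.*2 *
    ((-1) ^+ m * (m.*2.+1%:R^-1 - m.+1.*2.+1%:R^-1)).
  rewrite QE expr1n; congr (_ + _); first by field.
  by apply: eq_bigr => m _; rewrite !expr1n !mulr1 /a mulrA.
(* [Q] is a primitive of r(y) (1 - y^2); the mean value theorem replaces the integral, as Q(1) =
   Q'(c) for some c in ]0, 1[. *)
have [c] := poly_mvt Q (@ltr01 R); rewrite in_itv /= => /andP[c0 c1].
rewrite Q0 Q1 !subr0 mulr1 dQ => e.
rewrite -subr_ge0 opprK addrC e mulr_ge0//.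
  by rewrite subr_ge0 expr_le1// ltW.
have := hp c; rewrite (ltW c0) (ltW c1) => /(_ isT).
rewrite (Re_poly_at_imag _ sp) big_ord_recl /= expr0 !mulr1 lerD2l.
have -> : \sum_(i < K) p`_(bump 0 i).*2 * ((-1) ^+ (bump 0 i) * c ^+ (bump 0 i).*2) =
    - (c ^+ 2 * \sum_(m < K) a m * c ^+ m.*2).
  rewrite mulr_sumr -sumrN; apply: eq_bigr => m _.
  by rewrite /bump leq0n add1n /a doubleS !exprS; ring.
have c2 : 0 < c ^+ 2 by rewrite exprn_gt0.
by rewrite -subr_ge0 opprK (mulrC delta) -mulrDr pmulr_rge0.
Qed.

(** Termwise, the mean over the arc is (2/pi) p(0) + p'(0)/2 plus 1/pi times the integral over
    [0, 1] of (p(0) - Re p(iy)) (1 - y^2)/y^2. By hypothesis that integral is at least -2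
    delta/3. *)
Lemma carleman_inequality (p : {poly R}) delta :
  (forall y, 0 <= y <= 1 ->
     complex.Re (poly_at (Complex 0 y) p) <= p`_0 + delta * y ^+ 2) ->
  (2 / pi) * (p`_0 + pi / 4 * p`_1 - delta / 3) <=
  \int[quarter_angle]_x (complex.Re (poly_at (cis x) p) * cos x).
Proof.
move=> hp; pose K := size p.
have sp : (size p <= K.+1.*2)%N.
  by rewrite -addnn (leq_trans (leqnSn _))// leq_addr.
have bc k : bounded_measurable
    ((fun x : R => cos (k%:R * x) * cos x) : measurableTypeR R -> R).
  split; last by exists 1 => x; rewrite normrM mulr_ile1// cos_max.
  apply: continuous_measurable_fun => x; apply: cvgM; last exact: continuous_cos.
  apply: (@continuous_comp _ _ _ (fun x : R => k%:R * x) cos); last exact: continuous_cos.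
  exact: mulrl_continuous.
have -> : \int[quarter_angle]_x (complex.Re (poly_at (cis x) p) * cos x) =
    \sum_(k < K.+1.*2) p`_k * moment k.
  transitivity (\int[quarter_angle]_x \sum_(k < K.+1.*2) p`_k * (cos (k%:R * x) * cos x)).
    apply: eq_Rintegral => x _; rewrite (Re_poly_at_cis _ sp) mulr_suml.
    by apply: eq_bigr => k _; rewrite mulrA.
  rewrite mean_sum; last by move=> k; exact: bmZ.
  by apply: eq_bigr => k _; rewrite meanZ.
rewrite (sum_even_odd (fun k => p`_k * moment k)) big_ord_recl /= moment0 moment1.
have -> : \sum_(i < K) (p`_(bump 0 i).*2 * moment (bump 0 i).*2 +
     p`_(bump 0 i).*2.+1 * moment (bump 0 i).*2.+1) =
   pi^-1 * \sum_(m < K) p`_m.+1.*2 *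
     ((-1) ^+ m * (m.*2.+1%:R^-1 - m.+1.*2.+1%:R^-1)).
  rewrite mulr_sumr; apply: eq_bigr => m _.
  by rewrite /bump leq0n add1n moment_odd moment_even; ring.
have ip : 0 <= pi^-1 :> R by rewrite invr_ge0 pi_ge0.
have := ler_wpM2l ip (imag_axis_sum sp hp).
have -> : 2 / pi * (p`_0 + pi / 4 * p`_1 - delta / 3) =
   p`_0 * (2 / pi) + p`_1 / 2 + pi^-1 * - (2 * delta / 3).
  by move: (@pi_gt0 R); move: (pi : R) => q q0; field; rewrite gt_eqF.
by move=> h; rewrite lerD2l.
Qed.

End QuarterCircle.

(** * Construction of the multiplier *)

Section Multiplier.
Context {R : realType}.
Local Notation C := R[i].
Local Notation toC := (real_complex R).
Local Notation RT := (measurableTypeR R).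

(** [mean_le] asks for a comparison everywhere, whereas integrands with a factor cos x are ordered
    only where cos x >= 0, on the support of [quarter_angle]. *)
Lemma mean_quarter_le (f g : RT -> R) : bounded_measurable f -> bounded_measurable g ->
  (forall x, 0 <= x <= pi / 2 -> f x <= g x) ->
  \int[quarter_angle]_x f x <= \int[quarter_angle]_x g x.
Proof.
move=> bf bg fg.
have h0 : (0 <= \int[quarter_angle]_x (g x - f x)).
  have bgf := bmB bg bf; have [mgf [K gfK]] := bgf.
  have bgfK : bounded_measurable (fun x => g x - f x + K).
    by apply: bmD => //; exact: bm_cst.
  rewrite -(lerD2r K) add0r -[X in _ <= _ + X](mean_cst quarter_angle K) -meanD//; last first.
    exact: bm_cst.
  rewrite -lee_fin -mean_EFin// (integral_uniform pihalf_gt0); last 2 first.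
  - by apply/measurable_EFinP; have [] := bgfK.
  - by move=> x; rewrite lee_fin; have := gfK x; rewrite ler_norml => /andP[]; lra.
  have <- : (((pi / 2 - 0)^-1)%R%:E * \int[lebesgue_measure]_(x in `[0%R, (pi / 2)%R]) K%:E = K%:E)%E.
    rewrite integral_cst//= lebesgue_measure_itv/= lte_fin pihalf_gt0 -EFinB -!EFinM.
    move: (@pihalf_gt0 R); move: (pi / 2 : R) => p p0.
    by congr EFin; field; rewrite gt_eqF.
  rewrite lee_wpmul2l//.
    by rewrite lee_fin invr_ge0 subr0 ltW// pihalf_gt0.
  have K0 : 0 <= K by rewrite (le_trans _ (gfK 0)).
  apply: ge0_le_integral => //=.
  - by apply: measurable_funTS; apply/measurable_EFinP; have [] := bgfK.
  - by move=> x; rewrite in_itv /= => /fg; rewrite lee_fin lerDr subr_ge0.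
by rewrite meanB// subr_ge0 in h0.
Qed.

Lemma mean_quarter_cos : \int[quarter_angle]_x cos (x : R) = 2 / pi :> R.
Proof.
rewrite -(moment0 (R := R)) /moment; apply: eq_Rintegral => x _.
by rewrite mul0r cos0 mul1r.
Qed.

Lemma cos_quarter_ge0 (x : R) : 0 <= x <= pi / 2 -> 0 <= cos x.
Proof.
move=> /andP[x0 xp]; apply: cos_ge0_pihalf; rewrite xp andbT (le_trans _ x0)//.
by rewrite oppr_le0 ltW// pihalf_gt0.
Qed.

Lemma bm_continuous (f : R -> R) K : continuous f -> (forall x, `|f x| <= K) ->
  bounded_measurable (f : RT -> R).
Proof.
by move=> cf fK; split; [exact: continuous_measurable_fun | exists K].
Qed.

Lemma bm_cos : bounded_measurable (cos : RT -> R).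
Proof. by apply: (@bm_continuous _ 1); [exact: continuous_cos | exact: cos_max]. Qed.

(* Newton-Schulz iteration for the sign function: odd polynomials increasing to 1
   on ]0, 1]. *)
Fixpoint sgn_iter (k : nat) (x : R) : R :=
  if k is k'.+1 then sgn_iter k' x * (3 - sgn_iter k' x ^+ 2) / 2 else x.

Lemma sgn_iter_range k x : 0 <= x <= 1 -> x <= sgn_iter k x <= 1.
Proof.
move=> /andP[x0 x1]; elim: k => [|k /andP[IH1 IH2]] /=; first by rewrite lexx.
move: (sgn_iter k x) IH1 IH2 => u xu u1.
have u0 : 0 <= u by exact: le_trans xu.
have h1 : 0 <= u * (1 - u ^+ 2).
  by rewrite mulr_ge0// subr_ge0 expr_le1.
have h2 : 0 <= (1 - u) ^+ 2 * (2 + u) by rewrite mulr_ge0 ?sqr_ge0// addr_ge0.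
apply/andP; split; lra.
Qed.

Lemma sgn_iter_norm k x : `|x| <= 1 -> `|sgn_iter k x| <= 1.
Proof.
move=> x1; elim: k => [//|k] /=; move: (sgn_iter k x) => u.
rewrite !ler_norml => /andP[u1 u2].
have h1 : 0 <= (1 - u) ^+ 2 * (2 + u) by rewrite mulr_ge0 ?sqr_ge0//; lra.
have h2 : 0 <= (1 + u) ^+ 2 * (2 - u) by rewrite mulr_ge0 ?sqr_ge0//; lra.
apply/andP; split; lra.
Qed.

Lemma sgn_iter_cvg1 x : 0 < x <= 1 -> sgn_iter k x @[k --> \oo] --> (1 : R).
Proof.
move=> /andP[x0 x1].
have x01 : 0 <= x <= 1 by rewrite ltW.
(* The ratio of successive errors is (1 - u)(2 + u)/2 = 1 - u/2 - u^2/2, at most 1 - x/2 because u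
   >= x. *)
have h k : 1 - sgn_iter k x <= (1 - x / 2) ^+ k.
  elim: k => [|k IH]; first by rewrite expr0 /=; lra.
  have /andP[r1 r2] := sgn_iter_range k x01.
  rewrite exprS /=; move: (sgn_iter k x) r1 r2 IH => u xu u1 IH.
  have u0 : 0 <= u by rewrite (le_trans (ltW x0)).
  have -> : 1 - u * (3 - u ^+ 2) / 2 = ((1 - u) * (2 + u) / 2) * (1 - u) by field.
  apply: ler_pM => //; [|by rewrite subr_ge0|].
    by rewrite divr_ge0// mulr_ge0 ?subr_ge0// addr_ge0.
  have : 0 <= u ^+ 2 by exact: sqr_ge0.
  lra.
have g0 : (1 - x / 2) ^+ k @[k --> \oo] --> (0 : R).
  by apply: cvg_expr; rewrite ger0_norm; lra.
have g1 : 1 - (1 - x / 2) ^+ k @[k --> \oo] --> (1 : R).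
  rewrite -[X in _ --> X]subr0; apply: cvgB => //; exact: cvg_cst.
have g2 : (fun _ : nat => 1 : R) @ \oo --> (1 : R) by exact: cvg_cst.
apply: (squeeze_cvgr _ g1 g2); apply: nearW => k.
by have /andP[_ ->] := sgn_iter_range k x01; rewrite andbT lerBlDl -lerBlDr.
Qed.

Lemma continuous_sgn_iter k : continuous (sgn_iter k).
Proof.
elim: k => [|k IH] x /=; first exact: cvg_id.
apply: cvgM; last exact: cvg_cst.
apply: cvgM; first exact: IH.
apply: cvgB; first exact: cvg_cst.
by apply: cvgM; exact: IH.
Qed.

Lemma continuous_sgn_iter_cos k : continuous (fun x : R => sgn_iter k (cos x)).
Proof.
move=> x; apply: (@continuous_comp _ _ _ cos (sgn_iter k)); first exact: continuous_cos.
exact: continuous_sgn_iter.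
Qed.

Lemma bm_sgn_iter_cos k : bounded_measurable ((fun x => sgn_iter k (cos x)) : RT -> R).
Proof.
apply: (@bm_continuous _ 1); first exact: continuous_sgn_iter_cos.
by move=> x; apply: sgn_iter_norm; exact: cos_max.
Qed.

Lemma bm_expR_sgn_iter k (c : R) :
  bounded_measurable ((fun x => expR (c * sgn_iter k (cos x))) : RT -> R).
Proof.
apply: (@bm_continuous _ (expR `|c|)).
  move=> x; apply: continuous_comp; last exact: continuous_expR.
  by apply: cvgM; [exact: cvg_cst | exact: continuous_sgn_iter_cos].
move=> x; rewrite ger0_norm ?expR_ge0// ler_expR (le_trans (ler_norm _))// normrM.
by rewrite ler_piMr// sgn_iter_norm// cos_max.
Qed.

Lemma sgn_iter_polyE k : exists S : {poly R}, forall x, sgn_iter k x = x * S.[x ^+ 2].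
Proof.
elim: k => [|k [S IH]]; first by exists 1 => x; rewrite hornerC mulr1.
exists (2^-1 *: (S * (3%:P - 'X * S ^+ 2))) => x /=; rewrite IH.
by rewrite hornerZ hornerM hornerD hornerN hornerC hornerM hornerX horner_exp; field.
Qed.

(** Cosine polynomials with odd frequencies. The lift [q] is an odd polynomial, hence imaginary on
    the imaginary axis, whatever its real part on the circle. *)
Definition odd_cosine (g : R -> R) : Prop := exists2 q : {poly R},
  forall m, q`_m.*2 = 0 & forall x, complex.Re (poly_at (cis x) q) = g x.

(** cos^2 x cos kx combines cos kx, cos (k+2)x and cos (k-2)x with weights 1/2, 1/4, 1/4. For k = 1
    the last frequency is -1 and folds back to 1, hence the separate multiple of ['X]. *)
Lemma odd_cosine_cos2 g : odd_cosine g -> odd_cosine (fun x => cos x ^+ 2 * g x).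
Proof.
move=> [q q0 qg]; pose D := drop_poly 2 q.
have qE : q = q`_1 *: 'X + D * 'X^2.
  rewrite -[LHS](poly_take_drop 2); congr (_ + _).
  apply/polyP => -[|[|i]]; rewrite coef_take_poly coefZ coefX /= ?mulr0 ?mulr1//.
  exact: (q0 0%N).
exists (2^-1 *: q + 4^-1 *: ('X^2 * q) + 4^-1 *: D + (4^-1 * q`_1) *: 'X).
  move=> m; rewrite !coefD !coefZ coefX coefXnM coef_drop_poly q0 mulr0 add0r.
  have -> : (m.*2 + 2)%N = m.+1.*2 by rewrite addn2 doubleS.
  rewrite q0 mulr0 addr0.
  have -> : (m.*2 == 1)%N = false by case: m.
  rewrite mulr0 addr0; case: m => [|m]; first by rewrite /= mulr0.
  by rewrite doubleS /= subn2 /= q0 mulr0.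
move=> x; rewrite -qg.
have ZE (a : R) (p : {poly R}) : poly_at (cis x) (a *: p) = toC a * poly_at (cis x) p.
  by rewrite -mul_polyC rmorphM /= /poly_at map_polyC hornerC.
have XE : poly_at (cis x) 'X = cis x by rewrite /poly_at map_polyX hornerX.
rewrite !rmorphD /= !ZE rmorphM rmorphXn /= XE.
have := congr1 (poly_at (cis x)) qE.
rewrite rmorphD rmorphM rmorphXn /= ZE XE /cis.
case: (poly_at _ q) => A B; case: (poly_at _ D) => E G.
have u1 := cos2Dsin2 x.
move: (cos x) (sin x) u1 => c s u1; rewrite expr2; simpc => -[-> ->].
set q1 := q`_1.
transitivity (2^-1 * (q1 * c + (E * (c * c - s * s) - G * (c * s + s * c))) * (c ^+ 2 + s ^+ 2)
  + 4^-1 * ((c * c - s * s) * (q1 * c + (E * (c * c - s * s) - G * (c * s + s * c)))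
     - (c * s + s * c) * (q1 * s + (E * (c * s + s * c) + G * (c * c - s * s))))
  + 4^-1 * E * (c ^+ 2 + s ^+ 2) ^+ 2 + 4^-1 * q1 * c * (c ^+ 2 + s ^+ 2)).
  by rewrite u1 expr1n /=; ring.
by rewrite /=; field.
Qed.

Lemma odd_cosine_poly (S : {poly R}) : odd_cosine (fun x => cos x * S.[cos x ^+ 2]).
Proof.
elim/poly_ind: S => [|S c IH].
  exists 0 => [m|x]; first by rewrite coef0.
  by rewrite rmorph0 horner0 mulr0.
have [q q0 qg] := odd_cosine_cos2 IH.
exists (q + c *: 'X).
  by move=> m; rewrite coefD q0 coefZ coefX add0r; case: m => [|m]; rewrite mulr0.
move=> x; rewrite rmorphD -mul_polyC rmorphM /=.
rewrite [poly_at _ c%:P]/poly_at map_polyC hornerC.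
rewrite [poly_at _ 'X]/poly_at map_polyX hornerX !hornerE.
have := qg x; case: (poly_at _ q) => a b /= ->; simpc => /=; ring.
Qed.

Lemma odd_cosine_mean (q : {poly R}) : (forall m, q`_m.*2 = 0) ->
  \int[quarter_angle]_x (complex.Re (poly_at (cis x) q) * cos x) = q`_1 / 2.
Proof.
move=> q0; pose K := size q.
have sq : (size q <= K.+1.*2)%N.
  by rewrite -addnn (leq_trans (leqnSn _))// leq_addr.
have bc k : bounded_measurable
    ((fun x : R => cos (k%:R * x) * cos x) : RT -> R).
  apply: (@bm_continuous _ 1); last by move=> x; rewrite normrM mulr_ile1// cos_max.
  move=> x; apply: cvgM; last exact: continuous_cos.
  apply: (@continuous_comp _ _ _ (fun x : R => k%:R * x) cos); last exact: continuous_cos.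
  exact: mulrl_continuous.
transitivity (\int[quarter_angle]_x \sum_(k < K.+1.*2) q`_k * (cos (k%:R * x) * cos x)).
  apply: eq_Rintegral => x _; rewrite (Re_poly_at_cis _ sq) mulr_suml.
  by apply: eq_bigr => k _; rewrite mulrA.
rewrite mean_sum; last by move=> k; exact: bmZ.
transitivity (\sum_(k < K.+1.*2) q`_k * moment k).
  by apply: eq_bigr => k _; rewrite meanZ.
rewrite (sum_even_odd (fun k => q`_k * moment k)) big_ord_recl /= moment1.
rewrite big1 => [|m _]; last by rewrite /bump leq0n add1n moment_odd q0 mul0r mulr0 addr0.
by rewrite (q0 0%N) mul0r add0r addr0.
Qed.

(* exp(-(s/2) q) is the multiplier: q is imaginary on the imaginary axis, and
   Re q is close to 1 on the arc. *)
Lemma multiplier_exists k : exists q : {poly R},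
  [/\ forall m, q`_m.*2 = 0,
      forall x, complex.Re (poly_at (cis x) q) = sgn_iter k (cos x) & q`_1 <= 4 / pi].
Proof.
have [S SE] := sgn_iter_polyE k; have [q q0 qg] := odd_cosine_poly S.
have qk x : complex.Re (poly_at (cis x) q) = sgn_iter k (cos x) by rewrite qg SE.
exists q; split => //.
(* By [odd_cosine_mean] the first coefficient is twice the mean of Re q cos x, so at most 2 (2/pi)
   because the sign iterates stay below 1. *)
have -> : q`_1 = 2 * (q`_1 / 2) by field.
rewrite -odd_cosine_mean// (@eq_Rintegral _ RT R quarter_angle setT
  (fun x => sgn_iter k (cos x) * cos x));
  last by move=> x _; rewrite qk.
have -> : 4 / pi = 2 * (2 / pi) :> R by rewrite mulrA -natrM.
rewrite ler_pM2l// -mean_quarter_cos; apply: mean_quarter_le.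
- by apply: bmM; [exact: bm_sgn_iter_cos | exact: bm_cos].
- exact: bm_cos.
- move=> x /cos_quarter_ge0 cx; rewrite ler_piMl//.
  by have /andP[] := @sgn_iter_range k (cos x) (introT andP (conj cx (cos_le1 x))).
Qed.

(** Inside the quarter circle the iterates tend to 1, and dominated convergence applies. *)
Lemma mean_expR_sgn_iter (c e : R) : 0 < e -> exists k,
  \int[quarter_angle]_x (expR (c * sgn_iter k (cos x)) * cos x) <= (2 / pi) * (expR c) + e.
Proof.
move=> e0.
pose f (k : nat) (x : RT) : \bar R := (expR (c * sgn_iter k (cos x)) * cos x)%:E.
(* [quarter_angle] is a measure on the whole line, so the pointwise limit is described for every
   sign of cos x. *)
pose g (x : RT) : R := if 0 < cos x then expR c * cos x else
  if cos x == 0 then 0 else expR (- c) * cos x.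
have sgnN k y : sgn_iter k (- y) = - sgn_iter k y.
  by elim: k => [//|k IH] /=; rewrite IH sqrrN !mulNr.
have fg x : f k x @[k --> \oo] --> (g x)%:E.
  apply: cvg_EFin; first exact: nearW.
  rewrite /g; case: ltgtP => cx.
  - apply: cvgM; last exact: cvg_cst.
    apply: continuous_cvg; first exact: continuous_expR.
    rewrite -[X in _ --> X]mulr1; apply: cvgM; first exact: cvg_cst.
    by apply: sgn_iter_cvg1; rewrite cx cos_le1.
  - apply: cvgM; last exact: cvg_cst.
    apply: continuous_cvg; first exact: continuous_expR.
    rewrite -mulrN1; apply: cvgM; first exact: cvg_cst.
    have -> : (fun k => sgn_iter k (cos x)) = fun k => - sgn_iter k (- cos x).
      by apply/funext => k; rewrite sgnN opprK.
    apply: cvgN; apply: sgn_iter_cvg1.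
    by rewrite oppr_gt0 cx lerNl cos_geN1.
  - rewrite ?eqxx.
    apply: (@cvg_trans _ ((fun _ : nat => 0 : R) @ \oo)); last exact: cvg_cst.
    by apply: near_eq_cvg; apply: nearW => k; rewrite /= -cx mulr0.
have bfk k : bounded_measurable ((fun x => expR (c * sgn_iter k (cos x)) * cos x) : RT -> R).
  by apply: bmM; [exact: bm_expR_sgn_iter | exact: bm_cos].
have mf k : measurable_fun setT (f k).
  by apply/measurable_EFinP; have [] := bfk k.
have mgE : measurable_fun setT (EFin \o g).
  apply: (emeasurable_fun_cvg f (EFin \o g)) => // x _; exact: fg.
have fb k x : (`|f k x| <= (expR `|c|)%:E)%E.
  rewrite /f abse_EFin lee_fin normrM -[leRHS]mulr1 ler_pM//; last exact: cos_max.
  rewrite ger0_norm ?expR_ge0// ler_expR (le_trans (ler_norm _))// normrM.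
  by rewrite ler_piMr// sgn_iter_norm// cos_max.
have icst : quarter_angle.-integrable setT (EFin \o (fun=> expR `|c|) : RT -> \bar R).
  by apply: bm_integrable; exact: bm_cst.
have [_ _ dct] := dominated_convergence measurableT mf mgE
  (aeW _ (fun x _ => fg x)) icst (aeW _ (fun x k _ => fb k x)).
have bg : bounded_measurable g.
  split; first by apply/measurable_EFinP.
  exists (expR `|c|) => x; rewrite /g; case: ifP => _.
    rewrite normrM -[leRHS]mulr1 ler_pM//; last exact: cos_max.
    by rewrite ger0_norm ?expR_ge0// ler_expR ler_norm.
  case: ifP => _; first by rewrite normr0 expR_ge0.
  rewrite normrM -[leRHS]mulr1 ler_pM//; last exact: cos_max.
  by rewrite ger0_norm ?expR_ge0// ler_expR -normrN ler_norm.
have gle : \int[quarter_angle]_x g x <= 2 / pi * expR c.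
  rewrite mulrC -mean_quarter_cos -meanZ; last exact: bm_cos.
  apply: mean_quarter_le => //; first by apply: bmZ; exact: bm_cos.
  move=> x /cos_quarter_ge0 cx; rewrite /g.
  by case: ltgtP cx => // cx _; rewrite -cx mulr0.
have rc : (fun k => \int[quarter_angle]_x (expR (c * sgn_iter k (cos x)) * cos x))
    @ \oo --> \int[quarter_angle]_x g x.
  by move: dct; rewrite mean_EFin// => /fine_cvgP[_].
move/cvgrPdist_le : rc => /(_ e e0) [k _ /(_ k (leqnn k))] /= hk; exists k.
move: hk; rewrite ler_norml => /andP[h1 _].
rewrite (le_trans _ (lerD gle (lexx e)))//; lra.
Qed.

End Multiplier.

(** * Truncated exponentials of complex numbers *)

Lemma scalar_mxX (K : comNzRingType) n (a : K) k : (a%:M : 'M[K]_n) ^+ k = (a ^+ k)%:M.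
Proof.
elim: k => [|k IH]; first by rewrite !expr0.
by rewrite !exprS IH scalar_mxM.
Qed.

Lemma expmx_trunc_scalar (K : comUnitRingType) n N (a : K) :
  expmx_trunc N (a%:M : 'M[K]_n) = (exp_trunc N a)%:M.
Proof.
rewrite /expmx_trunc /exp_trunc raddf_sum; apply: eq_bigr => i _ /=.
by rewrite scalar_mxX scale_scalar_mx.
Qed.

Section ComplexModulus.
Context {R : realType}.
Local Notation C := R[i].
Local Notation toC := (real_complex R).

Definition sqmod (z : C) : R := complex.Re z ^+ 2 + complex.Im z ^+ 2.

Lemma sqmod_ge0 z : 0 <= sqmod z.
Proof. by rewrite addr_ge0// sqr_ge0. Qed.

Lemma sqmodM z w : sqmod (z * w) = sqmod z * sqmod w.
Proof. by case: z => a b; case: w => c d; rewrite /sqmod /=; ring. Qed.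

Lemma Re_sqr_le z : complex.Re (z ^+ 2) <= sqmod z.
Proof.
case: z => a b; rewrite expr2 /sqmod /= -!expr2.
by rewrite lerD2l (le_trans _ (sqr_ge0 b))// oppr_le0 sqr_ge0.
Qed.

Lemma sqmod_cis x : sqmod (cis x) = 1.
Proof. exact: cos2Dsin2. Qed.

Lemma cblock_scalarZ n (z : C) (A : 'M[C]_n) : cblock (z *: A) = cblock (z%:M) *m cblock A.
Proof. by rewrite -mul_scalar_mx cblockM. Qed.

Lemma cblock_scalar_gram n (z : C) : (cblock (z%:M : 'M[C]_n))^T *m cblock (z%:M) = (sqmod z)%:M.
Proof.
rewrite /cblock tr_block_mx mulmx_block scalar_mx_block.
have mapM (f : C -> R) (f0 : f 0 = 0) : map_mx f (z%:M : 'M[C]_n) = (f z)%:M.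
  by apply/matrixP => i j; rewrite !mxE; case: (i == j); rewrite ?mulr1n ?mulr0n.
have nE : - ((complex.Im z)%:M : 'M[R]_n) = (- complex.Im z)%:M by rewrite raddfN.
rewrite !mapM// nE !tr_scalar_mx -!scalar_mxM -!raddfD /=.
rewrite /sqmod; congr block_mx.
- by rewrite -[RHS](raddf0 (@scalar_mx _ n)); congr scalar_mx; ring.
- by rewrite -[RHS](raddf0 (@scalar_mx _ n)); congr scalar_mx; ring.
- by congr scalar_mx; ring.
Qed.

Lemma mxdot_cblock_scalar n p (z : C) (X : 'M[R]_(n + n, p)) :
  mxdot (cblock (z%:M : 'M[C]_n) *m X) (cblock (z%:M) *m X) = sqmod z * mxdot X X.
Proof.
by rewrite mxdot_mull mulmxA cblock_scalar_gram mul_scalar_mx mxdotZr.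
Qed.

Lemma cblock_conj n (A : 'M[C]_n) : A^T = A ->
  (cblock A)^T = cblock (map_mx (@conjc R) A).
Proof.
move=> At; have Aij i j : A i j = A j i by rewrite -[in RHS]At mxE.
rewrite /cblock tr_block_mx; congr block_mx; apply/matrixP => i j; rewrite !mxE Aij;
  by case: (A _ _) => x y /=; rewrite ?opprK.
Qed.

(** In real form a complex number is a normal 2 x 2 matrix [K] with K^T + K = 2 Re w; this is
    [expmx_trunc_normal] for it. *)
Lemma sqmod_exp_trunc N (w : C) k : 0 <= k -> sqmod w <= k ^+ 2 ->
  sqmod (exp_trunc N w) <= exp_trunc N (2 * complex.Re w) + exp_tail N k.
Proof.
move=> k0 wk; pose K := cblock (w%:M : 'M[C]_1).
have Kk : opnorm_le K k.
  by move=> v; rewrite mxdot_cblock_scalar ler_wpM2r// mxdot_ge0.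
have KtE : K^T = cblock ((conjc w)%:M).
  rewrite /K cblock_conj ?tr_scalar_mx//; congr cblock.
  by apply/matrixP => i j; rewrite !mxE; case: (i == j); rewrite ?mulr1n ?mulr0n ?conjc0.
have KK : GRing.comm K^T K.
  by rewrite /GRing.comm KtE /K -[LHS]cblockM -[RHS]cblockM -!scalar_mxM mulrC.
have KD : K^T + K = (2 * complex.Re w)%:M.
  rewrite KtE /K -cblockD -raddfD /=.
  have -> : (conjc w + w)%:M = toC (2 * complex.Re w) *: (1%:M : 'M[C]_1).
    rewrite scalemx1; congr scalar_mx; case: (w) => a b.
    by apply/eqP; rewrite eq_complex /=; apply/andP; split; apply/eqP; ring.
  by rewrite cblockZ cblock1 scalemx1.
pose v : 'cV[R]_(1 + 1) := delta_mx 0 0.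
have v1 : mxdot v v = 1.
  by rewrite /mxdot !big_ord_recl !big_ord0 /v !mxE /=; ring.
have := expmx_trunc_normal N v k0 KK Kk.
rewrite -[expmx_trunc N K]cblock_expmx_trunc expmx_trunc_scalar mxdot_cblock_scalar v1 !mulr1 KD.
by rewrite expmx_trunc_scalar mul_scalar_mx mxdotZr v1 mulr1.
Qed.

(** The remainder of the series at x is dominated, term by term, by the one at s. *)
Lemma exp_trunc_le_expR_tail N (x s : R) : `|x| <= s ->
  exp_trunc N x <= expR x + (expR s - exp_trunc N s).
Proof.
move=> xs.
have hl : exp_trunc M x - exp_trunc N x + (exp_trunc M s - exp_trunc N s) @[M --> \oo] -->
    expR x - exp_trunc N x + (expR s - exp_trunc N s).
  apply: cvgD; first by apply: cvgB; [exact: exp_trunc_cvg | exact: cvg_cst].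
  by apply: cvgB; [exact: exp_trunc_cvg | exact: cvg_cst].
have : 0 <= expR x - exp_trunc N x + (expR s - exp_trunc N s).
  rewrite -(cvg_lim _ hl)//; apply: limr_ge; first by apply/cvg_ex; eexists; exact: hl.
  exists N => // M /= NM.
  have e (y : R) : exp_trunc M y - exp_trunc N y =
      \sum_(i < M - N) ((N + i)`!%:R)^-1 * y ^+ (N + i).
    by rewrite -{1}(subnKC NM) /exp_trunc big_split_ord /= addrAC subrr add0r.
  rewrite !e -big_split /=; apply: sumr_ge0 => i _; rewrite -mulrDr mulr_ge0 ?invr_ge0//.
  set k := (N + i)%N.
  have h : `|x ^+ k| <= s ^+ k by rewrite normrX; apply: lerXn2r => //;
    rewrite nnegrE ?normr_ge0// (le_trans _ xs).
  by move: h; rewrite ler_norml => /andP[]; lra.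
lra.
Qed.

End ComplexModulus.

(** * The product along the chain as a polynomial in z *)

Section PolynomialProduct.
Context {R : realType}.
Local Notation C := R[i].
Local Notation toC := (real_complex R).
Local Notation RT := (measurableTypeR R).

Lemma polyCVnat k : (k`!%:R : {poly R})^-1 = ((k`!%:R)^-1)%:P.
Proof.
have -> : (k`!%:R : {poly R}) = (k`!%:R)%:P by rewrite polyCMn.
by rewrite polyCV.
Qed.

Lemma poly_atC z (a : R) : poly_at z a%:P = toC a.
Proof. by rewrite /poly_at map_polyC hornerC. Qed.

Lemma poly_atX z : poly_at z ('X : {poly R}) = z.
Proof. by rewrite /poly_at map_polyX hornerX. Qed.

Lemma toC_Vnat k : toC (k`!%:R)^-1 = (k`!%:R)^-1.
Proof. by rewrite fmorphV rmorph_nat. Qed.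

Lemma poly_at_exp_trunc z N (p : {poly R}) :
  poly_at z (exp_trunc N p) = exp_trunc N (poly_at z p).
Proof.
rewrite /exp_trunc rmorph_sum; apply: eq_bigr => k _.
by rewrite rmorphM rmorphXn /= polyCVnat poly_atC toC_Vnat.
Qed.

Lemma map_poly_at_expmx_trunc z n N (A : 'M[{poly R}]_n) :
  map_mx (poly_at z) (expmx_trunc N A) = expmx_trunc N (map_mx (poly_at z) A).
Proof.
rewrite /expmx_trunc raddf_sum; apply: eq_bigr => k _.
rewrite /= map_mxZ; congr (_ *: _).
  by rewrite -toC_Vnat -(poly_atC z) -polyCVnat.
elim: (nat_of_ord k) => [|j IH]; first by rewrite !expr0 map_mx1.
by rewrite !exprS -IH; exact: map_mxM.
Qed.

Variables (d p : nat) (K : 'I_p -> 'M[R]_d) (N : nat).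
Hypothesis N2 : (1 < N)%N.

Definition poly_factor (A : 'M[R]_d) : 'M[{poly R}]_d :=
  expmx_trunc N ('X *: map_mx polyC A).

Definition poly_product : 'M[{poly R}]_d := \prod_(j < p) poly_factor (K j).

Lemma map_poly_at_product z : map_mx (poly_at z) poly_product =
  \prod_(j < p) expmx_trunc N (z *: map_mx toC (K j)).
Proof.
rewrite /poly_product (big_morph (map_mx (poly_at z)) (id1 := 1%:M) (op1 := *%R)).
- apply: eq_bigr => j _; rewrite map_poly_at_expmx_trunc map_mxZ.
  congr (expmx_trunc _ (_ *: _)); first exact: poly_atX.
  by apply/matrixP => a b; rewrite !mxE; exact: poly_atC.
- by move=> A B; exact: map_mxM.
- exact: map_mx1.
Qed.

Lemma poly_factorE A i j :
  poly_factor A i j = \poly_(k < N) ((k`!%:R)^-1 * (A ^+ k) i j).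
Proof.
rewrite /poly_factor /expmx_trunc summxE poly_def; apply: eq_bigr => k _.
have -> : ('X *: map_mx polyC A : 'M[{poly R}]_d) ^+ k = 'X^k *: map_mx polyC (A ^+ k).
  elim: (nat_of_ord k) => [|l IH]; first by rewrite !expr0 scale1r map_mx1.
  rewrite !exprS IH -[LHS]/(_ *m _) -scalemxAl -scalemxAr scalerA; congr (_ *: _).
  exact/esym/map_mxM.
rewrite !mxE polyCVnat mulrCA -polyCM mulrC mul_polyC; congr (_ *: _).
Qed.

Definition coef_mx (k m n : nat) (A : 'M[{poly R}]_(m, n)) : 'M[R]_(m, n) :=
  map_mx (coefp k) A.

Lemma coef_mx0M m n l (A : 'M[{poly R}]_(m, n)) (B : 'M[{poly R}]_(n, l)) :
  coef_mx 0 (A *m B) = coef_mx 0 A *m coef_mx 0 B.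
Proof.
apply/matrixP => i j; rewrite !mxE /= coef_sum; apply: eq_bigr => k _.
by rewrite !mxE /= coefM big_ord1.
Qed.

Lemma coef_mx1M m n l (A : 'M[{poly R}]_(m, n)) (B : 'M[{poly R}]_(n, l)) :
  coef_mx 1 (A *m B) = coef_mx 1 A *m coef_mx 0 B + coef_mx 0 A *m coef_mx 1 B.
Proof.
apply/matrixP => i j; rewrite !mxE /= coef_sum -big_split; apply: eq_bigr => k _ /=.
by rewrite !mxE /= coefM big_ord_recl big_ord1 /= addrC.
Qed.

Lemma coef_mx0_factor A : coef_mx 0 (poly_factor A) = 1%:M.
Proof.
apply/matrixP => i j; rewrite !mxE /= poly_factorE coef_poly (ltnW N2).
by rewrite expr0 fact0 invr1 mul1r mxE.
Qed.

Lemma coef_mx1_factor A : coef_mx 1 (poly_factor A) = A.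
Proof.
apply/matrixP => i j; rewrite !mxE /= poly_factorE coef_poly N2.
by rewrite expr1 invr1 mul1r.
Qed.

Lemma coef_mx_product (r : seq 'I_p) :
  coef_mx 0 (\prod_(j <- r) poly_factor (K j)) = 1%:M /\
  coef_mx 1 (\prod_(j <- r) poly_factor (K j)) = \sum_(j <- r) K j.
Proof.
elim: r => [|j r [IH0 IH1]].
  rewrite !big_nil; split; apply/matrixP => a b; rewrite !mxE /=.
    by rewrite coefMn coef1; case: (a == b).
  by rewrite coefMn coef1 mul0rn.
rewrite !big_cons; split.
  by rewrite [LHS]coef_mx0M IH0 coef_mx0_factor mulmx1.
by rewrite [LHS]coef_mx1M IH0 IH1 coef_mx0_factor coef_mx1_factor mulmx1 mul1mx.
Qed.

Variable v : 'rV[R]_d.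
Hypothesis v1 : mxdot v v = 1.

(** The function f(z) of the tail argument, with K_j = theta F_j/2. *)
Definition quad_poly : {poly R} :=
  (map_mx polyC v *m poly_product *m (map_mx polyC v)^T) 0 0.

Let vvT : (v *m v^T) 0 0 = 1.
Proof.
rewrite mxE -v1 /mxdot big_ord1; apply: eq_bigr => k _; by rewrite mxE.
Qed.

Let coef_mx_v : coef_mx 0 (map_mx polyC v) = v /\ coef_mx 1 (map_mx polyC v) = 0.
Proof.
by split; apply/matrixP => i j; rewrite !mxE /= coefC.
Qed.

Let coef_mx_vT : coef_mx 0 (map_mx polyC v)^T = v^T /\ coef_mx 1 (map_mx polyC v)^T = 0.
Proof.
by split; apply/matrixP => i j; rewrite !mxE /= coefC.
Qed.

Lemma quad_poly_coef0 : quad_poly`_0 = 1.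
Proof.
have -> : quad_poly`_0 = coef_mx 0 (map_mx polyC v *m poly_product *m (map_mx polyC v)^T) 0 0.
  by rewrite [RHS]mxE.
have [h0 _] := coef_mx_product (index_enum 'I_p).
by rewrite !coef_mx0M h0 coef_mx_v.1 coef_mx_vT.1 mulmx1 vvT.
Qed.

Lemma quad_poly_coef1 a : v *m (\sum_j K j) = a *: v -> quad_poly`_1 = a.
Proof.
move=> va.
have -> : quad_poly`_1 = coef_mx 1 (map_mx polyC v *m poly_product *m (map_mx polyC v)^T) 0 0.
  by rewrite [RHS]mxE.
have [h0 h1] := coef_mx_product (index_enum 'I_p).
rewrite !coef_mx1M !coef_mx0M h0 h1 coef_mx_v.1 coef_mx_v.2 coef_mx_vT.1 coef_mx_vT.2.
by rewrite mul0mx add0r mulmx0 addr0 va -scalemxAl mxE vvT mulr1.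
Qed.

Definition block_product (z : C) : 'M[R]_(d + d) :=
  \prod_(j < p) expmx_trunc N (cblock (z *: map_mx toC (K j))).

Lemma cblock_product z : cblock (map_mx (poly_at z) poly_product) = block_product z.
Proof.
rewrite map_poly_at_product cblock_prod; apply: eq_bigr => j _.
by rewrite cblock_expmx_trunc.
Qed.

(** The row [v] in real form: two orthonormal rows. So [W] is a contraction, and |W^T|_F^2 = 2
    cancels the doubling of [mxdot_cblock]. *)
Let W : 'M[R]_(1 + 1, d + d) := cblock (map_mx toC v).

Let WT : W^T = cblock (map_mx toC v)^T.
Proof.
rewrite /W /cblock tr_block_mx; congr block_mx; apply/matrixP => i j; rewrite !mxE /= ?oppr0//.
Qed.

Let WWT : W *m W^T = 1%:M.
Proof.
rewrite WT -cblockM map_trmx -map_mxM.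
have -> : v *m v^T = 1%:M.
  by apply/matrixP => i j; rewrite (ord1 i) (ord1 j) vvT mxE.
by rewrite map_mx1 cblock1.
Qed.

Let W1 : opnorm_le W 1.
Proof.
have WT1 : opnorm_le W^T 1.
  by move=> x; rewrite mxdot_mull trmxK mulmxA WWT mul1mx expr1n mul1r.
by rewrite -(trmxK W); exact: opnorm_le_tr.
Qed.

Let quad_poly_block z :
  2 * sqmod (poly_at z quad_poly) = mxdot (W *m block_product z *m W^T) (W *m block_product z *m W^T).
Proof.
rewrite -cblock_product WT -!cblockM mxdot_cblock !big_ord1 /sqmod.
have -> : poly_at z quad_poly =
   (map_mx toC v *m map_mx (poly_at z) poly_product *m (map_mx toC v)^T) 0 0.
  have vz : map_mx toC v = map_mx (poly_at z) (map_mx polyC v).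
    by apply/matrixP => i j; rewrite !mxE; exact/esym/poly_atC.
  by rewrite vz map_trmx -!map_mxM [RHS]mxE.
by [].
Qed.

Lemma quad_poly_le_frobenius z :
  sqmod (poly_at z quad_poly) <= mxdot (block_product z) (block_product z) / 2.
Proof.
rewrite ler_pdivlMr// mulrC quad_poly_block.
rewrite (le_trans (opnorm_le_mulr _ W1))// expr1n mul1r.
by rewrite (le_trans (opnorm_le_mull _ W1))// expr1n mul1r.
Qed.

Lemma quad_poly_le_opnorm z k : opnorm_le (block_product z) k ->
  sqmod (poly_at z quad_poly) <= k ^+ 2.
Proof.
move=> Gk; rewrite -(ler_pM2l (@ltr0n R 2)) quad_poly_block -mulmxA.
rewrite (le_trans (opnorm_le_mull _ W1))// expr1n mul1r.
rewrite (le_trans (opnorm_le_mull _ Gk))// mulrC ler_wpM2r ?sqr_ge0//.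
have -> : mxdot W^T W^T = mxdot (1%:M : 'M[R]_(1 + 1)) 1%:M.
  by rewrite -[X in mxdot X _](mulmx1 W^T) mxdot_mull trmxK WWT.
by rewrite mxdot1.
Qed.

Variables (kap : R).
Hypotheses (kap0 : 0 <= kap) (Ksym : forall j, (K j)^T = K j)
  (Kkap : forall j, opnorm_le (K j) kap).

Lemma mxdot_col_mx m1 m2 n (A A' : 'M[R]_(m1, n)) (B B' : 'M[R]_(m2, n)) :
  mxdot (col_mx A B) (col_mx A' B') = mxdot A A' + mxdot B B'.
Proof.
rewrite /mxdot big_split_ord; congr (_ + _); apply: eq_bigr => i _;
  apply: eq_bigr => j _; by rewrite ?col_mxEu ?col_mxEd.
Qed.

Lemma cblock_realE n (A : 'M[R]_n) : cblock (map_mx toC A) = block_mx A 0 0 A.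
Proof.
by rewrite /cblock; congr block_mx; apply/matrixP => i j; rewrite !mxE /= ?oppr0.
Qed.

Lemma opnorm_le_diag_block n (A : 'M[R]_n) k : opnorm_le A k ->
  opnorm_le (cblock (map_mx toC A)) k.
Proof.
move=> Ak x; rewrite cblock_realE -(vsubmxK x) mul_block_col !mul0mx addr0 add0r.
by rewrite !mxdot_col_mx mulrDr; apply: lerD; exact: Ak.
Qed.

Lemma opnorm_le_cblockZ n (A : 'M[R]_n) (z : C) k l : 0 <= k -> opnorm_le A k ->
  sqmod z <= l ^+ 2 -> opnorm_le (cblock (z *: map_mx toC A)) (l * k).
Proof.
move=> k0 Ak zl x; rewrite cblock_scalarZ -mulmxA mxdot_cblock_scalar.
rewrite exprMn -mulrA ler_pM ?sqmod_ge0 ?mxdot_ge0//.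
exact: opnorm_le_diag_block.
Qed.

(** In real form iy K_j is antisymmetric, so B^T + B = 0 and [expmx_trunc_normal] leaves 1 plus the
    tail, where [exp_tail_scale] extracts y^2. *)
Lemma opnorm_le_imag_product (y : R) : 0 <= y <= 1 ->
  opnorm_le (block_product (Complex 0 y)) (Num.sqrt (1 + y ^+ 2 * exp_tail N kap) ^+ p).
Proof.
move=> /andP[y0 y1].
have t0 : 0 <= 1 + y ^+ 2 * exp_tail N kap.
  by rewrite addr_ge0// mulr_ge0 ?sqr_ge0// exp_tail_ge0.
have fac j : opnorm_le (expmx_trunc N (cblock (Complex 0 y *: map_mx toC (K j))))
    (Num.sqrt (1 + y ^+ 2 * exp_tail N kap)).
  set B := cblock _.
  have By : opnorm_le B (y * kap).
    apply: opnorm_le_cblockZ => //.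
    by rewrite /sqmod /= expr0n add0r.
  have BT : B^T = - B.
    rewrite /B cblock_conj.
      have -> : map_mx (@conjc R) (Complex 0 y *: map_mx toC (K j)) =
          toC (-1) *: (Complex 0 y *: map_mx toC (K j)).
        by apply/matrixP => a b; rewrite !mxE /real_complex_def; simpc.
      by rewrite cblockZ scaleN1r.
    by apply/matrixP => a b; rewrite !mxE -[in LHS]Ksym mxE.
  have yk0 : 0 <= y * kap by rewrite mulr_ge0.
  have BB : GRing.comm B^T B by rewrite /GRing.comm BT mulNr mulrN.
  move=> x; have := expmx_trunc_normal N x yk0 BB By.
  rewrite BT addNr sqr_sqrtr// => /le_trans; apply.
  have -> : expmx_trunc N (0 : 'M[R]_(d + d)) = 1%:M.
    rewrite -(raddf0 (@scalar_mx _ (d + d))) expmx_trunc_scalar; congr _%:M.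
    rewrite /exp_trunc; case: N N2 => [//|N' _]; rewrite big_ord_recl fact0 invr1 expr0 mulr1.
    by rewrite big1 ?addr0// => i _; rewrite exprS mul0r mulr0.
  rewrite mul1mx [leRHS]mulrDl mul1r lerD2l ler_wpM2r ?mxdot_ge0//.
  by apply: exp_tail_scale => //; rewrite y0.
rewrite /block_product; elim: p K fac => [|p' IH] K' fac.
  by rewrite big_ord0 expr0 => x; rewrite mul1mx expr1n mul1r.
rewrite big_ord_recl exprS; apply: opnorm_leM; first exact: fac.
by apply: IH => j; exact: fac.
Qed.

Lemma quad_poly_imag (y : R) : 0 <= y <= 1 ->
  sqmod (poly_at (Complex 0 y) quad_poly) <= (1 + y ^+ 2 * exp_tail N kap) ^+ p.
Proof.
move=> y01; rewrite (le_trans (quad_poly_le_opnorm (opnorm_le_imag_product y01)))//.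
rewrite -exprM mulnC exprM sqr_sqrtr// addr_ge0// mulr_ge0 ?sqr_ge0//.
exact: exp_tail_ge0.
Qed.

End PolynomialProduct.

(** * The half disc inequality for one outcome of the chain *)

Section HalfDisc.
Context {R : realType}.
Local Notation C := R[i].
Local Notation toC := (real_complex R).
Local Notation RT := (measurableTypeR R).

Lemma sqmodD_le (z w : C) : sqmod (z + w) <= 2 * (sqmod z + sqmod w).
Proof.
case: z => a b; case: w => c e; rewrite /sqmod /= -subr_ge0.
have -> : 2 * (a ^+ 2 + b ^+ 2 + (c ^+ 2 + e ^+ 2)) - ((a + c) ^+ 2 + (b + e) ^+ 2) =
  (a - c) ^+ 2 + (b - e) ^+ 2 by ring.
by rewrite addr_ge0 ?sqr_ge0.
Qed.

Lemma sqmod_poly_at_bound (p : {poly R}) : exists2 c, 0 <= c &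
  forall z, sqmod z <= 1 -> sqmod (poly_at z p) <= c.
Proof.
elim/poly_ind: p => [|p a [c c0 IH]].
  by exists 0 => // z _; rewrite rmorph0 /sqmod /= expr0n addr0.
exists (2 * (c + a ^+ 2)); first by rewrite mulr_ge0// addr_ge0 ?sqr_ge0.
move=> z z1; rewrite rmorphD rmorphM /= poly_atX poly_atC.
rewrite (le_trans (sqmodD_le _ _))// ler_pM2l// lerD//.
  by rewrite sqmodM (le_trans _ (IH z z1))// ler_piMr ?sqmod_ge0.
by rewrite /sqmod /= [X in _ + X]expr0n addr0.
Qed.

(** Such a p is z times a polynomial bounded on the disc. On the axis its size is thus linear in y,
    as [exp_tail_scale] expects. *)
Lemma sqmod_poly_at_bound0 (p : {poly R}) : p`_0 = 0 -> exists2 k, 0 <= k &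
  forall z, sqmod z <= 1 -> sqmod (poly_at z p) <= k ^+ 2 * sqmod z.
Proof.
elim/poly_ind: p => [|p a _]; first exists 0 => // z _.
  by rewrite rmorph0 expr0n mul0r /sqmod /= expr0n addr0.
rewrite coefD coefMX coefC /= add0r => ->; rewrite addr0.
have [c c0 h] := sqmod_poly_at_bound p; exists (Num.sqrt c); first exact: sqrtr_ge0.
move=> z z1; rewrite rmorphM /= poly_atX sqmodM sqr_sqrtr//.
by rewrite ler_wpM2r ?sqmod_ge0// h.
Qed.

Lemma exp_trunc_coef N (p : {poly R}) : (1 < N)%N -> p`_0 = 0 ->
  (exp_trunc N p)`_0 = 1 /\ (exp_trunc N p)`_1 = p`_1.
Proof.
case: N => [//|[//|N]] _ p0; rewrite /exp_trunc 2!big_ord_recl.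
have pp r : (p ^+ 2 * r)`_0 = 0 /\ (p ^+ 2 * r)`_1 = 0.
  rewrite !coefM !big_ord_recl !big_ord0 /= !subn0 !subnn.
  rewrite expr2 !coefM !big_ord_recl !big_ord0 /= !subn0 !subnn p0.
  by split; ring.
have rest : exists r, \sum_(i < N) ((lift ord0 (lift ord0 i))`!%:R)^-1 *
    p ^+ lift ord0 (lift ord0 i) = p ^+ 2 * r.
  exists (\sum_(i < N) ((lift ord0 (lift ord0 i))`!%:R)^-1 * p ^+ i).
  rewrite mulr_sumr; apply: eq_bigr => i _.
  by rewrite [RHS]mulrCA -exprD /= /bump !leq0n !add1n.
have [r ->] := rest; have [r0 r1] := pp r.
rewrite !coefD r0 r1 expr0 expr1 /= !invr1 !mul1r !addr0.
by rewrite !coef1 p0 addr0 add0r.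
Qed.

Lemma prod_convex_step (u X A t : R) : 0 <= u <= 1 -> 1 <= A -> 0 <= t ->
  X <= 1 + u * (A - 1) -> X * (1 + u * t) <= 1 + u * (A * (1 + t) - 1).
Proof.
move=> /andP[u0 u1] A1 t0 XA.
have ut : 0 <= 1 + u * t by rewrite addr_ge0// mulr_ge0.
rewrite (le_trans (ler_wpM2r ut XA))// -subr_ge0.
have -> : 1 + u * (A * (1 + t) - 1) - (1 + u * (A - 1)) * (1 + u * t) =
  u * (1 - u) * (A - 1) * t by ring.
by rewrite !mulr_ge0// subr_ge0.
Qed.

(** A product of factors 1 + u t with t >= 0 is convex in u, so on [0, 1] it lies below its chord.
    At u = y^2 this puts the defect on the axis in the form delta y^2 of [carleman_inequality]. *)
Lemma prod_convex (u t t' : R) m : 0 <= u <= 1 -> 0 <= t -> 0 <= t' ->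
  (1 + u * t) ^+ m * (1 + u * t') <= 1 + ((1 + t) ^+ m * (1 + t') - 1) * u.
Proof.
move=> u01 t0 t'0; rewrite [(_ - 1) * u]mulrC; apply: prod_convex_step => //.
  by rewrite exprn_ege1// lerDl.
elim: m => [|m IH]; first by rewrite !expr0 subrr mulr0 addr0.
rewrite !exprSr; apply: prod_convex_step => //.
by rewrite exprn_ege1// lerDl.
Qed.

Lemma bm_sin : bounded_measurable (sin : RT -> R).
Proof. by apply: (@bm_continuous _ _ 1); [exact: continuous_sin | exact: sin_max]. Qed.

Lemma bm_Re_poly_at_cis (p : {poly R}) :
  bounded_measurable ((fun x => complex.Re (poly_at (cis x) p)) : RT -> R).
Proof.
under eq_fun do rewrite (Re_poly_at_cis _ (leqnn (size p))).
apply: bm_sum => k; apply: bmZ; apply: (@bm_continuous _ _ 1).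
  move=> x; apply: (@continuous_comp _ _ _ (fun x : R => k%:R * x) cos).
    by apply: cvgM; [exact: cvg_cst | exact: cvg_id].
  exact: continuous_cos.
by move=> x; exact: cos_max.
Qed.

Lemma bmx_cblock (disp : measure_display) (T : measurableType disp) n (c s : T -> R)
    (A : T -> 'M[R]_n) : bounded_measurable c -> bounded_measurable s ->
  bounded_measurable_mx A ->
  bounded_measurable_mx (fun x => cblock (Complex (c x) (s x) *: map_mx toC (A x))).
Proof.
move=> bc bs bA i j; rewrite -(@splitK n n i) -(@splitK n n j).
move: (fintype.split i) (fintype.split j) => [a|a] [b|b] /=.
- under eq_fun do rewrite block_mxEul !mxE /= mulr0 subr0.
  by apply: bmM.
- under eq_fun do rewrite block_mxEur !mxE /= mulr0 add0r.
  under eq_fun do rewrite -mulN1r.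
  by apply: bmZ; apply: bmM.
- under eq_fun do rewrite block_mxEdl !mxE /= mulr0 add0r.
  by apply: bmM.
- under eq_fun do rewrite block_mxEdr !mxE /= mulr0 subr0.
  by apply: bmM.
Qed.


Variables (d p : nat) (K : 'I_p -> 'M[R]_d) (N : nat).

Lemma bmx_block_product (disp : measure_display) (T : measurableType disp)
    (c s : T -> R) (A : 'I_p -> T -> 'M[R]_d) :
  bounded_measurable c -> bounded_measurable s ->
  (forall j, bounded_measurable_mx (A j)) ->
  bounded_measurable_mx (fun x => block_product (fun j => A j x) N (Complex (c x) (s x))).
Proof.
move=> bc bs bA.
have : forall r : seq 'I_p, bounded_measurable_mx (fun x =>
    \prod_(j <- r) expmx_trunc N (cblock (Complex (c x) (s x) *: map_mx toC (A j x)))).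
  elim=> [|j r IH]; first by under eq_fun do rewrite big_nil; exact: bmx_cst.
  under eq_fun do rewrite big_cons; apply: bmx_mul => //.
  by apply: bmx_sum => k; apply: bmxZ; apply: bmxX; exact: bmx_cblock.
exact.
Qed.

Hypothesis N2 : (1 < N)%N.
Variable v : 'rV[R]_d.
Hypothesis v1 : mxdot v v = 1.
Variables (kap kap' a : R) (Q : {poly R}) (h : RT -> R).
Hypotheses (kap0 : 0 <= kap) (kap'0 : 0 <= kap') (Ksym : forall j, (K j)^T = K j)
  (Kkap : forall j, opnorm_le (K j) kap)
  (va : v *m (\sum_j K j) = a *: v)
  (Q_odd : forall m, Q`_m.*2 = 0)
  (Qkap : forall z, sqmod z <= 1 -> sqmod (poly_at z Q) <= kap' ^+ 2 * sqmod z)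
  (aQ : 0 <= a + Q`_1) (bh : bounded_measurable h)
  (Qh : forall x, exp_trunc N (2 * complex.Re (poly_at (cis x) Q)) + exp_tail N kap' <= h x).

Lemma half_disc_inequality :
  (2 / pi) * (1 - ((1 + exp_tail N kap) ^+ p * (1 + exp_tail N kap') - 1) / 3) <=
  \int[quarter_angle]_x
    (mxdot (block_product K N (cis x)) (block_product K N (cis x)) / 2 * h x * cos x).
Proof.
pose E := exp_trunc N Q; pose g := quad_poly K N v * E; pose f := g ^+ 2.
have [E0 E1] : E`_0 = 1 /\ E`_1 = Q`_1 by exact: exp_trunc_coef N2 (Q_odd 0).
have g0 : g`_0 = 1 by rewrite coefM big_ord1 quad_poly_coef0// E0 mulr1.
have g1 : g`_1 = a + Q`_1.
  rewrite coefM big_ord_recl big_ord1 /= quad_poly_coef0// (quad_poly_coef1 N2 v1 va).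
  by rewrite E0 E1 mul1r mulr1 addrC.
have f0 : f`_0 = 1 by rewrite /f expr2 coefM big_ord1 g0 mulr1.
have f1 : f`_1 = 2 * (a + Q`_1).
  by rewrite /f expr2 coefM big_ord_recl big_ord1 /= g0 g1 mul1r mulr1 mulrDl mul1r.
have t0 := exp_tail_ge0 N kap0; have t'0 := exp_tail_ge0 N kap'0.
have imag y : 0 <= y <= 1 -> complex.Re (poly_at (Complex 0 y) f) <=
    f`_0 + ((1 + exp_tail N kap) ^+ p * (1 + exp_tail N kap') - 1) * y ^+ 2.
  move=> /andP[y0 y1]; have y01 : 0 <= y <= 1 by rewrite y0.
  rewrite f0 /f rmorphXn /= (le_trans (Re_sqr_le _))//.
  rewrite (le_trans _ (prod_convex p _ t0 t'0))//; last by rewrite sqr_ge0 exprn_ile1.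
  rewrite rmorphM /= sqmodM ler_pM ?sqmod_ge0//; first exact: quad_poly_imag.
  have sy : sqmod (Complex 0 y) = y ^+ 2 by rewrite /sqmod /= expr0n add0r.
  rewrite poly_at_exp_trunc (le_trans (@sqmod_exp_trunc _ N _ (y * kap') _ _))//.
  - by rewrite mulr_ge0.
  - by rewrite exprMn mulrC -sy Qkap// sy exprn_ile1.
  have -> : complex.Re (poly_at (Complex 0 y) Q) = 0.
    rewrite (@Re_poly_at_imag _ (size Q)); last by rewrite -addnn leq_addr.
    by rewrite big1// => m _; rewrite Q_odd mul0r.
  have -> : exp_trunc N (2 * 0 : R) = 1.
    rewrite mulr0 /exp_trunc; case: N N2 => [//|N' _]; rewrite big_ord_recl fact0 invr1 expr0 mulr1.
    by rewrite big1 ?addr0// => i _; rewrite exprS mul0r mulr0.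
  by rewrite lerD2l exp_tail_scale.
have := carleman_inequality imag; rewrite f0 => cl.
have cl2 : (2 / pi) * (1 - ((1 + exp_tail N kap) ^+ p * (1 + exp_tail N kap') - 1) / 3) <=
    (2 / pi) * (1 + pi / 4 * f`_1 -
      ((1 + exp_tail N kap) ^+ p * (1 + exp_tail N kap') - 1) / 3).
  rewrite ler_wpM2l ?divr_ge0 ?pi_ge0// lerD2r lerDl f1 mulr_ge0 ?divr_ge0 ?pi_ge0//.
  exact: mulr_ge0.
rewrite (le_trans cl2)// (le_trans cl)//; apply: mean_quarter_le.
- by apply: bmM; [exact: bm_Re_poly_at_cis | exact: bm_cos].
- apply: bmM; last exact: bm_cos; apply: bmM => //.
  under eq_fun do rewrite mulrC; apply: bmZ; apply: bm_mxdot.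
    by apply: (@bmx_block_product _ _ _ _ (fun j _ => K j));
      [exact: bm_cos | exact: bm_sin | move=> j; exact: bmx_cst].
  by apply: (@bmx_block_product _ _ _ _ (fun j _ => K j));
      [exact: bm_cos | exact: bm_sin | move=> j; exact: bmx_cst].
move=> x /cos_quarter_ge0 cx; rewrite ler_wpM2r//.
rewrite /f rmorphXn /= (le_trans (Re_sqr_le _))// rmorphM /= sqmodM.
rewrite ler_pM ?sqmod_ge0//; first exact: quad_poly_le_frobenius.
rewrite poly_at_exp_trunc (le_trans _ (Qh x))// sqmod_exp_trunc//.
by rewrite (le_trans (Qkap _))// sqmod_cis// mulr1.
Qed.

End HalfDisc.

(** * The tail bound *)

Section MeanFubini.
Context {d1 d2 : measure_display} {T1 : measurableType d1} {T2 : measurableType d2}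
  {R : realType}.
Variables (m1 : probability T1 R) (m2 : probability T2 R) (f : T1 * T2 -> R).
Hypothesis bf : bounded_measurable f.

Lemma bm_section1 x : bounded_measurable (fun y => f (x, y)).
Proof. by apply: (bm_comp (f := f)) => //; exact: measurable_pair1. Qed.

Lemma bm_section2 y : bounded_measurable (fun x => f (x, y)).
Proof. by apply: (bm_comp (f := f)) => //; exact: measurable_pair2. Qed.

Let integrable_f : (m1 \x m2)%E.-integrable setT (EFin \o f).
Proof.
have [mf [K fK]] := bf.
apply/integrable12ltyP; first exact/measurable_EFinP.
apply: (@le_lt_trans _ _ (\int[m1]_x (K%:E)%E)%E).
  apply: ge0_le_integral => //.
  - by move=> x _; exact: integral_ge0.
  - apply: (@measurable_fun_fubini_tonelli_F _ _ _ _ _ m2 (fun z => `|(EFin \o f) z|%E)) => //.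
    by apply: measurableT_comp => //; exact/measurable_EFinP.
  - move=> x _; rewrite (@le_trans _ _ (\int[m2]_y (K%:E)%E)%E)//.
      apply: ge0_le_integral => //.
      + apply: measurableT_comp => //; apply/measurable_EFinP.
        by have [] := bm_section1 x.
      + by move=> y _; rewrite lee_fin.
    by rewrite mean_EFin ?mean_cst//; exact: bm_cst.
by rewrite mean_EFin ?mean_cst ?ltry//; exact: bm_cst.
Qed.

Lemma bm_mean_section : bounded_measurable (fun x => \int[m2]_y f (x, y)).
Proof.
have [mf [K fK]] := bf; split.
  apply/measurable_EFinP.
  have := measurable_fubini_F integrable_f.
  rewrite /fubini_F; congr (measurable_fun _ _); apply/funext => x /=.
  by rewrite -mean_EFin//; exact: bm_section1.
by exists K => x; apply: mean_norm_le => //; exact: bm_section1.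
Qed.

Lemma mean_exchange :
  \int[m1]_x \int[m2]_y f (x, y) = \int[m2]_y \int[m1]_x f (x, y).
Proof.
transitivity (fine (\int[m1]_x \int[m2]_y (f (x, y))%:E)%E).
  congr fine; apply: eq_integral => x _; rewrite mean_EFin//; exact: bm_section1.
rewrite (Fubini integrable_f); congr fine.
by apply: eq_integral => y _; rewrite mean_EFin//; exact: bm_section2.
Qed.

End MeanFubini.

Section ComplexRotation.
Context {disp : measure_display} {T : measurableType disp} {R : realType}.
Variables (mu : probability T R) (d : nat) (A : T -> 'M[R]_d) (m r : R).
Local Notation C := R[i].
Local Notation toC := (real_complex R).
Hypotheses (A_sym : forall x, (A x)^T = A x) (m0 : 0 <= m) (Ab : two_sided_bound mu A m r).

Lemma row_bound_rotation (z : C) : sqmod z = 1 ->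
  row_bound mu (fun x => cblock (z *: map_mx toC (A x))) m r.
Proof.
move=> z1; have [[bA Am Ar] _ _] := Ab; split.
- by case: (z) => a b; apply: bmx_cblock => //; exact: bm_cst.
- by move=> x; rewrite -[m]mul1r; apply: opnorm_le_cblockZ => //; rewrite z1 expr1n.
move=> v.
have E x : mxdot (cblock (z *: map_mx toC (A x)) *m v) (cblock (z *: map_mx toC (A x)) *m v) =
    mxdot (A x *m usubmx v) (A x *m usubmx v) + mxdot (A x *m dsubmx v) (A x *m dsubmx v).
  rewrite cblock_scalarZ -mulmxA mxdot_cblock_scalar z1 mul1r cblock_realE -{1 2}(vsubmxK v).
  by rewrite mul_block_col !mul0mx addr0 add0r mxdot_col_mx.
under eq_Rintegral do rewrite E.
have bAv (u : 'cV[R]_d) : bounded_measurable (fun x => mxdot (A x *m u) (A x *m u)).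
  by apply: bm_mxdot; apply: bmx_mul => //; exact: bmx_cst.
rewrite meanD//.
have -> : mxdot v v = mxdot (usubmx v) (usubmx v) + mxdot (dsubmx v) (dsubmx v).
  by rewrite -mxdot_col_mx vsubmxK.
by rewrite mulrDr lerD.
Qed.

(** The transpose of a rotated symmetric matrix is its rotation by the conjugate number, so the same
    row bound serves for both. *)
Lemma two_sided_bound_rotation (z : C) : sqmod z = 1 ->
  two_sided_bound mu (fun x => cblock (z *: map_mx toC (A x))) m r.
Proof.
move=> z1; split; first exact: row_bound_rotation.
  have -> : (fun x => (cblock (z *: map_mx toC (A x)))^T) =
      (fun x => cblock (conjc z *: map_mx toC (A x))).
    apply/funext => x; rewrite cblock_conj.
      congr cblock; apply/matrixP => i j; rewrite !mxE; case: (z) => a b.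
      by rewrite /real_complex_def /=; congr Complex; ring.
    by apply/matrixP => i j; rewrite !mxE -[in LHS]A_sym mxE.
  by apply: row_bound_rotation; case: z z1 => a b; rewrite /sqmod /= sqrrN.
have [[bA _ _] _ /matrixP A0] := Ab.
have mean0 a (i j : 'I_d) : \int[mu]_x (a * A x i j) = 0.
  by rewrite meanZ//; have := A0 i j; rewrite !mxE => ->; rewrite mulr0.
apply/matrixP => i j; rewrite !mxE -(@splitK d d i) -(@splitK d d j).
move: (fintype.split i) (fintype.split j) => [a|a] [b|b] /=;
  case: z {z1} => c s.
- rewrite -(mean0 c a b); apply: eq_Rintegral => x _.
  by rewrite block_mxEul !mxE /= mulr0 subr0.
- rewrite -(mean0 (- s) a b); apply: eq_Rintegral => x _.
  by rewrite block_mxEur !mxE /= mulr0 add0r mulNr.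
- rewrite -(mean0 s a b); apply: eq_Rintegral => x _.
  by rewrite block_mxEdl !mxE /= mulr0 add0r.
- rewrite -(mean0 c a b); apply: eq_Rintegral => x _.
  by rewrite block_mxEdr !mxE /= mulr0 subr0.
Qed.

End ComplexRotation.

Section TailBound.
Context {disp disp' : measure_display} {T : measurableType disp}
  {Omega : measurableType disp'} {R : realType}.
Local Notation C := R[i].
Local Notation toC := (real_complex R).
Local Notation RT := (measurableTypeR R).
Variables (P : R.-pker T ~> T) (mu : probability T R) (lam : R).
Hypotheses (st : stationary P mu) (lamE : kernel_lambda P mu = lam%:E).
Variables (n : nat) (Pr : probability Omega R) (s : 'I_n.+1 -> {mfun Omega >-> T}).
Hypothesis s_chain : markov_chain Pr P mu s.
Variables (d : nat) (F : 'I_n.+1 -> T -> 'M[R]_d) (V : 'I_n.+1 -> R) (M : R).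
Hypotheses (F_measurable : forall (j : 'I_n.+1) (a b : 'I_d),
     measurable_fun [set: T] (fun x : T => F j x a b))
  (F_sym : forall (j : 'I_n.+1) (x : T), (F j x)^T = F j x)
  (F_mean : forall j : 'I_n.+1, mx_expectation mu (F j) = 0)
  (F_var : forall j : 'I_n.+1,
     spectral_norm (mx_expectation mu (fun x : T => F j x ^+ 2)) <= V j)
  (M_gt0 : 0 < M)
  (F_bound : forall (j : 'I_n.+1) (x : T), spectral_norm (F j x) <= M).
Variable theta : R.
Hypotheses (theta_gt0 : 0 < theta) (theta_gap : lam != 0 -> theta < ln (1 / lam) / M).

Let m := theta * M / 2.
Let m0 : 0 <= m. Proof. by rewrite divr_ge0 ?mulr_ge0// ltW. Qed.
Let Kmx w j := (theta / 2) *: F j (s j w).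
Let bnd : R := d%:R * expR ((\sum_j V j) / M ^+ 2 * gap_factor lam m).
Let two_sided j := two_sided_bound_symmetric F_measurable F_sym F_mean F_var M_gt0 F_bound j theta_gt0.

Definition rotated_norm N w (x : R) : R :=
  mxdot (block_product (Kmx w) N (cis x)) (block_product (Kmx w) N (cis x)) / 2.

Lemma bmx_rotated (disp1 : measure_display) (T1 : measurableType disp1) N
    (phi : T1 -> Omega) (c e : T1 -> R) : measurable_fun setT phi ->
  bounded_measurable c -> bounded_measurable e ->
  bounded_measurable_mx (fun z => block_product (Kmx (phi z)) N (Complex (c z) (e z))).
Proof.
move=> mphi bc be; apply: (@bmx_block_product _ _ _ _ _ _ _ _ (fun j z => Kmx (phi z) j)) => // j.
apply: bmxZ => a b; apply: (bm_comp (f := fun y => F j y a b) (phi := s j \o phi)).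
  exact: measurableT_comp.
exact: (bmx_F F_measurable M_gt0 F_bound).
Qed.

(** The real blocks have size 2d, which doubles the dimension factor; the half in [rotated_norm]
    brings it back to d. *)
Lemma mean_rotated_norm N x : (1 < N)%N -> \int[Pr]_w rotated_norm N w x <= bnd.
Proof.
move=> N2; have lq := gap_condition lamE M_gt0 theta_gt0 theta_gap.
have Ksym j y : ((theta / 2) *: F j y)^T = (theta / 2) *: F j y by rewrite linearZ /= F_sym.
have tsb j := two_sided_bound_rotation (Ksym j) m0 (two_sided j) (sqmod_cis x).
have := mean_chain_product_exp st lamE s_chain
  (B := fun j y => cblock (cis x *: map_mx toC ((theta / 2) *: F j y)))
  N2 m0 (std_ratio_ge0 V M_gt0) tsb lq.
rewrite (sum_std_ratio _ F_var) // -/m natrD mulrDl => h.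
have -> : \int[Pr]_w rotated_norm N w x =
    2^-1 * \int[Pr]_w mxdot (block_product (Kmx w) N (cis x)) (block_product (Kmx w) N (cis x)).
  rewrite -meanZ; first by apply: eq_Rintegral => w _; rewrite mulrC.
  have b : bounded_measurable_mx (fun w => block_product (Kmx w) N (cis x)).
    by apply: (bmx_rotated N (phi := id)); [exact: measurable_id | exact: bm_cst | exact: bm_cst].
  exact: bm_mxdot.
by rewrite mulrC ler_pdivrMr// mulr_natr mulr2n.
Qed.

Lemma bm_rotated_norm N : bounded_measurable (fun z : Omega * RT => rotated_norm N z.1 z.2).
Proof.
rewrite /rotated_norm; under eq_fun do rewrite mulrC; apply: bmZ.
have b : bounded_measurable_mx (fun z : Omega * RT => block_product (Kmx z.1) N (cis z.2)).
  apply: bmx_rotated => //.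
  - by apply: (bm_comp (f := (cos : RT -> R)) (phi := snd)) => //; exact: bm_cos.
  - by apply: (bm_comp (f := (sin : RT -> R)) (phi := snd)) => //; exact: bm_sin.
exact: bm_mxdot.
Qed.

Variables (E : set Omega) (t : R).
Hypotheses (mE : measurable E) (t0 : 0 <= t)
  (E_eigen : forall w, E w -> exists a (v : 'rV[R]_d),
     [/\ t <= a, mxdot v v = 1 & v *m (\sum_j F j (s j w)) = a *: v]).

Let Kkap w j : opnorm_le (Kmx w j) m.
Proof. by have [[_ h _] _ _] := two_sided j; exact: h. Qed.

(** [half_disc_inequality] is integrated over the event. On the right the event can be forgotten,
    since the integrand is nonnegative on the quarter circle; then the two means are exchanged and
    the chain estimate is used at each angle. *)
Lemma tail_step N kap' (Q : {poly R}) (h : RT -> R) : (1 < N)%N -> 0 <= kap' ->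
  (forall k, Q`_k.*2 = 0) ->
  (forall z, sqmod z <= 1 -> sqmod (poly_at z Q) <= kap' ^+ 2 * sqmod z) ->
  - (theta / 2 * t) <= Q`_1 -> bounded_measurable h -> (forall x, 0 <= h x) ->
  (forall x, exp_trunc N (2 * complex.Re (poly_at (cis x) Q)) + exp_tail N kap' <= h x) ->
  fine (Pr E) *
    ((2 / pi) * (1 - ((1 + exp_tail N m) ^+ n.+1 * (1 + exp_tail N kap') - 1) / 3)) <=
  bnd * \int[quarter_angle]_x (h x * cos x).
Proof.
move=> N2 kap'0 Q_odd Qkap Q1 bh h0 Qh; set L := (_ / pi * _).
pose f (z : Omega * RT) := rotated_norm N z.1 z.2 * h z.2 * cos (z.2 : R).
have b2 (g : RT -> R) : bounded_measurable g -> bounded_measurable (fun z : Omega * RT => g z.2).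
  by move=> bg; exact: (bm_comp (f := g) (phi := snd)).
have bf : bounded_measurable f.
  by apply: bmM; [apply: bmM; [exact: bm_rotated_norm | exact: b2] | exact: (b2 _ bm_cos)].
have bhc : bounded_measurable (fun x : RT => h x * cos x) by apply: bmM => //; exact: bm_cos.
have rn0 w x : 0 <= rotated_norm N w x by rewrite divr_ge0// mxdot_ge0.
apply: (@le_trans _ _ (\int[Pr]_w \int[quarter_angle]_x f (w, x))).
  rewrite -(mean_indic Pr mE) mulrC -meanZ; last exact: bm_indic.
  apply: mean_le; [exact/bmZ/bm_indic | exact: (bm_mean_section Pr quarter_angle bf) |].
  move=> w; rewrite indicE; have [wE|wE] := boolP (w \in E); last first.
    rewrite mulr0 -(mean_cst quarter_angle 0); apply: mean_quarter_le.
    - exact: bm_cst.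
    - exact: (bm_section1 bf w).
    - move=> x /cos_quarter_ge0 cx; rewrite /f /=; apply: mulr_ge0 => //; exact: mulr_ge0.
  rewrite mulr1; move: wE; rewrite inE => /E_eigen[a [v [ta v1 va]]].
  apply: (@half_disc_inequality _ _ _ (Kmx w) N N2 v v1 m kap' (theta / 2 * a) Q h) => //.
  - by move=> j; rewrite linearZ /= F_sym.
  - by rewrite -scaler_sumr -scalemxAr va scalerA.
  - rewrite -lerBlDl sub0r (le_trans _ Q1)// lerN2 ler_wpM2l// divr_ge0// ltW//.
rewrite mean_exchange// -meanZ//; apply: mean_quarter_le.
- have bfs : bounded_measurable (fun z : RT * Omega => f (z.2, z.1)).
    by apply: (bm_comp (f := f) (phi := fun z : RT * Omega => (z.2, z.1))) => //;
      exact: measurable_swap.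
  exact: (bm_mean_section quarter_angle Pr bfs).
- exact: bmZ.
move=> x /cos_quarter_ge0 cx.
have -> : \int[Pr]_w f (w, x) = (h x * cos x) * \int[Pr]_w rotated_norm N w x.
  rewrite -meanZ; last exact: (bm_section2 (bm_rotated_norm N) x).
  by apply: eq_Rintegral => w _; rewrite /f /= -[LHS]mulrA mulrC.
by rewrite mulrC ler_wpM2r ?mean_rotated_norm// mulr_ge0.
Qed.

(** N tends to infinity with k fixed, because the radius [kap'] depends on the multiplier of index
    k. *)
Lemma tail_bound_lim k : fine (Pr E) * (2 / pi) <=
  bnd * \int[quarter_angle]_x
    (expR (- (theta * t * (pi / 4)) * sgn_iter k (cos x)) * cos x).
Proof.
set c := theta * t * (pi / 4).
have c0 : 0 <= c.
  apply: mulr_ge0; first exact: mulr_ge0 (ltW theta_gt0) t0.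
  by rewrite divr_ge0// pi_ge0.
have [q [q_odd q_cis q1]] := multiplier_exists (R := R) k.
(* As q'(0) <= 4/pi, the slope of Q at 0 is at least -(c/2)(4/pi) = -theta t/2, which f'(0)
   compensates. *)
pose Q : {poly R} := (- (c / 2)) *: q.
have Q_odd i : Q`_i.*2 = 0 by rewrite coefZ q_odd mulr0.
have [kap' kap'0 Qkap] := sqmod_poly_at_bound0 (Q_odd 0).
have Q_cis x : 2 * complex.Re (poly_at (cis x) Q) = - c * sgn_iter k (cos x).
  rewrite /Q -mul_polyC rmorphM /= poly_atC Re_toCM q_cis.
  by move: (c) (sgn_iter _ _) => c' y; field.
have Q1 : - (theta / 2 * t) <= Q`_1.
  rewrite coefZ mulNr lerN2 (@le_trans _ _ (c / 2 * (4 / pi)))//.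
    by rewrite ler_wpM2l// divr_ge0.
  rewrite /c; move: (@pi_gt0 R); move: (pi : R) => p p0.
  by rewrite le_eqVlt; apply/predU1P; left; field; rewrite gt_eqF.
pose eta N := expR c - exp_trunc N c + exp_tail N kap'.
pose h N x : R := expR (- c * sgn_iter k (cos x)) + eta N.
have eta0 N : 0 <= eta N by rewrite addr_ge0 ?exp_tail_ge0// subr_ge0 exp_trunc_le_expR.
have step N : (1 < N)%N ->
    fine (Pr E) *
      ((2 / pi) * (1 - ((1 + exp_tail N m) ^+ n.+1 * (1 + exp_tail N kap') - 1) / 3)) <=
    bnd * (\int[quarter_angle]_x (expR (- c * sgn_iter k (cos x)) * cos x) + eta N * (2 / pi)).
  move=> N2; have bh : bounded_measurable (h N : RT -> R).
    by apply: bmD; [exact: bm_expR_sgn_iter | exact: bm_cst].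
  rewrite (le_trans (tail_step N2 kap'0 Q_odd Qkap Q1 bh _ _))//.
  - by move=> x; rewrite addr_ge0 ?expR_ge0.
  - move=> x; rewrite Q_cis /h /eta [leRHS]addrA lerD2r.
    apply: exp_trunc_le_expR_tail; rewrite normrM normrN (ger0_norm c0) ler_piMr//.
    by rewrite sgn_iter_norm// cos_max.
  rewrite le_eqVlt; apply/predU1P; left; congr (_ * _).
  rewrite -mean_quarter_cos -meanZ; last exact: bm_cos.
  rewrite -meanD; last 2 first.
  - by apply: bmM; [exact: bm_expR_sgn_iter | exact: bm_cos].
  - by apply: bmZ; exact: bm_cos.
  by apply: eq_Rintegral => x _; rewrite mulrDl.
have lhs : fine (Pr E) *
      ((2 / pi) * (1 - ((1 + exp_tail N m) ^+ n.+1 * (1 + exp_tail N kap') - 1) / 3))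
    @[N --> \oo] --> fine (Pr E) * ((2 / pi) * (1 - ((1 + 0) ^+ n.+1 * (1 + 0) - 1) / 3)).
  apply: cvgM; first exact: cvg_cst.
  apply: cvgM; first exact: cvg_cst.
  apply: cvgB; first exact: cvg_cst.
  apply: cvgM; last exact: cvg_cst.
  apply: cvgB; last exact: cvg_cst.
  apply: cvgM; last by apply: cvgD; [exact: cvg_cst | exact: exp_tail_cvg0].
  apply: (@continuous_cvg _ _ _ _ _ _ (fun x : R => x ^+ n.+1)); first exact: exprn_continuous.
  by apply: cvgD; [exact: cvg_cst | exact: exp_tail_cvg0].
have rhs : bnd * (\int[quarter_angle]_x (expR (- c * sgn_iter k (cos x)) * cos x) +
      eta N * (2 / pi)) @[N --> \oo] -->
    bnd * (\int[quarter_angle]_x (expR (- c * sgn_iter k (cos x)) * cos x) +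
      (expR c - expR c + 0) * (2 / pi)).
  apply: cvgM; first exact: cvg_cst.
  apply: cvgD; first exact: cvg_cst.
  apply: cvgM; last exact: cvg_cst.
  apply: cvgD; last exact: exp_tail_cvg0.
  by apply: cvgB; [exact: cvg_cst | exact: exp_trunc_cvg].
have -> : 2 / pi = 2 / pi * (1 - ((1 + 0) ^+ n.+1 * (1 + 0) - 1) / 3) :> R.
  by rewrite addr0 expr1n mul1r subrr mul0r subr0 mulr1.
have -> : \int[quarter_angle]_x (expR (- c * sgn_iter k (cos x)) * cos x) =
   \int[quarter_angle]_x (expR (- c * sgn_iter k (cos x)) * cos x) +
      (expR c - expR c + 0) * (2 / pi) by rewrite subrr addr0 mul0r addr0.
apply: (ler_cvg_to lhs rhs); near=> N; apply: step; near: N; exact: nbhs_infty_gt.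
Unshelve. all: by end_near.
Qed.

Lemma tail_bound : (Pr E <= (bnd * expR (- (theta * t * (pi / 4))))%:E)%E.
Proof.
have fP : (Pr E \is a fin_num) by exact: fin_num_measure.
rewrite -(fineK fP) lee_fin.
have p2 : 0 < 2 / pi :> R by rewrite divr_gt0// pi_gt0.
have bnd0 : 0 <= bnd by rewrite mulr_ge0// expR_ge0.
rewrite -(ler_pM2r p2); apply/ler_addgt0Pr => e e0.
have e1 : 0 < e / (bnd + 1) by rewrite divr_gt0// ltr_wpDl.
have [k hk] := mean_expR_sgn_iter (- (theta * t * (pi / 4))) e1.
rewrite (le_trans (tail_bound_lim k))// (le_trans (ler_wpM2l bnd0 hk))//.
rewrite mulrDr lerD//.
  by rewrite [2 / pi * _]mulrC [leLHS]mulrA.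
rewrite mulrCA ler_piMr ?(ltW e0)//.
by rewrite ler_pdivrMr ?mul1r ?lerDl// ltr_wpDl.
Qed.

End TailBound.

(** * Eigenvalues and measurability of the tail event *)

Section LargestEigenvalue.
Context {R : realType}.

Lemma horner_char_poly n (A : 'M[R]_n) a : (char_poly A).[a] = \det (a%:M - A).
Proof.
rewrite /char_poly -horner_evalE -det_map_mx; congr (\det _).
by apply/matrixP => i j; rewrite !mxE /= /horner_eval hornerD hornerN hornerMn hornerX hornerC.
Qed.

(* [0 < t] excludes the value 0 of [sup] on the empty set. *)
Lemma lambda_max_ge n (A : 'M[R]_n) t : 0 < t ->
  (t <= lambda_max A) <-> exists2 a, t <= a & eigenvalue A a.
Proof.
move=> t0; rewrite /lambda_max; have pn0 : char_poly A != 0 by rewrite monic_neq0 ?char_poly_monic.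
split=> [tA|[a ta Aa]].
  have hs : has_sup [set a | eigenvalue A a].
    by apply: contrapT => /sup_out s0; move: tA; rewrite s0 leNgt t0.
  exists (sup [set a | eigenvalue A a]) => //; rewrite eigenvalue_root_char.
  (* The eigenvalues are the roots of a polynomial, a closed set, so the supremum is attained. *)
  have cl : closed [set a : R | (char_poly A).[a] = 0].
    apply: (@preimage_closed R R (horner (char_poly A)) [set x | x = 0]); last exact: closed_eq.
    by move=> x _; exact: continuous_horner.
  apply/eqP; apply: cl.
  have := closure_sup hs.1 hs.2; apply: closure_subset => a /=.
  by rewrite eigenvalue_root_char => /eqP.
rewrite (le_trans ta)//; apply: ub_le_sup => //.
exists (cauchy_bound (char_poly A)) => b /=; rewrite eigenvalue_root_char => /eqP pb.
exact: le_trans (ler_norm _) (ltW (cauchy_boundP pn0 pb)).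
Qed.

Lemma unit_eigenvector n (A : 'M[R]_n) a : eigenvalue A a ->
  exists2 v : 'rV[R]_n, mxdot v v = 1 & v *m A = a *: v.
Proof.
move=> /eigenvalueP[v vA v0]; pose c := Num.sqrt (mxdot v v).
have vp : 0 < mxdot v v.
  by rewrite lt_def mxdot_ge0 andbT; apply: contra_neq v0; exact: mxdot_eq0.
have c0 : c != 0 by rewrite gt_eqF// sqrtr_gt0.
exists (c^-1 *: v); last by rewrite -scalemxAl vA !scalerA mulrC.
by rewrite mxdotZl mxdotZr mulrA -invfM -expr2 sqr_sqrtr ?mxdot_ge0// mulVf// gt_eqF.
Qed.

Context {disp : measure_display} {T : measurableType disp}.

(* On a compact interval |p| attains its minimum, so p has a root there exactly
   when |p| takes arbitrarily small values at (truncated) rational points. *)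
Lemma measurable_root_ge (p : T -> {poly R}) (t : R) :
  (forall a, measurable_fun [set: T] (fun w => (p w).[a])) ->
  measurable [set w | exists2 a, t <= a & root (p w) a].
Proof.
move=> mp; pose clamp N a : R := Num.max t (Num.min a (t + N%:R)).
have -> : [set w | exists2 a, t <= a & root (p w) a] =
    \bigcup_N \bigcap_k \bigcup_(q in [set: rat])
      [set w | `|(p w).[clamp N (ratr q)]| < k.+1%:R^-1].
  apply/seteqP; split => [w [a ta /eqP pa]|w [N _ wN]].
    have [N aN] : exists N : nat, a <= t + N%:R.
      exists (Num.trunc (a - t)).+1; rewrite -lerBlDl ltW// truncnS_gt//.
    exists N => // k _.
    have cq q : `|clamp N q - a| <= `|q - a|.
      rewrite /clamp; case: (leP q (t + N%:R)) => h1.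
        case: (leP t q) => h2 //.
        by rewrite !ler0_norm ?subr_le0// ?(ltW (lt_le_trans h2 ta))// lerN2 lerD2r ltW.
      rewrite max_r ?lerDl// !ger0_norm ?subr_ge0//; first by rewrite lerD2r ltW.
      by rewrite (le_trans aN)// ltW.
    have k0 : 0 < k.+1%:R^-1 :> R by rewrite invr_gt0.
    have /cvgrPdist_lt/(_ _ k0)/nbhs_ballP[e /= e0 he] := @continuous_horner _ (p w) a.
    have /rat_in_itvoo[q] : a - e < a + e by lra.
    rewrite in_itv /= => /andP[q1 q2].
    exists q => //=; have := he (clamp N (ratr q)); rewrite pa sub0r normrN; apply.
    rewrite /ball /= distrC (le_lt_trans (cq _))// ltr_norml.
    by apply/andP; split; lra.
  have tN : t <= t + N%:R by rewrite lerDl.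
  have [] := @EVT_min _ (fun x => `|(p w).[x]|) _ _ tN.
    apply: continuous_subspaceT => x; apply: continuous_comp; first exact: continuous_horner.
    exact: norm_continuous.
  move=> a; rewrite in_itv /= => /andP[ta _] amin; exists a => //.
  apply/eqP/normr0_eq0/eqP; rewrite eq_le normr_ge0 andbT.
  apply/ler_addgt0Pr => e e0; rewrite add0r.
  have [k ke] : exists k : nat, k.+1%:R^-1 < e.
    exists (Num.trunc e^-1); rewrite invf_plt ?posrE//.
    exact: truncnS_gt.
  have [q _ /= qk] := wN k I.
  rewrite (le_trans (amin (clamp N (ratr q)) _)) ?(ltW (lt_trans qk ke))//.
  by rewrite in_itv /= le_max lexx /= ge_max tN ge_min lexx orbT.
apply: bigcup_measurable => N _; apply: bigcapT_measurable => k.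
apply: bigcupT_measurable_rat => q.
rewrite -[X in measurable X]setTI.
have mn : measurable_fun [set: T] (fun w => `|(p w).[clamp N (ratr q)]|).
  by apply: measurableT_comp.
have := mn measurableT `]-oo, k.+1%:R^-1[%classic (measurable_itv _).
by congr (measurable _); apply/seteqP; split => w /=; rewrite in_itv.
Qed.

End LargestEigenvalue.

(** * Choice of the parameter *)

Section GapFactorBound.
Context {R : realType}.

Lemma fact_ge_exp3 k : (2 * 3 ^ k <= (k.+2)`!)%N.
Proof.
elim: k => [//|k IH]; rewrite expnS factS mulnCA leq_mul//.
Qed.

(** Since 2 3^k <= (k+2)!, the series beyond its linear term is at most u^2/2 times the geometric
    series of ratio u/3. *)
Lemma expR_bernstein (u : R) : 0 <= u < 3 -> expR u - 1 - u <= u ^+ 2 / 2 / (1 - u / 3).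
Proof.
move=> /andP[u0 u3]; set y := u / 3.
have y0 : 0 <= y by rewrite divr_ge0.
have y1 : 0 < 1 - y by rewrite subr_gt0 ltr_pdivrMr ?mul1r.
have trunc_le N : exp_trunc N.+2 u <= 1 + u + u ^+ 2 / 2 * ((1 - y ^+ N) / (1 - y)).
  elim: N => [|N IH].
    rewrite expr0 subrr mul0r mulr0 addr0 /exp_trunc !big_ord_recl big_ord0 /=.
    by rewrite expr0 expr1 invr1 !mul1r addr0.
  have -> : exp_trunc N.+3 u = exp_trunc N.+2 u + (N.+2)`!%:R^-1 * u ^+ N.+2.
    by rewrite /exp_trunc big_ord_recr.
  rewrite (le_trans (lerD IH (_ : _ <= u ^+ 2 / 2 * y ^+ N)))//.
    rewrite mulrC ler_pdivrMr ?ltr0n ?fact_gt0// -[X in u ^+ X]addn2 exprD.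
    have uE : u = 3 * y by rewrite /y mulrC divfK.
    have -> : u ^+ N * u ^+ 2 = u ^+ 2 / 2 * y ^+ N * (2 * 3 ^ N)%:R.
      rewrite {1}uE exprMn natrM natrX; by field.
    by rewrite ler_wpM2l ?ler_nat ?fact_ge_exp3// !mulr_ge0 ?exprn_ge0// invr_ge0.
  rewrite -addrA lerD2l -mulrDr ler_wpM2l ?divr_ge0 ?sqr_ge0//.
  rewrite le_eqVlt; apply/predU1P; left.
  by rewrite exprS; field; rewrite gt_eqF.
have lim : exp_trunc N.+2 u @[N --> \oo] --> expR u.
  by have := exp_trunc_cvg (x := u); rewrite -(cvg_shiftn 2); under eq_fun do rewrite addn2.
rewrite lerBlDr lerBlDr -addrA addrC [u + 1]addrC.
apply: (ler_cvg_to lim (@cvg_cst _ _ _ _ _)); apply: nearW => N.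
rewrite (le_trans (trunc_le N))// lerD2l.
rewrite ler_wpM2l ?divr_ge0 ?sqr_ge0// ler_piMl ?invr_ge0 ?(ltW y1)//.
by rewrite lerBlDr lerDl exprn_ge0.
Qed.

Lemma gap_factor_le0 (u : R) : 0 <= u < 3 -> gap_factor 0 (u / 2) <= u ^+ 2 / 2 / (1 - u / 3).
Proof.
move=> u03; rewrite /gap_factor !mul0r addr0.
have -> : 2 * (u / 2) = u by field.
exact: expR_bernstein.
Qed.

Lemma gap_factor_le (lam u : R) : 0 <= lam < 1 -> 0 <= u -> 2 * u < 1 - lam ->
  gap_factor lam (u / 2) <= u ^+ 2 / 2 * ((1 + lam) / (1 - lam)) / (1 - 2 * u / (1 - lam)).
Proof.
move=> /andP[l0 l1] u0 ul; rewrite /gap_factor.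
have -> : 2 * (u / 2) = u by field.
have e0 : 0 < 1 - lam by rewrite subr_gt0.
set x := u / (1 - lam).
have uE : u = (1 - lam) * x by rewrite /x mulrC divfK// gt_eqF.
have x0 : 0 <= x by rewrite divr_ge0// ltW.
have x2 : 0 < 1 - 2 * x.
  by rewrite subr_gt0 /x mulrA ltr_pdivrMr ?mul1r.
have -> : 2 * u / (1 - lam) = 2 * x by rewrite mulrA.
have u1 : u < 2^-1 by lra.
have h1 : 0 < 1 - u / 2 by lra.
(* Relaxing 1 - u/3 to 1 - u/2 pays off in [w2], where u + (u^2/2)/(1 - u/2) is exactly u/(1 -
   u/2). *)
have w1 : expR u - 1 - u <= u ^+ 2 / 2 / (1 - u / 2).
  have u03 : 0 <= u < 3 by apply/andP; split; lra.
  rewrite (le_trans (expR_bernstein u03))// ler_wpM2l ?divr_ge0 ?sqr_ge0//.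
  by rewrite lef_pV2 ?posrE; lra.
have w2 : expR u - 1 <= u / (1 - u / 2).
  rewrite (le_trans (_ : _ <= u + u ^+ 2 / 2 / (1 - u / 2)))//; first by rewrite -lerBlDl.
  by rewrite le_eqVlt; apply/predU1P; left; field; rewrite gt_eqF; lra.
have w0 : 0 <= expR u - 1 by rewrite subr_ge0 -expR0 ler_expR.
set k := 1 - u / 2 in h1 w1 w2.
have kE : k = 1 - (1 - lam) * x / 2 by rewrite /k {1}uE.
have lx0 : 0 <= lam * x by exact: mulr_ge0.
have ex0 : 0 <= (1 - lam) * x by rewrite -uE.
(* By [hD] below, 1 - lam exp(u) is at least (1 - lam)(k - lam x)/k; this inequality then brings in
   the common denominator 1 - 2x. *)
have key : 1 - 2 * x <= k * (k - lam * x).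
  rewrite -subr_ge0.
  have -> : k * (k - lam * x) - (1 - 2 * x) =
      x + ((1 - lam) * x / 2) ^+ 2 + (1 - lam) * x * (lam * x) / 2 by rewrite kE; field.
  by rewrite !addr_ge0// ?sqr_ge0// divr_ge0// mulr_ge0.
have kx : 0 < k - lam * x by rewrite -(pmulr_rgt0 _ h1) (lt_le_trans x2).
have hw : (expR u - 1) ^+ 2 <= u ^+ 2 / k ^+ 2.
  by rewrite -expr_div_n lerXn2r ?nnegrE// divr_ge0// ltW.
have hD : (1 - lam) * (k - lam * x) / k <= 1 - lam * expR u.
  have -> : 1 - lam * expR u = 1 - lam - lam * (expR u - 1) by ring.
  have -> : (1 - lam) * (k - lam * x) / k = 1 - lam - lam * (u / k).
    by rewrite {1}uE; field; rewrite gt_eqF.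
  by rewrite lerD2l lerN2 ler_wpM2l.
have D0 : 0 < 1 - lam * expR u by apply: lt_le_trans hD; rewrite divr_gt0// mulr_gt0.
have t2 : lam * (expR u - 1) ^+ 2 / (1 - lam * expR u) <=
    lam * u ^+ 2 / (1 - lam) / (1 - 2 * x).
  have c0 : 0 <= lam * u ^+ 2 / (1 - lam) / (1 - 2 * x).
    by apply: divr_ge0 (ltW x2); apply: divr_ge0 (ltW e0); apply: mulr_ge0; rewrite ?sqr_ge0.
  rewrite ler_pdivrMr// (le_trans (ler_wpM2l l0 hw))// (le_trans _ (ler_wpM2l c0 hD))//.
  have -> : lam * (u ^+ 2 / k ^+ 2) =
      lam * u ^+ 2 / (1 - lam) / (1 - 2 * x) * ((1 - lam) * (1 - 2 * x) / k ^+ 2).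
    by field; rewrite !gt_eqF.
  rewrite ler_wpM2l// ler_pdivrMr ?exprn_gt0//.
  have -> : (1 - lam) * (k - lam * x) / k * k ^+ 2 = (1 - lam) * (k * (k - lam * x)).
    by field; rewrite gt_eqF.
  by rewrite ler_pM2l.
have t1 : expR u - 1 - u <= u ^+ 2 / 2 / (1 - 2 * x).
  rewrite (le_trans w1)// ler_wpM2l ?divr_ge0 ?sqr_ge0// lef_pV2 ?posrE//.
  rewrite (le_trans key)// ler_piMr ?(ltW h1)// lerBlDr (@le_trans _ _ 1) ?lerDl//.
  by rewrite /k gerBl divr_ge0.
rewrite (le_trans (lerD t1 t2))//.
rewrite le_eqVlt; apply/predU1P; left; field; rewrite !gt_eqF//.
Qed.

End GapFactorBound.

Section OptimalParameter.
Context {R : realType}.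

Lemma pi_le4 : pi <= 4 :> R.
Proof. by have := @pihalf_lt2 R; lra. Qed.

Lemma invpi_ge : 4^-1 <= pi^-1 :> R.
Proof. by rewrite lef_pV2 ?posrE ?pi_gt0// pi_le4. Qed.

(** From pi <= 4, the values 16/(3 pi^2) and 32/(pi^2 (1 - lam)) of [b] are at least the constants
    1/3 and 2/(1 - lam) of the two bounds on [gap_factor]. The factor 4/pi undoes the pi/4 of the
    tail exponent. For lam > 0, 1/b <= (1 - lam)/2 < 1 - lam <= ln(1/lam). *)
Lemma gap_factor_quadratic (lam : R) : 0 <= lam < 1 ->
  exists b, [/\ b = beta_gap lam * (4 / pi), 0 < b,
    lam != 0 -> b^-1 < ln (1 / lam) &
    forall u, 0 <= u -> b * u < 1 ->
      gap_factor lam (u / 2) <= u ^+ 2 / 2 * alpha_gap lam / (1 - b * u)].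
Proof.
move=> /andP[l0 l1]; exists (beta_gap lam * (4 / pi)).
have ip := invpi_ge; have ip0 : 0 < pi^-1 :> R by rewrite invr_gt0 pi_gt0.
have ip2 : 4^-1 * 4^-1 <= pi^-1 * pi^-1 :> R by rewrite ler_pM.
rewrite /beta_gap /alpha_gap; case: eqVneq => [-> /=|lam0].
  have bE : 4 / (3 * pi) * (4 / pi) = 16 / 3 * (pi^-1 * pi^-1) :> R.
    by move: (@pi_gt0 R); move: (pi : R) => p p0; field; rewrite gt_eqF.
  have b3 : 3^-1 <= 16 / 3 * (pi^-1 * pi^-1) :> R by lra.
  split => //; rewrite bE.
    by rewrite (lt_le_trans _ b3)// invr_gt0.
  move=> u u0 bu; rewrite addr0 subr0 divr1 mulr1.
  have u3 : 3^-1 * u < 1 by rewrite (le_lt_trans _ bu)// ler_wpM2r.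
  rewrite (le_trans (gap_factor_le0 _))//; first by apply/andP; split => //; lra.
  rewrite ler_wpM2l ?divr_ge0 ?sqr_ge0// lef_pV2 ?posrE; last by lra.
    by rewrite lerD2l lerN2 (mulrC u) ler_wpM2r.
  by lra.
have e0 : 0 < 1 - lam by rewrite subr_gt0.
have bE : 8 / pi / (1 - lam) * (4 / pi) = 32 * (pi^-1 * pi^-1) / (1 - lam) :> R.
  by move: (@pi_gt0 R); move: (pi : R) => p p0; field; rewrite !gt_eqF.
have b2 : 2 / (1 - lam) <= 32 * (pi^-1 * pi^-1) / (1 - lam).
  by rewrite ler_wpM2r ?invr_ge0 ?(ltW e0)//; lra.
have b20 : 0 < 2 / (1 - lam) by rewrite divr_gt0.
have b0 := lt_le_trans b20 b2.
split => //; rewrite bE //.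
  move=> _; have lp : 0 < lam by rewrite lt_def lam0.
  have : 1 - lam <= ln (1 / lam).
    rewrite div1r lnV ?posrE//.
    have h : ln (1 + (lam - 1)) <= lam - 1 by apply: le_ln1Dx; lra.
    by rewrite addrC subrK in h; rewrite lerNr opprB.
  apply: lt_le_trans; rewrite (@le_lt_trans _ _ (2 / (1 - lam))^-1)//.
    by rewrite lef_pV2 ?posrE.
  by rewrite invf_div ltr_pdivrMr//; lra.
move=> u u0 bu.
have ul : 2 * u < 1 - lam.
  have : 2 / (1 - lam) * u < 1 by rewrite (le_lt_trans _ bu)// ler_wpM2r.
  by rewrite mulrAC ltr_pdivrMr// mul1r.
rewrite (le_trans (gap_factor_le _ u0 ul)) ?l0//.
rewrite ler_wpM2l; first by [].
  rewrite mulr_ge0 ?divr_ge0 ?sqr_ge0 ?(ltW e0)//; exact: addr_ge0.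
rewrite lef_pV2 ?posrE.
- by rewrite lerD2l lerN2 mulrAC ler_wpM2r.
- by rewrite subr_gt0 ltr_pdivrMr ?mul1r.
- by rewrite subr_gt0.
Qed.

Lemma optimal_parameter (lam v tau : R) : 0 <= lam < 1 -> 0 <= v -> 0 < tau ->
  exists u, [/\ 0 < u, lam != 0 -> u < ln (1 / lam) &
    v * gap_factor lam (u / 2) - u * tau <=
      - (tau ^+ 2 / 2) / (alpha_gap lam * v + beta_gap lam * (4 / pi) * tau)].
Proof.
move=> l01 v0 tau0; have [b [<- b0 bln gap]] := gap_factor_quadratic l01.
have /andP[l0 l1] := l01.
have a0 : 0 < alpha_gap lam by rewrite divr_gt0 ?subr_gt0// ltr_wpDr.
have bt0 : 0 < b * tau by rewrite mulr_gt0.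
have av0 : 0 <= alpha_gap lam * v by rewrite mulr_ge0// ltW.
have D0 : 0 < alpha_gap lam * v + b * tau by rewrite ltr_wpDl.
set D := alpha_gap lam * v + b * tau in D0 *.
(* The usual choice for a Bernstein bound: 1 - b u = alpha v/D, so for v > 0 the quadratic term is
   exactly half of u tau. *)
exists (tau / D); split; first by rewrite divr_gt0.
  move=> /bln; apply: le_lt_trans.
  by rewrite ler_pdivrMr// mulrC ler_pdivlMr// mulrC lerDr.
have u0 : 0 <= tau / D by exact: divr_ge0 (ltW tau0) (ltW D0).
have half : v * gap_factor lam (tau / D / 2) <= tau / D * tau / 2.
  have [v00|vn0] := eqVneq v 0.
    by rewrite v00 mul0r divr_ge0// mulr_ge0 ?(ltW tau0).
  have vp : 0 < v by rewrite lt_def vn0.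
  have bu : b * (tau / D) < 1.
    by rewrite mulrA ltr_pdivrMr// mul1r /D ltrDr mulr_gt0.
  rewrite (le_trans (ler_wpM2l v0 (gap _ u0 bu)))//.
  have -> : 1 - b * (tau / D) = alpha_gap lam * v / D.
    by rewrite /D; field; rewrite gt_eqF.
  rewrite le_eqVlt; apply/predU1P; left; field.
  by rewrite !gt_eqF.
rewrite (le_trans (lerB half (lexx _)))//.
by rewrite le_eqVlt; apply/predU1P; left; field; rewrite gt_eqF.
Qed.

End OptimalParameter.

(** * Proof of the two inequalities *)

Lemma bm_det (disp : measure_display) (T : measurableType disp) (R : realType) n
    (X : T -> 'M[R]_n) : bounded_measurable_mx X ->
  bounded_measurable (fun x => \det (X x)).
Proof.
move=> bX; apply: bm_sum => p; apply: bmZ.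
elim: (index_enum _) => [|i r IH]; first by under eq_fun do rewrite big_nil; exact: bm_cst.
by under eq_fun do rewrite big_cons; exact: bmM.
Qed.

Theorem theorem2p6 (R : realType)
  (disp disp' : measure_display)
  (T : measurableType disp) (Omega : measurableType disp')
  (P : R.-pker T ~> T) (mu : probability T R)
  (mu_stationary : stationary P mu)
  (lam : R) (lamE : kernel_lambda P mu = lam%:E) (lam_lt1 : lam < 1)
  (n : nat) (n_gt0 : (0 < n)%N)
  (Pr : probability Omega R) (s : 'I_n -> {mfun Omega >-> T})
  (s_chain : markov_chain Pr P mu s)
  (d : nat) (d_gt0 : (0 < d)%N)
  (F : 'I_n -> T -> 'M[R]_d) (V : 'I_n -> R) (M : R)
  (F_measurable : forall (j : 'I_n) (a b : 'I_d),
     measurable_fun [set: T] (fun x : T => F j x a b))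
  (F_sym : forall (j : 'I_n) (x : T), (F j x)^T = F j x)
  (F_mean : forall j : 'I_n, mx_expectation mu (F j) = 0)
  (F_var : forall j : 'I_n,
     spectral_norm (mx_expectation mu (fun x : T => F j x ^+ 2)) <= V j)
  (M_gt0 : 0 < M)
  (F_bound : forall (j : 'I_n) (x : T), spectral_norm (F j x) <= M) :
  let sigma2 : R := \sum_(j < n) V j in
  (forall theta : R, 0 < theta ->
     (lam != 0 -> theta < ln (1 / lam) / M) ->
     ('E_Pr[(fun w : Omega =>
        (frobenius_norm (\prod_(j < n) expmx ((theta / 2) *: F j (s j w))) ^+ 2)%R)]
      <= (d%:R *
          expR (sigma2 / M ^+ 2 * (expR (M * theta) - M * theta - 1)
                + sigma2 / M ^+ 2 *
                  (lam * (expR (M * theta) - 1) ^+ 2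
                   / (1 - lam * expR (M * theta)))))%:E)%E)
  /\
  (forall t : R, 0 < t ->
     (Pr [set w | (t <= lambda_max (\sum_(j < n) F j (s j w)))%R]
      <= (d%:R `^ (2 - pi / 4) *
          expR (- (t ^+ 2 / (32 / pi ^+ 2)) /
                (alpha_gap lam * sigma2 + beta_gap lam * M * t)))%:E)%E).
Proof.
destruct n as [|n] => // sigma2; split => [theta theta0 theta_gap|t t0].
  rewrite (le_trans (first_inequality mu_stationary lamE s_chain F_measurable F_sym
    F_mean F_var M_gt0 F_bound theta0 theta_gap))// lee_fin ler_wpM2l// ler_expR.
  rewrite /gap_factor -mulrDr; have -> : 2 * (theta * M / 2) = M * theta by field.
  by rewrite [_ - 1 - M * theta]addrAC.
pose S w := \sum_(j < n.+1) F j (s j w).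
have bS : bounded_measurable_mx S.
  apply: bmx_sum => j a b; apply: (bm_comp (f := fun y => F j y a b)) => //.
  exact: (bmx_F F_measurable M_gt0 F_bound).
set E := [set w | _].
(* The event is restated through roots of the characteristic polynomial, whose values are
   determinants and hence measurable. *)
have EE : E = [set w | exists2 a, t <= a & root (char_poly (S w)) a].
  apply/seteqP; split => w /=.
    by move=> /(lambda_max_ge _ t0)[a ta]; rewrite eigenvalue_root_char; exists a.
  by move=> [a ta Sa]; apply/(lambda_max_ge _ t0); exists a; rewrite ?eigenvalue_root_char.
have mE : measurable E.
  rewrite EE; apply: measurable_root_ge => a.
  under eq_fun do rewrite horner_char_poly.
  have [] // : bounded_measurable (fun w => \det (a%:M - S w)).
  by apply: bm_det; apply: bmxB => //; exact: bmx_cst.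
have E_eigen w : E w -> exists a (v : 'rV[R]_d),
    [/\ t <= a, mxdot v v = 1 & v *m (\sum_j F j (s j w)) = a *: v].
  move=> /(lambda_max_ge _ t0)[a ta /unit_eigenvector[v v1 va]].
  by exists a, v.
have l01 : 0 <= lam < 1 by rewrite (kernel_lambda_ge0 lamE).
have sig0 : 0 <= sigma2 / M ^+ 2.
  by rewrite divr_ge0 ?sqr_ge0// sumr_ge0// => j _; exact: variance_ge0 F_var j.
(* With theta = u / M the tail exponent theta t pi/4 is u tau for tau = (pi/4) t/M, and tau^2/2 =
   pi^2 t^2/(32 M^2) is the origin of 32/pi^2. *)
have tau0 : 0 < pi / 4 * t / M :> R by rewrite divr_gt0// mulr_gt0// divr_gt0// pi_gt0.
have [u [u0 uln uE]] := optimal_parameter l01 sig0 tau0.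
have theta0 : 0 < u / M by rewrite divr_gt0.
have theta_gap : lam != 0 -> u / M < ln (1 / lam) / M by move=> /uln; rewrite ltr_pM2r// invr_gt0.
rewrite (le_trans (tail_bound mu_stationary lamE s_chain F_measurable F_sym
    F_mean F_var M_gt0 F_bound theta0 theta_gap mE (ltW t0) E_eigen))// lee_fin.
rewrite -mulrA -expRD; apply: ler_pM; rewrite ?expR_ge0//.
  (* The factor obtained is d, and d <= d^(2 - pi/4) because d >= 1 and pi <= 4. *)
  rewrite -[leLHS]powRr1// ler_powR ?ler1n//.
  by have := @pi_le4 R; lra.
rewrite ler_expR; have -> : u / M * M / 2 = u / 2 by rewrite divfK// gt_eqF.
have -> : u / M * t * (pi / 4) = u * (pi / 4 * t / M) by rewrite mulrAC -!mulrA; congr (_ * _); ring.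
rewrite (le_trans uE)// le_eqVlt; apply/predU1P; left.
move: (@pi_gt0 R) (alpha_gap lam) (beta_gap lam); move: (pi : R) => p p0 al be.
have -> : al * (sigma2 / M ^+ 2) + be * (4 / p) * (p / 4 * t / M) =
    (al * sigma2 + be * M * t) / M ^+ 2 by field; rewrite !gt_eqF.
rewrite invfM invrK; move: (al * sigma2 + be * M * t)^-1 => D.
by field; rewrite !gt_eqF.
Qed.
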